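(* If $\alpha,\beta:\mathbf{F}_n\curvearrowright(X,\mu)$ are hyperfinite actions (i.e. their underlying graphings are hyperfinite) and $type(\alpha)=type(\beta)$, then $\alpha$ and $\beta$ are strongly equivalent.
   Context: $\mathbf{F}_n$ is the free group on $\{s_1,\dots,s_n\}$. All actions are probability measure preserving (p.m.p.) Borel actions on standard Borel probability spaces; they need not be free. The underlying graphing of a p.m.p. Borel action of $\mathbf{F}_n$ on $(X,\mu)$ has vertex set $X$ and an edge between $x$ and $y$ whenever $x\ne y$ and $y=sx$ for some $s\in S=\{s_1^{\pm1},\dots,s_n^{\pm1}\}$. It is hyperfinite if for every $\epsilon>0$ there are $K>0$ and a Borel set $Z\subset X$ with $\mu(Z)<\epsilon$ such that after removing all edges incident to $Z$ all components have at most $K$ vertices. $\Sigma_n$ is the compact space of all rooted Schreier graphs of transitive actions of $\mathbf{F}_n$ on countable sets, i.e. connected rooted graphs with edge labels from $\{s_1^{\pm1},\dots,s_n^{\pm1}\}$, the edge $(x,s_ix)$ being labeled $s_i$ (up to rooted labeled isomorphism). For a p.m.p. Borel action $\alpha:\mathbf{F}_n\curvearrowright(X,\mu)$, $\pi_\alpha:X\to\Sigma_n$ maps $x$ to the Schreier graph of its orbit with root $x$, and $type(\alpha)=(\pi_\alpha)_*(\mu)$. Actions $\alpha$ on $(X,\mu)$ and $\beta$ on $(Y,\nu)$ are strongly equivalent if for every $\epsilon>0$ there is a measure preserving bijection $\rho_\epsilon:X\to Y$ such that $\mu(\{x\in X:\rho_\epsilon(\alpha(s)x)=\beta(s)\rho_\epsilon(x)\text{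 for every }s\in S\})>1-\epsilon$.
   Formalization: The probability space is assumed non-atomic (every point has measure zero); with atoms of unequal mass the claim fails, e.g. when α swaps two atoms of mass 1/4 and β instead swaps two pairs of atoms of mass 1/8. *)

(* Defs.v *)
(* MathComp / MathComp-Analysis. *)
From HB Require Import structures.
From mathcomp Require Import all_boot all_order all_algebra generic_quotient.
From mathcomp Require Import all_classical all_reals all_analysis.
From Stdlib Require Import Relation_Operators.

Set Implicit Arguments.
Unset Strict Implicit.
Unset Printing Implicit Defensive.

Import Order.TTheory GRing.Theory Num.Theory.

Local Open Scope classical_set_scope.
Local Open Scope quotient_scope.
Local Open Scope card_scope.

(** * The free group on [n] generators, as reduced words *)

(* The symmetric generating set S: [(i, false)] is s_i and [(i, true)] is its
   inverse. *)
Definition letter (n : nat) : Type := ('I_n * bool)%type.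
HB.instance Definition _ n := Finite.on (letter n).

Section FreeGroup.
Variable n : nat.
Implicit Types (s t : letter n) (u v w : seq (letter n)).

Definition linv s : letter n := (s.1, ~~ s.2).

Definition reduced w := sorted (fun s t => t != linv s) w.

Definition push s w :=
  if w is t :: w' then if t == linv s then w' else s :: w else [:: s].

Lemma linvK : involutive linv.
Proof. by case=> i b; rewrite /linv /= negbK. Qed.

Lemma reduced_behead s w : reduced (s :: w) -> reduced w.
Proof. by case: w => //= t w /andP[]. Qed.

Lemma push_reduced s w : reduced w -> reduced (push s w).
Proof.
case: w => //= t w rw; case: ifPn => [_|ts]; first exact: reduced_behead rw.
by rewrite /reduced /= ts.
Qed.

Lemma foldr_reduced u w : reduced w -> reduced (foldr push w u).
Proof. by move=> rw; elim: u => //= s u; exact: push_reduced. Qed.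

Lemma push_id s w : reduced (s :: w) -> push s w = s :: w.
Proof. by case: w => //= t w /andP[/negPf ->]. Qed.

Lemma pushK s w : reduced w -> push s (push (linv s) w) = w.
Proof.
case: w => [|t w] rw /=; first by rewrite eqxx.
rewrite linvK; case: eqP => [ts|_]; last by rewrite /= eqxx.
by subst t; exact: push_id.
Qed.

Lemma foldr_push w s u : reduced w ->
  foldr push w (push s u) = push s (foldr push w u).
Proof.
move=> rw; case: u => [|t u] //=; case: eqP => //= ->.
by rewrite pushK //; exact: foldr_reduced.
Qed.

Record free_group := FreeWord {word :> seq (letter n); _ : reduced word}.
HB.instance Definition _ := [isSub for word].
HB.instance Definition _ := [Countable of free_group by <:].

Implicit Types g h k : free_group.

Lemma word_reduced g : reduced g. Proof. by case: g. Qed.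

Definition fg_one := @FreeWord [::] isT.
Definition fg_mul g h := FreeWord (foldr_reduced g (word_reduced h)).

Lemma fg_inv_subproof g : reduced (rev (map linv g)).
Proof.
rewrite /reduced rev_sorted sorted_map.
apply: sub_sorted (word_reduced g) => s t /=; rewrite linvK.
by apply: contra => /eqP ->.
Qed.
Definition fg_inv g := FreeWord (fg_inv_subproof g).

Lemma fg_mulA : associative fg_mul.
Proof.
move=> g h k; apply/val_inj => /=; elim: (g : seq _) => //= s u ->.
by rewrite foldr_push //; exact: word_reduced.
Qed.

Lemma fg_mul1 : left_id fg_one fg_mul.
Proof. by move=> g; exact: val_inj. Qed.

Lemma fg_mulr1 : right_id fg_one fg_mul.
Proof.
move=> g; apply/val_inj => /=; have := word_reduced g.
elim: (g : seq _) => //= s u IHu rsu.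
by rewrite (IHu (reduced_behead rsu)) push_id.
Qed.

Lemma fg_mulV : left_inverse fg_one fg_inv fg_mul.
Proof.
move=> g; apply/val_inj => /=; elim: (g : seq _) => //= s u IHu.
by rewrite rev_cons foldr_rcons /= linvK eqxx.
Qed.

Lemma fg_invK : involutive fg_inv.
Proof.
move=> g; apply/val_inj => /=.
by rewrite map_rev revK -map_comp map_id_in // => s _; exact: linvK.
Qed.

Lemma fg_mulrV : right_inverse fg_one fg_inv fg_mul.
Proof. by move=> g; rewrite -{1}(fg_invK g) fg_mulV. Qed.

HB.instance Definition _ := isGroup.Build free_group
  fg_mulA fg_mul1 fg_mulr1 fg_mulV fg_mulrV.

Definition gen s : free_group := @FreeWord [:: s] isT.

Lemma gen_linv s : (gen (linv s) = (gen s)^-1)%g.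
Proof. exact: val_inj. Qed.

End FreeGroup.

Record gaction (n : nat) (T : Type) := GAction {
  act :> free_group n -> T -> T;
  act1 : forall x, act 1%g x = x;
  actM : forall g h x, act (g * h)%g x = act g (act h x)
}.

Definition gorbit n T (a : gaction n T) (x : T) : set T :=
  range (fun g : free_group n => a g x).

(** * Rooted graphs with edges labeled by the letters *)

(* The vertices are a subset of the ambient type [T]; [edge s x y] says that
   there is an edge labeled [s] from [x] to [y]. *)
Record rgraph (n : nat) (T : Type) := RGraph {
  vert : set T;
  edge : letter n -> T -> T -> Prop;
  root : T
}.
HB.instance Definition _ n T := gen_eqMixin (rgraph n T).
HB.instance Definition _ n T := gen_choiceMixin (rgraph n T).

(* [edge] is only inspected between vertices. *)
Definition rgraph_iso n T U (G : rgraph n T) (H : rgraph n U) : Prop :=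
  exists f : T -> U, [/\ set_bij (vert G) (vert H) f,
    f (root G) = root H &
    forall s x y, vert G x -> vert G y ->
      (edge G s x y <-> edge H s (f x) (f y))].

Definition schreier_graph n T (a : gaction n T) (x : T) : rgraph n T :=
  RGraph (gorbit a x) (fun s y z => gorbit a x y /\ z = a (gen s) y) x.

Fixpoint ball_vert n T (G : rgraph n T) (r : nat) : set T :=
  if r is r'.+1 then
    ball_vert G r' `|` [set y | exists s x, ball_vert G r' x /\ edge G s x y]
  else [set root G].

Definition ball_graph n T (G : rgraph n T) (r : nat) : rgraph n T :=
  RGraph (ball_vert G r)
    (fun s x y => [/\ ball_vert G r x, ball_vert G r y & edge G s x y])
    (root G).

(** * The space of rooted Schreier graphs *)

(* Up to isomorphism, the vertex set of a Schreier graph of a transitive action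
   on a countable set is a subset [V] of [nat]; since an action on [V] extends
   by the identity to [nat], these graphs are the Schreier graphs of the orbits
   of the actions on [nat]. *)
Definition schreier_rgraph (n : nat) : Type :=
  [set G : rgraph n nat | exists (a : gaction n nat) x, G = schreier_graph a x].
HB.instance Definition _ n := Choice.on (schreier_rgraph n).

Lemma rooted_schreier_subproof n (a : gaction n nat) (x : nat) :
  schreier_graph a x \in
    [set G | exists (a : gaction n nat) x, G = schreier_graph a x].
Proof. by apply/mem_set; exists a, x. Qed.

Definition rooted_schreier n (a : gaction n nat) (x : nat) : schreier_rgraph n :=
  SigSub (rooted_schreier_subproof a x).

Lemma rgraph_iso_refl n T (G : rgraph n T) : rgraph_iso G G.
Proof. by exists id; split => //; split => // x Gx; exists x. Qed.

Lemma rgraph_iso_sym n T U (G : rgraph n T) (H : rgraph n U) :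
  vert G (root G) -> rgraph_iso G H -> rgraph_iso H G.
Proof.
move=> Groot [f [[fGH finj fsurj] froot fedge]].
have [g gP] : exists g : U -> T, forall y, vert H y -> vert G (g y) /\ f (g y) = y.
  suff /choice[g gP] : forall y, exists x, vert H y -> vert G x /\ f x = y.
    by exists g.
  move=> y; have [Hy|nHy] := pselect (vert H y); last by exists (root G).
  by have [x Gx fx] := fsurj y Hy; exists x.
have gf x : vert G x -> g (f x) = x.
  move=> Gx; have [Ggf fgf] := gP _ (fGH _ Gx).
  by apply: finj => //; exact/mem_set.
exists g; split.
- split.
  + by move=> y /gP[].
  + move=> y z /set_mem/gP[_ fy] /set_mem/gP[_ fz] gyz.
    by rewrite -fy -fz gyz.
  + by move=> x Gx; exists (f x); [exact: fGH | exact: gf].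
- by rewrite -froot gf.
- move=> s y z Hy Hz; have [Gy fy] := gP _ Hy; have [Gz fz] := gP _ Hz.
  by rewrite fedge // fy fz.
Qed.

Lemma rgraph_iso_trans n T U W
    (G : rgraph n T) (H : rgraph n U) (K : rgraph n W) :
  rgraph_iso G H -> rgraph_iso H K -> rgraph_iso G K.
Proof.
move=> [f [[fGH finj fsurj] froot fedge]] [g [[gHK ginj gsurj] groot gedge]].
exists (g \o f); split.
- split.
  + by move=> x Gx; exact/gHK/fGH.
  + move=> x y Gx Gy /= gfxy; apply: finj => //.
    by apply: ginj => //; apply/mem_set/fGH/set_mem.
  + move=> z /gsurj[y Hy <-]; have [x Gx <-] := fsurj _ Hy.
    by exists x.
- by rewrite /= froot.
- by move=> s x y Gx Gy; rewrite fedge // gedge //; exact: fGH.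
Qed.

Lemma schreier_rgraph_root n (G : schreier_rgraph n) :
  vert (val G) (root (val G)).
Proof.
have [a [x ->]] := set_mem (valP G).
by exists 1%g => //; rewrite act1.
Qed.

Definition schreier_iso n (G H : schreier_rgraph n) : bool :=
  `[< rgraph_iso (val G) (val H) >].

Lemma schreier_iso_refl n : reflexive (@schreier_iso n).
Proof. by move=> G; apply/asboolP; exact: rgraph_iso_refl. Qed.

Lemma schreier_iso_sym n : symmetric (@schreier_iso n).
Proof.
by move=> G H; apply/asboolP/asboolP => /rgraph_iso_sym; apply;
  exact: schreier_rgraph_root.
Qed.

Lemma schreier_iso_trans n : transitive (@schreier_iso n).
Proof.
by move=> H G K /asboolP GH /asboolP HK; apply/asboolP/(rgraph_iso_trans GH HK).
Qed.

Canonical schreier_equiv n := EquivRel (@schreier_iso n)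
  (@schreier_iso_refl n) (@schreier_iso_sym n) (@schreier_iso_trans n).

Definition Sigma (n : nat) : Type := {eq_quot (schreier_equiv n)}.
HB.instance Definition _ n := Quotient.on (Sigma n).
HB.instance Definition _ n := Choice.on (Sigma n).

Definition trivial_gaction n T : gaction n T :=
  @GAction n T (fun _ x => x) (fun _ => erefl) (fun _ _ _ => erefl).

HB.instance Definition _ n :=
  isPointed.Build (Sigma n)
    (\pi_(Sigma n) (rooted_schreier (trivial_gaction n nat) 0%N)).

(* The rooted graphs having the same ball of radius [p.2] as [p.1]. *)
Definition cylinder n (p : Sigma n * nat) : set (Sigma n) :=
  [set t | rgraph_iso (ball_graph (val (repr p.1)) p.2)
                      (ball_graph (val (repr t)) p.2)].

HB.instance Definition _ n :=
  isSubBaseTopological.Build (Sigma n) setT (@cylinder n).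

Definition borel_Sigma (n : nat) := g_sigma_algebraType (@open (Sigma n)).

Lemma gorbit_act n T (a : gaction n T) x g y : gorbit a x y -> gorbit a x (a g y).
Proof. by move=> [h _ <-]; exists (g * h)%g => //; rewrite actM. Qed.

Lemma countable_gorbit n T (a : gaction n T) x : countable (gorbit a x).
Proof. by apply: (card_le_trans (card_image_le _ _)); exact: countableP. Qed.

Lemma schreier_coding n T (a : gaction n T) (x : T) :
  exists G : schreier_rgraph n, rgraph_iso (val G) (schreier_graph a x).
Proof.
have ax : gorbit a x x by exists 1%g => //; rewrite act1.
have /countable_injP[f inj] := countable_gorbit a x.
have finj y z : gorbit a x y -> gorbit a x z -> f y = f z -> y = z.
  by move=> ay az; apply: inj => //; exact/mem_set.
pose b g m := match pselect (exists2 y, gorbit a x y & f y = m) with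
  | left e => f (a g (s2val (cid2 e))) | right _ => m end.
have bf g y : gorbit a x y -> b g (f y) = f (a g y).
  move=> ay; rewrite /b; case: pselect => [e|]; last by case; exists y.
  by case: cid2 => z az /= /finj ->.
have bN g m : ~ (exists2 y, gorbit a x y & f y = m) -> b g m = m.
  by move=> nm; rewrite /b; case: pselect.
have b1 m : b 1%g m = m.
  have [[y ay <-]|nm] := pselect (exists2 y, gorbit a x y & f y = m).
    by rewrite bf // act1.
  exact: bN.
have bM g h m : b (g * h)%g m = b g (b h m).
  have [[y ay <-]|nm] := pselect (exists2 y, gorbit a x y & f y = m).
    by rewrite !bf ?actM //; exact: gorbit_act.
  by rewrite !bN.
exists (rooted_schreier (GAction b1 bM) (f x)).
apply: rgraph_iso_sym => //=; exists f; split => //.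
- split.
  + by move=> y [g _ <-]; exists g => //=; rewrite bf.
  + by move=> y z /set_mem ay /set_mem az; exact: finj.
  + by move=> m [g _ <-] /=; exists (a g x); [exists g | rewrite bf].
- move=> s y z ay az /=; rewrite bf //; split => [[_ ->]|[_ /finj ->]//].
    split=> //; case: ay => g _ <-; exists g => //=; exact: bf.
  exact: gorbit_act.
Qed.

(* The isomorphism class of the Schreier graph of the orbit of [x], rooted at
   [x]. *)
Definition orbit_type n T (a : gaction n T) (x : T) : Sigma n :=
  \pi_(Sigma n) (projT1 (cid (schreier_coding a x))).

Lemma orbit_typeP n T (a : gaction n T) (x : T) (G : schreier_rgraph n) :
  orbit_type a x = \pi_(Sigma n) G <-> rgraph_iso (val G) (schreier_graph a x).
Proof.
rewrite /orbit_type; case: cid => H Hx /=; split.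
  move/eqquotP/asboolP/rgraph_iso_sym => /(_ (schreier_rgraph_root H)) GH.
  exact: rgraph_iso_trans GH Hx.
move=> Gx; apply/eqquotP/asboolP/(rgraph_iso_trans Hx)/rgraph_iso_sym => //.
exact: schreier_rgraph_root.
Qed.

(** * Measure-theoretic notions *)

Definition standard_borel (R : realType) d (X : measurableType d) : Prop :=
  exists (P : completePseudoMetricType R) (f : X -> P),
    [/\ hausdorff_space P, (exists2 D : set P, countable D & dense D),
        bijective f &
        forall A : set X,
          measurable A <-> exists2 B, <<s @open P >> B & A = f @^-1` B].

(* On a standard Borel space, all atoms are singletons up to null sets. *)
Definition atomless (R : realType) d (X : measurableType d)
    (mu : probability X R) : Prop :=
  forall x : X, mu [set x] = 0%E.

Definition measure_preserving (R : realType) d d' (X : measurableType d)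
    (Y : measurableType d') (mu : probability X R) (nu : probability Y R)
    (f : X -> Y) : Prop :=
  measurable_fun setT f /\ forall B, measurable B -> mu (f @^-1` B) = nu B.

Definition pmp (R : realType) n d (X : measurableType d)
    (mu : probability X R) (a : gaction n X) : Prop :=
  forall g, measure_preserving mu mu (a g).

Definition graphing n T (a : gaction n T) (x y : T) : Prop :=
  x <> y /\ exists s, y = a (gen s) x.

(* The vertices of the component of [x] in the graphing once all edges incident
   to [Z] are removed (the vertices in [Z] remain, as isolated points). *)
Definition component n T (a : gaction n T) (Z : set T) (x : T) : set T :=
  clos_refl_trans T (fun y z => [/\ graphing a y z, ~ Z y & ~ Z z]) x.

Definition hyperfinite (R : realType) n d (X : measurableType d)
    (mu : probability X R) (a : gaction n X) : Prop :=
  forall e : R, (0 < e)%R -> exists (K : nat) (Z : set X),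
    [/\ (0 < K)%N, measurable Z, (mu Z < e%:E)%E &
        forall x, component a Z x #<= `I_K].

(* Only meant to be evaluated on measurable sets. *)
Definition action_type (R : realType) n d (X : measurableType d)
    (mu : probability X R) (a : gaction n X) : set (borel_Sigma n) -> \bar R :=
  pushforward mu (orbit_type a : X -> borel_Sigma n).

Definition same_type (R : realType) n d d' (X : measurableType d)
    (Y : measurableType d') (mu : probability X R) (nu : probability Y R)
    (a : gaction n X) (b : gaction n Y) : Prop :=
  forall B, measurable B -> action_type mu a B = action_type nu b B.

Definition strongly_equivalent (R : realType) n d d' (X : measurableType d)
    (Y : measurableType d') (mu : probability X R) (nu : probability Y R)
    (a : gaction n X) (b : gaction n Y) : Prop :=
  forall e : R, (0 < e)%R -> exists (rho : X -> Y) (rho' : Y -> X),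
    [/\ cancel rho rho', cancel rho' rho, measure_preserving mu nu rho,
        measure_preserving nu mu rho' &
        ((1 - e)%:E <
          mu [set x | forall s, rho (a (gen s) x) = b (gen s) (rho x)])%E].

(* Main.v *)
From mathcomp Require Import finmap.
From mathcomp Require Import all_boot all_order all_algebra generic_quotient.
From mathcomp Require Import all_classical all_reals all_analysis.
From mathcomp Require Import measurable_realfun ring lra.
From Stdlib Require Import Relation_Operators.
Require Import Defs.

(* A hyperfinite action is cut, up to small measure, into finite tiles, and a
   conjugacy up to [e] amounts to matching tiles of [a] with tiles of [b] having
   the same labeled shape. So it suffices to color [b] by a finite coloring whose
   local patterns are about as frequent as those of the tiling of [a]. To get
   it, tile [b] by much larger tiles and let each of them copy the colors that
   [a] puts around a random point having the same finite stabilizer type (the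
   traces of the stabilizer on finite subsets of the group, whose distribution
   is a function of the type of the action) as the root of the tile. Averaged
   over the tiles, this samples the points of [a] with density
     w = sum_i P(the root of x is g_i x | stabilizer type of g_i x),
   and, as the types of [x] and [g_i x] determine each other in the limit, an
   energy increment argument gives a scale at which [w] is close to 1 in mean.

   Tiles are matched by measure isomorphisms of subsets of the space, obtained
   by mapping almost all of a set to an interval along a lexicographic order. The
   resulting partial isomorphism is made bijective by closing up its finite
   chains; its one-sided infinite chains are null by recurrence. *)

(** Equality of types compares the two actions only through laws of finite stabilizer types, and
    translation does not respect the scale of these: the [M]-type of [g_i x] is a function of a
    larger type of [x] and determines only a smaller one. Hence three scales [M1], [M], [M2], with
    the [M]-type of [g_i x] lying between the [M1]-type and the [M2]-type of [x]. Given the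
    [M1]-type of [x], which does not involve [i], the probabilities of the indices [i] add up to
    exactly 1. When the energies at [M1] and [M2] nearly agree, conditioning on the intermediate
    type changes these probabilities little, and so [w] is close to 1 in mean. The number of indices
    is fixed by the tiling before the scales are chosen, so errors summed over [i] stay small. As
    stabilizers may be nontrivial, a local pattern has to record coincidences between translates and
    not only colors. A lower bound for each pattern frequency of [b] is enough: matching pattern by
    pattern loses only the deficit with respect to [a]. Standardness enters through large subsets
    whose sets of codes are closed; there every branch of cells is realized by a point. *)

Set Implicit Arguments.
Unset Strict Implicit.
Unset Printing Implicit Defensive.
Import Order.TTheory GRing.Theory Num.Theory.
Import numFieldNormedType.Exports.
Local Open Scope classical_set_scope.
Local Open Scope ring_scope.

(** * Measurable sets and real-valued probabilities *)

Section MeasurableSets.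
Context d (X : measurableType d).

(** This and the next rules follow the shape of a defining formula, with quantifiers over countable
    types; sets are kept in set-builder form below so that they apply connective by connective. *)
Lemma meas_ex (I : countType) (F : I -> set X) :
  (forall i, measurable (F i)) -> measurable [set x | exists i, F i x].
Proof.
move=> mF; rewrite (_ : [set x | _] = \bigcup_i F i).
  by apply: countable_bigcupT_measurable.
by apply/seteqP; split=> x /= [i]; [exists i | move=> _; exists i].
Qed.

Lemma meas_not (A : set X) : measurable A -> measurable [set x | ~ A x].
Proof. exact: measurableC. Qed.

Lemma meas_all (I : countType) (F : I -> set X) :
  (forall i, measurable (F i)) -> measurable [set x | forall i, F i x].
Proof.
move=> mF; rewrite (_ : [set x | _] = [set x | ~ exists i, ~ F i x]).
  by apply/meas_not/meas_ex => i; exact/meas_not.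
apply/seteqP; split=> x /=; first by move=> Fx [i]; apply.
by move=> nF i; apply: contrapT => nFi; apply: nF; exists i.
Qed.

Lemma meas_and (A B : set X) : measurable A -> measurable B ->
  measurable [set x | A x /\ B x].
Proof. exact: measurableI. Qed.

Lemma meas_or (A B : set X) : measurable A -> measurable B ->
  measurable [set x | A x \/ B x].
Proof. exact: measurableU. Qed.

Lemma meas_imp (A B : set X) : measurable A -> measurable B ->
  measurable [set x | A x -> B x].
Proof.
move=> mA mB; rewrite (_ : [set x | _] = (~` A) `|` B).
  by apply: measurableU => //; exact: measurableC.
apply/seteqP; split=> x /=; last by case.
by move=> AB; have [/AB|] := pselect (A x); [right | left].
Qed.

Lemma meas_iff (A B : set X) : measurable A -> measurable B ->
  measurable [set x | A x <-> B x].
Proof. by move=> mA mB; apply: meas_and; exact: meas_imp. Qed.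

Lemma meas_const (P : Prop) : measurable [set x : X | P].
Proof.
have [p|np] := pselect P.
  by rewrite (_ : [set _ | _] = setT) //; apply/seteqP; split.
by rewrite (_ : [set _ | _] = set0) //; apply/seteqP; split.
Qed.

Lemma meas_preim d' (Y : measurableType d') (f : X -> Y) (A : set Y) :
  measurable_fun setT f -> measurable A -> measurable [set x | A (f x)].
Proof. by move=> mf mA; rewrite -[X in measurable X]setTI; exact: mf. Qed.

(** For countable [I] this is measurability for the discrete sigma-algebra, without putting a
    measurable structure on finite function types and other codomains. *)
Definition discr_meas (I : Type) (f : X -> I) :=
  forall i, measurable (f @^-1` [set i]).

Lemma discr_meas_set (I : countType) (f : X -> I) (S : I -> Prop) :
  discr_meas f -> measurable [set x | S (f x)].
Proof.
move=> mf; rewrite (_ : [set x | _] = [set x | exists i, S i /\ f x = i]).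
  by apply: meas_ex => i; apply: meas_and; [exact: meas_const | exact: mf].
by apply/seteqP; split=> x /=; [exists (f x) | move=> [i [Si ->]]].
Qed.

Lemma discr_meas_comp (I J : countType) (f : X -> I) (g : I -> J) :
  discr_meas f -> discr_meas (g \o f).
Proof. by move=> mf j; exact: (@discr_meas_set _ f (fun i => g i = j)). Qed.

Lemma discr_meas_pair (I J : Type) (f : X -> I) (g : X -> J) :
  discr_meas f -> discr_meas g -> discr_meas (fun x => (f x, g x)).
Proof.
move=> mf mg [i j]; rewrite (_ : _ @^-1` _ = f @^-1` [set i] `&` g @^-1` [set j]).
  exact: measurableI.
by apply/seteqP; split=> x /= [-> ->].
Qed.

Lemma discr_meas_ffun (K : finType) (I : Type) (f : K -> X -> I) :
  (forall k, discr_meas (f k)) -> discr_meas (fun x => [ffun k => f k x]).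
Proof.
move=> mf h; rewrite (_ : _ @^-1` _ = [set x | forall k, f k x = h k]).
  by apply: meas_all => k; exact: mf.
apply/seteqP; split=> x /=; first by move=> <- k; rewrite ffunE.
by move=> fh; apply/ffunP => k; rewrite ffunE.
Qed.

Lemma discr_meas_bool (A : set X) : measurable A ->
  discr_meas (fun x => `[< A x >]).
Proof.
move=> mA b; rewrite (_ : _ @^-1` _ = [set x | A x <-> b]).
  by apply: meas_iff => //; exact: meas_const.
apply/seteqP; split=> x /=; first by move=> <-; split=> /asboolP.
move=> Ab; apply/idP/idP; first by move=> /asboolP/Ab.
by move=> /Ab/asboolP.
Qed.

Lemma meas_glue d' (Y : measurableType d') (I : countType) (c : X -> I)
    (f : I -> X -> Y) : discr_meas c -> (forall i, measurable_fun setT (f i)) ->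
  measurable_fun setT (fun x => f (c x) x).
Proof.
move=> mc mf _ B mB; rewrite setTI.
rewrite (_ : _ @^-1` _ = [set x | exists i, c x = i /\ B (f i x)]).
  by apply: meas_ex => i; apply: meas_and; [exact: mc | exact: meas_preim].
by apply/seteqP; split=> x /=; [exists (c x) | move=> [i [->]]].
Qed.

End MeasurableSets.

Lemma discr_meas_preim d d' (X : measurableType d) (Y : measurableType d') (I : Type)
  (f : Y -> I) (g : X -> Y) :
  measurable_fun setT g -> discr_meas f -> discr_meas (fun x => f (g x)).
Proof. by move=> mg mf i; exact: (meas_preim mg (mf i)). Qed.

Section RealProbability.
Context (R : realType) d (X : measurableType d) (mu : probability X R).
Implicit Types A B : set X.

Definition pr A : R := fine (mu A).

Lemma probability_inhabited : exists x : X, True.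
Proof.
apply: contrapT => nX; have := probability_setT mu; rewrite (_ : setT = set0).
  by rewrite measure0 => /esym/eqP; rewrite eqe oner_eq0.
by apply/seteqP; split=> x // _; case: nX; exists x.
Qed.

Lemma prE A : measurable A -> mu A = (pr A)%:E.
Proof. by move=> mA; rewrite fineK //; exact: fin_num_measure. Qed.

Lemma pr_ge0 A : 0 <= pr A. Proof. exact/fine_ge0/measure_ge0. Qed.

Lemma pr_set0 : pr set0 = 0. Proof. by rewrite /pr measure0. Qed.

Lemma pr_setT : pr setT = 1. Proof. by rewrite /pr probability_setT. Qed.

Lemma pr_le A B : measurable A -> measurable B -> A `<=` B -> pr A <= pr B.
Proof.
by move=> mA mB AB; rewrite -lee_fin -!prE //; apply: le_measure; rewrite ?inE.
Qed.

Lemma pr_le1 A : measurable A -> pr A <= 1.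
Proof. by move=> mA; rewrite -pr_setT; exact: pr_le. Qed.

Lemma prDI A B : measurable A -> measurable B ->
  pr A = pr (A `\` B) + pr (A `&` B).
Proof.
move=> mA mB; apply: EFin_inj; rewrite EFinD -!prE //.
- exact: measureDI.
- exact: measurableI.
- exact: measurableD.
Qed.

Lemma prU A B : measurable A -> measurable B -> A `&` B = set0 ->
  pr (A `|` B) = pr A + pr B.
Proof.
move=> mA mB AB; apply: EFin_inj; rewrite EFinD -!prE //; first exact: measureU.
exact: measurableU.
Qed.

Lemma prU_le A B : measurable A -> measurable B ->
  pr (A `|` B) <= pr A + pr B.
Proof.
move=> mA mB; rewrite -lee_fin EFinD -!prE //; first exact: measureU2.
exact: measurableU.
Qed.

Lemma prC A : measurable A -> pr (~` A) = 1 - pr A.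
Proof.
move=> mA; rewrite -pr_setT (prDI measurableT mA) setTI setTD addrK //.
Qed.

Lemma pr_sum (I : finType) (f : X -> I) A : discr_meas f -> measurable A ->
  pr A = \sum_i pr [set x | A x /\ f x = i].
Proof.
move=> mf mA.
have H (s : seq I) : uniq s ->
    pr [set x | A x /\ f x \in s] = \sum_(i <- s) pr [set x | A x /\ f x = i].
  elim: s => [|i s IH] /=.
    rewrite big_nil (_ : [set _ | _] = set0) ?pr_set0 //.
    by apply/seteqP; split=> x //= [].
  move=> /andP[iNs us]; rewrite big_cons -IH // -prU.
  - congr (pr _); apply/seteqP; split=> x /=.
      move=> [Ax]; rewrite inE => /orP[/eqP|]; by [left|right].
    by move=> [[Ax <-]|[Ax xs]]; split=> //; rewrite inE ?eqxx // xs orbT.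
  - by apply: meas_and => //; exact: mf.
  - by apply: meas_and => //; exact: (@discr_meas_set _ _ _ _ (fun i => i \in s)).
  - apply/seteqP; split=> x //= [[_ fi] [_]]; rewrite fi => iis.
    by rewrite iis in iNs.
rewrite -[RHS]H ?index_enum_uniq //; congr (pr _); apply/seteqP; split=> x /=.
  by move=> Ax; rewrite mem_index_enum.
by case.
Qed.

Lemma pr_ex_le (I : finType) (F : I -> set X) : (forall i, measurable (F i)) ->
  pr [set x | exists i, F i x] <= \sum_i pr (F i).
Proof.
move=> mF.
have H (s : seq I) : pr [set x | exists2 i, i \in s & F i x] <= \sum_(i <- s) pr (F i) /\
    measurable [set x | exists2 i, i \in s & F i x].
  elim: s => [|i s [IH IHm]] /=.
    rewrite (_ : [set _ | _] = set0) ?pr_set0 ?big_nil //.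
    by apply/seteqP; split=> x //= [].
  rewrite big_cons (_ : [set _ | _] = F i `|` [set x | exists2 i, i \in s & F i x]).
    by split; [apply: (le_trans (prU_le _ _)) => //; rewrite lerD2l | exact: measurableU].
  apply/seteqP; split=> x /=.
    by move=> [j]; rewrite inE => /orP[/eqP ->|]; [left|right; exists j].
  by move=> [Fx|[j js Fx]]; [exists i|exists j] => //; rewrite inE ?eqxx ?js ?orbT.
have [H1 _] := H (index_enum I); apply: le_trans H1.
rewrite le_eqVlt; apply/orP; left; apply/eqP; congr (pr _).
by apply/seteqP; split=> x /= [i]; [exists i; rewrite ?mem_index_enum | exists i].
Qed.

Lemma pr_countable_le (F : nat -> set X) e : 0 <= e ->
  (forall k, measurable (F k)) -> (forall k, pr (F k) <= e / (2 ^ k.+1)%:R) ->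
  pr [set x | exists k, F k x] <= e.
Proof.
move=> e0 mF Fe; rewrite -lee_fin -prE; last exact: meas_ex.
apply: (le_trans (measure_sigma_subadditive mu mF _ _)) => /=.
- exact: meas_ex.
- by move=> x [k Fx]; exists k.
apply: le_trans (epsilon_trick0 xpredT e0); apply: lee_nneseries => // k _.
by rewrite prE // lee_fin.
Qed.

Lemma pr_cvg_dec (F : nat -> set X) : (forall k, measurable (F k)) ->
  (forall k, F k.+1 `<=` F k) ->
  (pr (F k)) @[k --> \oo] --> pr [set x | forall k, F k x].
Proof.
move=> mF dF; have -> : [set x | forall k, F k x] = \bigcap_k F k.
  by apply/seteqP; split=> x /= Fx k *; exact: Fx.
apply: fine_cvg; rewrite -/(pr _) -prE; last exact: bigcapT_measurable.
apply: nonincreasing_cvg_mu => //.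
- by rewrite -ge0_fin_numE ?measure_ge0 //; exact: fin_num_measure.
- exact: bigcapT_measurable.
- by apply/nonincreasing_seqP => k; exact/subsetPset/dF.
Qed.

Lemma pr_cvg_inc (F : nat -> set X) : (forall k, measurable (F k)) ->
  (forall k, F k `<=` F k.+1) ->
  (pr (F k)) @[k --> \oo] --> pr [set x | exists k, F k x].
Proof.
move=> mF dF; have -> : [set x | exists k, F k x] = \bigcup_k F k.
  by apply/seteqP; split=> x /= [k]; [exists k | move=> _; exists k].
apply: fine_cvg; rewrite -/(pr _) -prE; last exact: bigcupT_measurable.
apply: nondecreasing_cvg_mu => //.
- exact: bigcupT_measurable.
- by apply/nondecreasing_seqP => k; exact/subsetPset/dF.
Qed.

Lemma pr_null_ex (F : nat -> set X) : (forall k, measurable (F k)) ->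
  (forall k, pr (F k) = 0) -> pr [set x | exists k, F k x] = 0.
Proof.
move=> mF F0; apply/eqP; rewrite eq_le pr_ge0 andbT.
by apply: pr_countable_le => // k; rewrite F0 mul0r.
Qed.

Lemma pr_null_sub A B : measurable A -> measurable B -> A `<=` B ->
  pr B = 0 -> pr A = 0.
Proof.
by move=> mA mB AB B0; apply/eqP; rewrite eq_le pr_ge0 andbT -B0 pr_le.
Qed.

Lemma pr_eq_ex (F G : nat -> set X) : (forall k, measurable (F k)) ->
  (forall k, measurable (G k)) -> (forall k, pr (F k) = pr (G k)) ->
  trivIset setT F -> trivIset setT G ->
  pr [set x | exists k, F k x] = pr [set x | exists k, G k x].
Proof.
move=> mF mG FG tF tG.
have E H : [set x | exists k : nat, H k x] = \bigcup_k (H k : set X).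
  by apply/seteqP; split=> x /= [k]; [exists k | move=> _; exists k].
apply: EFin_inj; rewrite -!prE; [|exact: meas_ex|exact: meas_ex].
rewrite !E !measure_bigcup //; apply: eq_eseriesr => k _.
by have := FG k; rewrite /pr => FGk;
  rewrite -[LHS]fineK ?fin_num_measure // FGk fineK // fin_num_measure.
Qed.

End RealProbability.

(** * Lexicographic cells of an atomless measure *)

Section Cells.
Context (R : realType) d (X : measurableType d) (mu : probability X R).
Variable (U : nat -> set X).
Hypothesis mU : forall k, measurable (U k).
Hypothesis sepU : forall x y, (forall k, U k x <-> U k y) -> x = y.
Hypothesis mu_atomless : forall x : X, mu [set x] = 0%E.
Local Notation pr := (pr mu).
Implicit Types (p : seq bool) (x y : X) (t : R).

(* Most recent bit first: the code of depth [k] is a suffix of the later ones. *)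
Fixpoint code x k : seq bool :=
  if k is k'.+1 then `[< U k' x >] :: code x k' else [::].

Lemma size_code x k : size (code x k) = k.
Proof. by elim: k => //= k ->. Qed.

Lemma code_inj x y : (forall k, code x k = code y k) -> x = y.
Proof.
move=> xy; apply: sepU => k; have /= [Uxy _] := xy k.+1.
by split=> /asboolP; [rewrite Uxy|rewrite -Uxy] => /asboolP.
Qed.

Section OneSet.
Variable A : set X.
Hypothesis mA : measurable A.

Fixpoint cell p : set X :=
  if p is b :: p' then cell p' `&` (if b then U (size p') else ~` U (size p'))
  else A.

(* The cells of a given depth are ordered lexicographically, and [lo p] is the
   total measure of those before [cell p]. *)
Fixpoint lo p : R :=
  if p is b :: p' then lo p' + (if b then pr (cell p' `\` U (size p')) else 0)
  else 0.

Lemma cellE p x : cell p x <-> A x /\ code x (size p) = p.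
Proof.
elim: p => [|b p IH] /=; first by split=> [|[]].
split.
  move=> [/IH[Ax ->]] bU; split=> //; congr (_ :: _).
  by case: b bU => /= bU; [exact/asboolP | exact/asboolPn].
move=> [Ax [bU cp]]; split; first exact/IH.
by case: b bU => /= [/asboolP|/asboolPn].
Qed.

Lemma measurable_cell p : measurable (cell p).
Proof.
by elim: p => //= b p IH; apply: measurableI => //; case: b => //; exact: measurableC.
Qed.

Lemma cell_sub b p : cell (b :: p) `<=` cell p.
Proof. by move=> x []. Qed.

Lemma cell_subA p : cell p `<=` A.
Proof. by move=> x /cellE[]. Qed.

Lemma pr_cell p :
  pr (cell p) = pr (cell (false :: p)) + pr (cell (true :: p)).
Proof. by rewrite /= -setDE -prDI //; exact: measurable_cell. Qed.

(** A cell occupies the interval of length its measure that starts at [lo]. The branch follows the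
    cells whose interval contains [t], going right when [t] has reached the left end of the right
    child. *)
Fixpoint branch t k : seq bool :=
  if k is k'.+1 then
    (lo (branch t k') + pr (cell (branch t k') `\` U k') <= t) :: branch t k'
  else [::].

Lemma size_branch t k : size (branch t k) = k.
Proof. by elim: k => //= k ->. Qed.

Lemma branch_bounds t k : 0 <= t < pr A ->
  lo (branch t k) <= t < lo (branch t k) + pr (cell (branch t k)).
Proof.
move=> tA; elim: k => [|k IH] /=; first by rewrite add0r.
have /= := pr_cell (branch t k); rewrite size_branch -setDE.
by case: (leP (lo (branch t k) + pr (cell (branch t k) `\` U k)) t) => /= ? H;
  move: H IH; rewrite -?setDE; lra.
Qed.

Lemma branch_unique t p : lo p <= t < lo p + pr (cell p) -> branch t (size p) = p.
Proof.
elim: p => [//|b p IH] /= H.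
have /= pE := pr_cell p; rewrite -?setDE in pE H.
have g1 := pr_ge0 mu (cell p `\` U (size p)).
have g2 := pr_ge0 mu (cell p `&` U (size p)).
have -> : branch t (size p) = p by apply: IH; case: b H => /=; rewrite -?setDE; lra.
congr (_ :: _); case: b H => /=; rewrite -?setDE => H; first by lra.
by apply/negbTE; rewrite -ltNge; lra.
Qed.

Lemma branchP t p : 0 <= t < pr A ->
  branch t (size p) = p <-> lo p <= t < lo p + pr (cell p).
Proof.
move=> tA; split; last exact: branch_unique.
move=> tp; have := branch_bounds (size p) tA; by rewrite tp.
Qed.

Lemma pr_subsingleton (B : set X) : measurable B ->
  (forall x y, B x -> B y -> x = y) -> pr B = 0.
Proof.
move=> mB Beq; have [[x Bx]|nB] := pselect (exists x, B x).
  rewrite (_ : B = [set x]) ?/pr ?mu_atomless //.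
  by apply/seteqP; split=> y /=; [move=> By; exact: Beq | move=> ->].
rewrite (_ : B = set0) ?pr_set0 //.
by apply/seteqP; split=> y // By; apply: nB; exists y.
Qed.

(** Nested cells shrink to at most one point because the [U k] separate points, and points are
    null. *)
Lemma pr_cell_cvg (q : nat -> seq bool) : (forall k, size (q k) = k) ->
  (forall k, behead (q k.+1) = q k) -> (pr (cell (q k))) @[k --> \oo] --> 0.
Proof.
move=> sq bq; have H := @pr_cvg_dec R d X mu (fun k => cell (q k)).
rewrite pr_subsingleton in H.
- apply: H => [k|k]; first exact: measurable_cell.
  by move: (sq k.+1) (bq k); case: (q k.+1) => //= b q' _ ->; exact: cell_sub.
- by apply: meas_all => k; exact: measurable_cell.
- move=> x y Bx By; apply: code_inj => k.
  have /cellE[_] := Bx k; have /cellE[_] := By k.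
  by rewrite sq => -> ->.
Qed.

Lemma lo_branch_cvg t : 0 <= t < pr A -> (lo (branch t k)) @[k --> \oo] --> t.
Proof.
move=> tA; have H := pr_cell_cvg (size_branch t) (fun k => erefl).
apply: (@squeeze_cvgr _ _ _ _ (fun k => t - pr (cell (branch t k))) (fun=> t)).
- by apply: nearW => k; have := branch_bounds k tA; lra.
- by rewrite -[X in _ --> X]subr0; apply: cvgB => //; exact: cvg_cst.
- exact: cvg_cst.
Qed.

(** The set measured by [lo p]: the part of [A] that precedes [cell p]. It grows along a branch. *)
Fixpoint below p : set X :=
  if p is b :: p' then below p' `|` (if b then cell p' `\` U (size p') else set0)
  else set0.

Lemma belowP p : [/\ measurable (below p), below p `<=` A,
  below p `&` cell p = set0 & pr (below p) = lo p].
Proof.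
elim: p => [|b p [IH1 IH2 IH3 IH4]] /=; first by rewrite pr_set0 set0I; split.
have mc := measurable_cell p.
have mD : measurable (cell p `\` U (size p)) by exact: measurableD.
have bc : below p `&` (cell p `\` U (size p)) = set0.
  by rewrite setDE setIA IH3 set0I.
case: b => /=; last first.
  by rewrite setU0 addr0; split.
split.
- exact: measurableU.
- by move=> x [bx|[cx _]]; [exact: IH2 | exact: cell_subA cx].
- apply/seteqP; split=> x //= [[bx|[cx nU]]] [cx' Ux] //.
  by have : (below p `&` cell p) x by []; rewrite IH3.
- by rewrite prU // IH4.
Qed.

(** The sets [below] along the branch of [t] increase and their measures [lo] converge to [t], so
    their union has measure [t]. *)
Lemma atomless_split t : 0 <= t <= pr A ->
  exists B, [/\ measurable B, B `<=` A & pr B = t].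
Proof.
move=> /andP[t0]; rewrite le_eqVlt => /orP[/eqP ->|tA].
  by exists A; split.
have tA' : 0 <= t < pr A by rewrite t0.
exists [set x | exists k, below (branch t k) x]; split.
- by apply: meas_ex => k; case: (belowP (branch t k)).
- by move=> x [k bx]; case: (belowP (branch t k)) => _ sub _ _; exact: sub bx.
- have H : pr (below (branch t k)) @[k --> \oo] -->
      pr [set x | exists k, below (branch t k) x].
    apply: pr_cvg_inc => k; first by case: (belowP (branch t k)).
    by move=> x /= ?; left.
  rewrite -(cvg_lim (@Rhausdorff R) H).
  rewrite -[RHS](cvg_lim (@Rhausdorff R) (lo_branch_cvg tA')).
  have -> // : (fun k => pr (below (branch t k))) = (fun k => lo (branch t k)).
  by apply/funext => k; case: (belowP (branch t k)).
Qed.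

End OneSet.

Lemma atomless_split_seq (V : finType) (w : V -> R) (v0 : V) (s : seq V) A :
  measurable A -> uniq s -> (forall v, 0 <= w v) -> \sum_(v <- s) w v = pr A ->
  exists f : X -> V, discr_meas f /\
    forall v, pr [set x | A x /\ f x = v] = if v \in s then w v else 0.
Proof.
move=> + + w0; elim: s A => [|v s IH] A mA /=.
  rewrite big_nil => _ A0; exists (fun=> v0); split.
    by move=> v; exact: (@meas_const _ _ (v0 = v)).
  move=> v; apply: (@pr_null_sub _ _ _ _ _ A) => //; last by move=> x [].
  by apply: meas_and => //; exact: meas_const.
move=> /andP[vs us]; rewrite big_cons => sA.
have s0 : 0 <= \sum_(v <- s) w v by exact: sumr_ge0.
have wv : 0 <= w v <= pr A by rewrite -sA w0 /= lerDl.
have [B [mB BA Bv]] := atomless_split mA wv.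
have mAB : measurable (A `\` B) by exact: measurableD.
have ABs : \sum_(v <- s) w v = pr (A `\` B).
  by have := prDI mu mA mB; rewrite -sA (setIidr BA) Bv addrC => /addIr.
have [f [mf fP]] := IH _ mAB us ABs.
have mBb := discr_meas_bool mB.
exists (fun x => if `[< B x >] then v else f x).
split.
  exact: (@discr_meas_comp _ _ _ _ _ (fun bv => if bv.1 then v else bv.2)
    (discr_meas_pair mBb mf)).
move=> v'; rewrite inE; have [->|v'v] /= := eqVneq v' v.
  rewrite (_ : [set _ | _] = B `|` [set x | (A `\` B) x /\ f x = v]).
    rewrite prU // ?fP ?(negbTE vs) ?addr0 //.
      by apply: meas_and => //; exact: mf.
    by apply/seteqP; split=> x //= [Bx [[]]].
  apply/seteqP; split=> x /=.
    by have [Bx|nB] := asboolP (B x) => -[Ax fx]; [left | right].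
  by move=> [Bx|[[Ax nB] fx]]; case: asboolP => // ?; split=> //; exact: BA.
rewrite -fP; congr (pr _); apply/seteqP; split=> x /=.
  have [Bx|nB] := asboolP (B x) => -[Ax fx] //.
  by rewrite fx eqxx in v'v.
by move=> [[Ax nB] fx]; case: asboolP.
Qed.

(** This supplies the random choices of the proof: splitting each fiber of [C] realizes any joint
    law whose first marginal is the law of [C]. *)
Lemma atomless_partition (J V : finType) (C : X -> J) (w : J -> V -> R) (v0 : V) :
  discr_meas C -> (forall j v, 0 <= w j v) ->
  (forall j, \sum_v w j v = pr [set x | C x = j]) ->
  exists f : X -> V, discr_meas f /\
    forall j v, pr [set x | C x = j /\ f x = v] = w j v.
Proof.
move=> mC w0 wC.
have /choice[f fP] j : exists f : X -> V, discr_meas f /\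
    forall v, pr [set x | C x = j /\ f x = v] = w j v.
  have [f [mf fP]] := @atomless_split_seq V (w j) v0 (index_enum V) _ (mC j)
    (index_enum_uniq _) (w0 j) (wC j).
  by exists f; split=> // v; rewrite fP mem_index_enum.
exists (fun x => f (C x) x); split=> [v|j v].
  rewrite (_ : _ @^-1` _ = [set x | exists j, C x = j /\ f j x = v]).
    by apply: meas_ex => j; apply: meas_and; [exact: mC | exact: (fP j).1].
  by apply/seteqP; split=> x /=; [exists (C x) | move=> [j [->]]].
rewrite -(fP j).2; congr (pr _).
by apply/seteqP; split=> x /= [<-].
Qed.

End Cells.

(** * Isomorphisms between sets of equal measure *)

Section Uniformize.
Context (R : realType) d (X : measurableType d) (mu : probability X R).
Variable (U : nat -> set X).
Hypothesis mU : forall k, measurable (U k).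
Hypothesis sepU : forall x y, (forall k, U k x <-> U k y) -> x = y.
Hypothesis genU : @measurable _ X = <<s range U >>.
Hypothesis mu_atomless : forall x : X, mu [set x] = 0%E.
Local Notation pr := (pr mu).
Local Notation code := (code U).
Implicit Types (p : seq bool) (x y : X) (t : R).

Definition cylinder_code p : set X := [set x | code x (size p) = p].

Lemma measurable_cylinder_code p : measurable (cylinder_code p).
Proof.
rewrite (_ : cylinder_code p = cell U setT p); first exact: measurable_cell.
by apply/seteqP; split=> x; rewrite cellE; [move=> /= ->|case].
Qed.

Lemma code_prefix x j k : (j <= k)%N -> code x j = drop (k - j) (code x k).
Proof.
elim: k => [|k IH]; first by rewrite leqn0 => /eqP ->.
rewrite leq_eqVlt => /orP[/eqP ->|]; first by rewrite subnn drop0.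
by rewrite ltnS => jk; rewrite subSn //= -IH.
Qed.

(** Two code cylinders are nested or disjoint; adjoining the empty set makes the family stable under
    intersection, as uniqueness of measures requires. *)
Let cyls : set (set X) := [set S | S = set0 \/ exists p, S = cylinder_code p].

Lemma measurable_cyls : @measurable _ X = <<s cyls >>.
Proof.
apply/seteqP; split; last first.
  apply: smallest_sub; first exact: sigma_algebra_measurable.
  by move=> S [->//|[p ->]]; exact: measurable_cylinder_code.
rewrite genU; apply: smallest_sub; first exact: smallest_sigma_algebra.
move=> _ [k _ <-].
rewrite (_ : U k = [set x | exists p, size p = k /\ cylinder_code (true :: p) x]).
  apply: (@meas_ex _ (g_sigma_algebraType cyls) _
    (fun p x => size p = k /\ cylinder_code (true :: p) x)) => p.
  apply: (@meas_and _ (g_sigma_algebraType cyls)); first exact: meas_const.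
  by apply: sub_sigma_algebra; right; exists (true :: p).
apply/seteqP; split=> x /=.
  move=> Ux; exists (code x k); rewrite size_code; split=> //.
  by rewrite /cylinder_code /= size_code; congr (_ :: _); exact/asboolP.
by move=> [p [<-]]; rewrite /cylinder_code /= => -[/asboolP].
Qed.

Lemma cyls_setI : setI_closed cyls.
Proof.
move=> S T [->|[p ->]] [->|[q ->]]; rewrite ?set0I ?setI0; try by left.
wlog pq : p q / (size p <= size q)%N => [H|].
  have [/H //|/ltnW/H] := leqP (size p) (size q).
  by rewrite setIC.
have [E|nE] := eqVneq (drop (size q - size p) q) p.
  right; exists q; apply/seteqP; split=> x; first by case.
  move=> qx; split=> //; rewrite /cylinder_code /= (code_prefix _ pq).
  by rewrite [code _ _]qx.
left; apply/seteqP; split=> x //= -[px qx].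
move/eqP: nE; apply; have qx' : code x (size q) = q := qx.
by rewrite -[X in drop _ X]qx' -code_prefix.
Qed.

Lemma eq_measure_codes (m1 m2 : {measure set X -> \bar R}) :
  (m1 setT < +oo)%E -> (forall p, m1 (cylinder_code p) = m2 (cylinder_code p)) ->
  forall S, measurable S -> m1 S = m2 S.
Proof.
move=> m1oo m12 S mS.
have cT : cylinder_code [::] = setT by apply/seteqP.
apply: (measure_unique cyls (fun=> setT)) => //.
- exact: measurable_cyls.
- exact: cyls_setI.
- by move=> _; right; exists [::].
- by rewrite bigcup_const.
- by move=> A [->|[p ->]]; rewrite ?measure0.
Qed.

(* The set of infinite codes of points of [A] is closed in the Cantor space. *)
Definition closed_code (A : set X) := forall q : nat -> seq bool,
  (forall k, behead (q k.+1) = q k) ->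
  (forall k, exists2 x, A x & code x k = q k) ->
  exists2 x, A x & forall k, code x k = q k.

Section OneSet.
Variable A : set X.
Hypothesis mA : measurable A.
Local Notation lo := (lo mu U A).
Local Notation cell := (cell U A).
Local Notation branch := (branch mu U A).

Lemma lo_bounds p : 0 <= lo p /\ lo p + pr (cell p) <= pr A.
Proof.
elim: p => [|b p [IH1 IH2]]; first by rewrite /= add0r.
have := pr_cell mu mU mA p; have := pr_ge0 mu (cell (true :: p)).
have := pr_ge0 mu (cell (false :: p)).
by case: b => /=; rewrite -?setDE; lra.
Qed.

(* On a set with closed code this plays the role of the distribution function of
   the lexicographic order; [unposition] below is its right inverse on the
   interval from 0 to [pr A], and it pushes Lebesgue measure to [mu]. *)
Definition position x : R := limn (fun k => lo (code x k)).

Lemma position_cvg x : lo (code x k) @[k --> \oo] --> position x.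
Proof.
apply: nondecreasing_is_cvgn.
  apply/nondecreasing_seqP => k /=; rewrite lerDl.
  by case: ifP => // _; exact: pr_ge0.
exists (pr A) => _ [k _ <-]; have [_] := lo_bounds (code x k).
by have := pr_ge0 mu (cell (code x k)); lra.
Qed.

Lemma measurable_position : measurable_fun setT position.
Proof.
apply: (@measurable_fun_cvg _ _ _ _ (fun k x => lo (code x k))).
  move=> k _ B mB; rewrite setTI.
  apply: (@discr_meas_set _ _ _ (fun x => code x k) (fun p => B (lo p))).
  move=> p; have [sp|sp] := eqVneq (size p) k.
    by have := measurable_cylinder_code p; rewrite /cylinder_code sp.
  rewrite (_ : _ @^-1` _ = set0) //; apply/seteqP; split=> x //= cx.
  by rewrite -cx size_code eqxx in sp.
by move=> x _; exact: position_cvg.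
Qed.

Hypothesis cA : closed_code A.

(** Each cell on the branch of [t] has positive measure, hence contains a point of [A], and
    closedness of the code merges these into one point with the whole branch as code. The constant
    value outside the interval keeps the map measurable. *)
Lemma unposition_ex : exists h : R -> X,
  (exists x0, forall t, ~~ (0 <= t < pr A) -> h t = x0) /\
  forall t, 0 <= t < pr A -> A (h t) /\ forall k, code (h t) k = branch t k.
Proof.
have [x0 _] := probability_inhabited mu.
suff /choice[h hP] : forall t, exists x, (~~ (0 <= t < pr A) -> x = x0) /\
    (0 <= t < pr A -> A x /\ forall k, code x k = branch t k).
  by exists h; split; [exists x0 => t /(hP t).1 | move=> t /(hP t).2].
move=> t; have [tA|tA] := boolP (0 <= t < pr A); last by exists x0.
have [//|k|x Ax xt] := cA (q := branch t); last by exists x.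
have := branch_bounds mU mA k tA => H.
have [x /cellE[Ax]] : exists x, cell (branch t k) x.
  apply: contrapT => nc; move: H; rewrite (_ : cell _ = set0).
    by rewrite pr_set0; lra.
  by apply/seteqP; split=> x // ?; apply: nc; exists x.
by rewrite size_branch; exists x.
Qed.

Definition unposition : R -> X := sval (cid unposition_ex).

Lemma unpositionP t : 0 <= t < pr A ->
  A (unposition t) /\ forall k, code (unposition t) k = branch t k.
Proof. by rewrite /unposition; case: cid => /= h [_]; apply. Qed.

Lemma unpositionK t : 0 <= t < pr A -> position (unposition t) = t.
Proof.
move=> tA; have [_ E] := unpositionP tA; rewrite /position.
have -> : (fun k => lo (code (unposition t) k)) = (fun k => lo (branch t k)).
  by apply/funext => k; rewrite E.
exact: (cvg_lim (@Rhausdorff R) (lo_branch_cvg mU sepU mu_atomless mA tA)).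
Qed.

Lemma unposition_code t p : 0 <= t < pr A ->
  cylinder_code p (unposition t) <-> lo p <= t < lo p + pr (cell p).
Proof.
by move=> tA; rewrite /cylinder_code /= (unpositionP tA).2 branchP.
Qed.

Lemma measurable_unposition : measurable_fun setT unposition.
Proof.
apply: (measurability _ measurable_cyls) => _ [_ [->|[p ->]] <-].
  by rewrite preimage_set0 setI0.
have [x0 x0P] : exists x0, forall t, ~~ (0 <= t < pr A) -> unposition t = x0.
  by rewrite /unposition; case: cid => /= h [].
rewrite setTI (_ : _ @^-1` _ =
   ([set` `[0, pr A[] `&` [set` `[lo p, lo p + pr (cell p)[]) `|`
   (~` [set` `[0, pr A[] `&` [set t | cylinder_code p x0])).
  apply: measurableU; apply: measurableI => //.
    by apply: measurableC.
  exact: meas_const.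
apply/seteqP; split=> t /=; rewrite !in_itv /=.
  have [tA|tA] := boolP (0 <= t < pr A); first by move=> /(unposition_code p tA); left.
  by rewrite x0P //; right; split=> //; exact/negP.
move=> [[tA tp]|[/negP tA cx]]; first exact/unposition_code.
by rewrite x0P.
Qed.

(** Both sides are finite measures in [S], and they agree on code cylinders, whose preimages are the
    intervals of the cells. *)
Lemma unposition_pushforward S : measurable S ->
  lebesgue_measure ([set` `[0, pr A[] `&` unposition @^-1` S) = (pr (A `&` S))%:E.
Proof.
move=> mS; have mI : measurable ([set` `[0, pr A[] : set R) by [].
rewrite -prE; last exact: measurableI.
pose m1 : {measure set X -> \bar R} :=
  measure_function_pushforward__canonical__measure_function_Measure
    (mrestr lebesgue_measure mI) measurable_unposition.
rewrite setIC (setIC A); suff : m1 S = mrestr mu mA S by [].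
apply: eq_measure_codes => //=; rewrite /pushforward /mrestr.
  rewrite preimage_setT setTI lebesgue_measure_itv /=.
  by case: ifP => _; rewrite ?sube0 ltry.
move=> p; have [l0 lA] := lo_bounds p.
rewrite (_ : _ `&` _ = [set` `[lo p, lo p + pr (cell p)[]).
  rewrite lebesgue_measure_itv /= lte_fin ltrDl.
  rewrite (_ : _ `&` A = cell p).
    rewrite prE; last exact: measurable_cell.
    case: ltP => H; first by rewrite -EFinD; congr (_%:E); lra.
    by congr (_%:E); apply/eqP; rewrite eq_le pr_ge0.
  by apply/seteqP; split=> x; [move=> [? ?]; exact/cellE | move=> /cellE[]].
apply/seteqP; split=> t /=; rewrite !in_itv /=; first by move=> [tp tA];
  exact/unposition_code.
move=> tp; have tA : 0 <= t < pr A by lra.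
by split=> //; exact/unposition_code.
Qed.

(** By separation, equality is a countable conjunction of conditions on the [U k]. *)
Lemma measurable_eq d' (Y : measurableType d') (f g : Y -> X) :
  measurable_fun setT f -> measurable_fun setT g ->
  measurable [set y | f y = g y].
Proof.
move=> mf mg; rewrite (_ : [set y | _] = [set y | forall k, U k (f y) <-> U k (g y)]).
  by apply: meas_all => k; apply: meas_iff; exact: meas_preim.
by apply/seteqP; split=> y /=; [move=> -> | exact: sepU].
Qed.

(** Here [position] and [unposition] invert each other. Every [unposition t] with [t] in the
    interval lies in this part, so it fills [A] up to a null set. *)
Definition uniform_part : set X :=
  [set x | A x /\ (0 <= position x < pr A /\ unposition (position x) = x)].

Lemma measurable_uniform_part : measurable uniform_part.
Proof.
apply: meas_and => //; apply: meas_and.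
  rewrite [X in measurable X](_ : _ = position @^-1` [set` `[0, pr A[]).
    by rewrite -[X in measurable X]setTI; exact: measurable_position.
  by apply/seteqP; split=> x /=; rewrite in_itv.
apply: measurable_eq => //; apply: measurableT_comp => //.
  exact: measurable_unposition.
exact: measurable_position.
Qed.

End OneSet.

(** The maps are total, so that they can be composed and iterated freely; only their values on [A]
    and [B] are constrained. Measure preservation of [g] follows, see [partial_iso_sym]. *)
Definition partial_iso (A B : set X) (f g : X -> X) : Prop :=
  [/\ measurable A /\ measurable B,
      measurable_fun setT f /\ measurable_fun setT g,
      forall x, A x -> B (f x) /\ g (f x) = x,
      forall y, B y -> A (g y) /\ f (g y) = y &
      forall S, measurable S -> pr [set x | A x /\ S (f x)] = pr (B `&` S)].

(** Both sets are parametrized by the interval from 0 to the smaller measure [m]; composing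
    [position] of one with [unposition] of the other matches points with the same parameter. *)
Lemma partial_iso_closed_code A B : measurable A -> measurable B ->
  closed_code A -> closed_code B ->
  exists A' B' f g, [/\ partial_iso A' B' f g, A' `<=` A, B' `<=` B &
    pr A' = Order.min (pr A) (pr B)].
Proof.
move=> mA mB cA cB.
pose m := Order.min (pr A) (pr B).
have mlA : m <= pr A by rewrite ge_min lexx.
have mlB : m <= pr B by rewrite ge_min lexx orbT.
pose part C mC cC : set X :=
  [set x | @uniform_part C mC cC x /\ position C x < m].
have partP C mC cC x : part C mC cC x ->
  [/\ C x, 0 <= position C x < m & unposition mC cC (position C x) = x].
  by move=> [[Cx [/andP[p0 pC] px]] pm]; rewrite p0.
have part_un C mC cC t : m <= pr C -> 0 <= t < m ->
  part C mC cC (unposition mC cC t) /\ position C (unposition mC cC t) = t.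
  move=> mlC tm; have tC : 0 <= t < pr C by lra.
  have [Ch _] := unpositionP mC cC tC; have E := unpositionK mC cC tC.
  by split=> //; rewrite /part /uniform_part /= !E; split; [split|case/andP: tm].
have mpart C mC cC : measurable (part C mC cC).
  apply: meas_and; first exact: measurable_uniform_part.
  rewrite [X in measurable X](_ : _ = position C @^-1` [set` `]-oo, m[]).
    by rewrite -[X in measurable X]setTI; exact: measurable_position.
  by apply/seteqP; split=> x /=; rewrite in_itv.
have mpush C mC cC S : m <= pr C -> measurable S ->
    (pr (part C mC cC `&` S))%:E =
    lebesgue_measure ([set` `[0, m[] `&` unposition mC cC @^-1` S).
  move=> mlC mS; have mS' : measurable (part C mC cC `&` S) by exact: measurableI.
  have -> : part C mC cC `&` S = C `&` (part C mC cC `&` S).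
    by rewrite setIA [C `&` _]setIidr // => x [[]].
  rewrite -(unposition_pushforward mC cC) //; congr (lebesgue_measure _).
  apply/seteqP; split=> t /=; rewrite !in_itv /=.
    move=> [tC [pt St]]; split=> //; move: pt => [_ pm].
    by rewrite unpositionK // in pm; case/andP: tC => -> _.
  by move=> [tm St]; split; [lra | split=> //; case: (part_un C mC cC t mlC tm)].
exists (part A mA cA), (part B mB cB), (unposition mB cB \o position A),
  (unposition mA cA \o position B).
have mf C mC cC D (mD : measurable D) :
    measurable_fun setT (@unposition C mC cC \o position D).
  by apply: measurableT_comp; [exact: measurable_unposition | exact: measurable_position].
split; [split| | |].
- by split; exact: mpart.
- by split; exact: mf.
- move=> x /partP[_ tm E] /=; have [h1 h2] := part_un B mB cB _ mlB tm.
  by rewrite h2.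
- move=> x /partP[_ tm E] /=; have [h1 h2] := part_un A mA cA _ mlA tm.
  by rewrite h2.
- move=> S mS; apply: EFin_inj; rewrite (mpush B mB cB) //.
  have mfS : measurable [set x | S (unposition mB cB (position A x))].
    exact: (meas_preim (mf _ mB cB A mA)).
  rewrite -[X in pr X]/(part A mA cA `&` [set x | S (unposition mB cB (position A x))]).
  rewrite (mpush A mA cA) //; congr (lebesgue_measure _).
  apply/seteqP; split=> t /=; rewrite !in_itv /= => -[tm];
    by rewrite unpositionK //; lra.
- by move=> x /partP[].
- by move=> x /partP[].
- apply: EFin_inj; rewrite -[X in pr X]setIT (mpush A mA cA) //.
  rewrite preimage_setT setIT lebesgue_measure_itv /= lte_fin -EFinB subr0.
  case: ltP => // m0; congr (_%:E); apply/eqP; rewrite eq_le m0 andbT.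
  by rewrite le_min !pr_ge0.
Qed.

End Uniformize.

(** * Standard Borel spaces *)

Lemma pr_inc_approx (R : realType) d (X : measurableType d) (mu : probability X R)
    (F : nat -> set X) (e : R) : (forall k, measurable (F k)) ->
  (forall k, F k `<=` F k.+1) -> 0 < e ->
  exists k, pr mu ([set x | exists k, F k x] `\` F k) <= e.
Proof.
move=> mF dF e0; have H := @pr_cvg_inc R d X mu F mF dF.
have mU : measurable [set x | exists k, F k x] by exact: meas_ex.
have /cvgrPdist_le/(_ e e0)[k _ /(_ k (leqnn k)) /=] := H.
rewrite ler_norml => /andP[_ H1]; exists k.
have := prDI mu mU (mF k); rewrite (setIidr (_ : F k `<=` _)); last by move=> x; exists k.
by move=> E; rewrite E in H1; lra.
Qed.

Lemma natSinv_lt_ex (R : realType) (e : R) : 0 < e -> exists m, m.+1%:R^-1 < e.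
Proof.
move=> e0; have [m _ /(_ m (leqnn m))] := near_infty_natSinv_lt (PosNum e0).
by exists m.
Qed.

Section StandardBorel.
Context (R : realType) d (X : measurableType d) (mu : probability X R).
Variables (P : completePseudoMetricType R) (f : X -> P) (g : P -> X).
Hypothesis hausP : hausdorff_space P.
Variable (dn : nat -> P).
Hypothesis dnP : forall O : set P, open O -> O !=set0 -> exists i, O (dn i).
Hypotheses (fK : cancel f g) (gK : cancel g f).
Hypothesis measP : forall A : set X,
  measurable A <-> exists2 B, <<s @open P >> B & A = f @^-1` B.
Local Notation pr := (pr mu).

(** The interior is taken because a [ball] need not be open. *)
Let base_ball (i m : nat) : set P := (ball (dn i) (m.+1%:R^-1 : R))°.

Let base (k : nat) : set P :=
  let im := odflt (0%N, 0%N) (unpickle k) in base_ball im.1 im.2.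

Let baseE i m : base (pickle (i, m)) = base_ball i m.
Proof. by rewrite /base pickleK. Qed.

Let open_base k : open (base k). Proof. exact: open_interior. Qed.

Let base_small (p : P) (e : R) : 0 < e ->
  exists i m, base_ball i m p /\ base_ball i m `<=` ball p e.
Proof.
move=> e0.
have [m me] : exists m : nat, m.+1%:R^-1 + m.+1%:R^-1 < e.
  have e4 : 0 < e / 2 by lra.
  by have [m H] := natSinv_lt_ex e4; exists m; rewrite [ltRHS]splitr ltrD.
pose r : R := m.+1%:R^-1 / 2.
have m0 : 0 < m.+1%:R^-1 :> R by rewrite invr_gt0.
have r0 : 0 < r by rewrite /r divr_gt0.
have [|i /interior_subset pi] := dnP (open_interior (ball p r)).
  by exists p; exact: nbhsx_ballx.
exists i, m; split.
  apply: (@filterS _ _ _ (ball p r)) (nbhsx_ballx _ _ r0) => q pq.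
  have -> : m.+1%:R^-1 = r + r :> R by rewrite /r -splitr.
  by apply: (@ball_triangle _ _ p) => //; exact: ball_sym.
move=> q /interior_subset iq.
apply: (@le_ball _ _ _ (r + m.+1%:R^-1)).
  by apply: le_trans (ltW me); rewrite lerD2r /r ler_pdivrMr // ler_peMr ?ltW // ltr1n.
exact: ball_triangle pi iq.
Qed.

Let base_nbhs (p : P) (O : set P) : nbhs p O -> exists k, base k p /\ base k `<=` O.
Proof.
move=> /nbhs_ballP[e /= e0 eO]; have [i [m [ip im]]] := base_small p e0.
by exists (pickle (i, m)); rewrite baseE; split=> // q /im /eO.
Qed.

Definition borel_base k : set X := f @^-1` base k.

Let meas_open O : open O -> measurable (f @^-1` O).
Proof. by move=> oO; apply/measP; exists O => //; exact: sub_sigma_algebra. Qed.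

Let meas_closed K : closed K -> measurable (f @^-1` K).
Proof.
move=> cK; rewrite -[K]setCK; apply: measurableC.
by apply: meas_open; exact: closed_openC.
Qed.

Lemma measurable_borel_base k : measurable (borel_base k).
Proof. exact: meas_open. Qed.

Lemma borel_base_sep x y : (forall k, borel_base k x <-> borel_base k y) -> x = y.
Proof.
move=> xy; apply: (can_inj fK); apply: hausP => A B xA yB.
have [k [kx kA]] := base_nbhs xA.
by exists (f y); split; [apply: kA; exact/xy | exact: nbhs_singleton].
Qed.

Lemma borel_base_gen : @measurable _ X = <<s range borel_base >>.
Proof.
apply/seteqP; split; last first.
  apply: smallest_sub; first exact: sigma_algebra_measurable.
  by move=> _ [k _ <-]; exact: measurable_borel_base.
move=> A /measP[B sB ->]; pose Y := g_sigma_algebraType (range borel_base).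
suff : <<s @open P >> `<=` [set B | @measurable _ Y (f @^-1` B)] by apply.
apply: smallest_sub; first split.
- by rewrite /= preimage_set0; exact: (@measurable0 _ Y).
- by move=> C mC; rewrite /= setTD preimage_setC; exact: (@measurableC _ Y).
- move=> F mF; rewrite /= preimage_bigcup.
  by apply: (@bigcupT_measurable _ Y).
move=> O oO /=.
rewrite (_ : _ @^-1` _ = [set x | exists k, base k `<=` O /\ borel_base k x]).
  apply: (@meas_ex _ Y nat (fun k x => base k `<=` O /\ borel_base k x)) => k.
  apply: (@meas_and _ Y); first exact: meas_const.
  by apply: sub_sigma_algebra; exists k.
apply/seteqP; split=> x /=; last by move=> [k [kO]]; exact: kO.
move=> Ox; have [|k [kx kO]] := @base_nbhs (f x) O; first exact: open_nbhs_nbhs.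
by exists k.
Qed.

Let inner_regular (B : set P) := forall e : R, 0 < e ->
  exists K, [/\ closed K, K `<=` B & pr (f @^-1` (B `\` K)) <= e].

Let inner_regular_open O : open O -> inner_regular O.
Proof.
move=> oO e e0.
(* These closed sets increase to [O]. The closure stays inside [O]: a limit point is within radius
   [k.+1%:R^-1] of a point whose ball of that radius lies in [O]. *)
pose K k := closure [set p | ball p (k.+1%:R^-1 : R) `<=` O].
have KO k : K k `<=` O.
  move=> p /(_ (ball p (k.+1%:R^-1 / 2 : R)))[|q [qO pq]].
    by apply: nbhsx_ballx; rewrite divr_gt0.
  apply: qO; apply: ball_sym; apply: le_ball pq.
  by rewrite ler_pdivrMr // ler_peMr ?ltW ?invr_gt0 // ltr1n.
have mK k : measurable (f @^-1` K k) by apply/meas_closed/closed_closure.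
have KS k : f @^-1` K k `<=` f @^-1` K k.+1.
  apply: preimage_subset; apply: closureS => p /= pO q pq; apply: pO.
  apply: le_ball pq; rewrite lef_pV2 ?posrE // ler_nat //.
have [k Hk] := @pr_inc_approx R d X mu (fun k => f @^-1` K k) e mK KS e0.
exists (K k); split=> //; first exact: closed_closure.
rewrite [X in pr X](_ : _ = [set x | exists k0, (f @^-1` K k0) x] `\` f @^-1` K k) //.
apply/seteqP; split=> x /= [Ox nK]; split=> //; last by case: Ox => j /KO.
have : nbhs (f x) O by exact: open_nbhs_nbhs.
move=> /nbhs_ballP[r /= r0 rO].
have [m Hm] := natSinv_lt_ex r0.
exists m; apply: subset_closure => q /= qm; apply: rO.
by apply: le_ball qm; exact: ltW.
Qed.

(** Asking for inner regularity of the complement as well makes the class a sigma-algebra; it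
    contains the open sets by the previous lemma. *)
Let regular_borel B : <<s @open P >> B ->
  [/\ measurable (f @^-1` B), inner_regular B & inner_regular (~` B)].
Proof.
suff : <<s @open P >> `<=` [set B | [/\ measurable (f @^-1` B),
  inner_regular B & inner_regular (~` B)]].
  by apply.
apply: smallest_sub; first split.
- split; first by rewrite preimage_set0.
    move=> e e0; exists set0; split=> //; first exact: closed0.
    by rewrite setD0 preimage_set0 pr_set0 ltW.
  move=> e e0; exists setT; split; [exact: closedT | by rewrite setC0|].
  by rewrite setDT preimage_set0 pr_set0 ltW.
- move=> A [mA rA rCA]; rewrite setTD; split=> //; last by rewrite setCK.
  by rewrite preimage_setC; exact: measurableC.
- move=> F mF; split.
  + rewrite preimage_bigcup; apply: bigcupT_measurable => k; by case: (mF k).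
  + move=> e e0; have e2 : 0 < e / 2 by lra.
    have e2k k : 0 < (e / 2) / (2 ^ k.+1)%:R by rewrite divr_gt0 // ltr0n expn_gt0.
    have /choice[K KP] k : exists K, [/\ closed K,
      K `<=` F k & pr (f @^-1` (F k `\` K)) <= (e / 2) / (2 ^ k.+1)%:R].
      by have [_ rF _] := mF k; exact: rF.
    have mK k : measurable (f @^-1` K k) by apply: meas_closed; case: (KP k).
    (* A countable union of closed sets need not be closed, so it is truncated, at the price of the
       second half of [e]. *)
    pose G N := \bigcup_(i in `I_N) K i.
    have cG N : closed (G N).
      by apply: closed_bigcup => // i _; case: (KP i).
    have mG N : measurable (f @^-1` G N) by exact: meas_closed.
    have [|N HN] := @pr_inc_approx R d X mu (fun N => f @^-1` G N) _ mG _ e2.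
      by move=> N x [i /= iN Ki]; exists i => //=; exact: ltnW.
    exists (G N); split=> //.
      by move=> p [i _ Ki]; exists i => //; case: (KP i) => _ + _; apply.
    pose E1 := [set x | exists k, (f @^-1` (F k `\` K k)) x].
    have mE1 k : measurable (f @^-1` (F k `\` K k)).
      apply: (@measurableD _ _ (f @^-1` F k) (f @^-1` K k)) => //.
      by case: (mF k).
    pose E2 := [set x | exists k, (f @^-1` G k) x] `\` f @^-1` G N.
    have mE2 : measurable E2 by apply: measurableD => //; exact: meas_ex.
    have E1e : pr E1 <= e / 2.
      by apply: pr_countable_le => // [|k]; [exact: ltW|case: (KP k)].
    apply: (@le_trans _ _ (pr (E1 `|` E2))); last first.
      apply: (le_trans (prU_le _ _ _)) => //; first exact: meas_ex.
      by rewrite /E2; lra.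
    apply: pr_le.
    * apply: (@measurableD _ _ (f @^-1` \bigcup_k F k) (f @^-1` G N)) => //.
      rewrite preimage_bigcup; apply: bigcupT_measurable => k; by case: (mF k).
    * by apply: measurableU => //; exact: meas_ex.
    * move=> x [[k _ Fk] nG]; have [Kk|nK] := pselect (K k (f x)); last by left; exists k.
      right; split=> //; exists k.+1; exists k => //=.
  + move=> e e0.
    have e2k k : 0 < e / (2 ^ k.+1)%:R by rewrite divr_gt0 // ltr0n expn_gt0.
    have /choice[K KP] k : exists K, [/\ closed K,
      K `<=` ~` F k & pr (f @^-1` (~` F k `\` K)) <= e / (2 ^ k.+1)%:R].
      by have [_ _ rF] := mF k; exact: rF.
    have mK k : measurable (f @^-1` K k) by apply: meas_closed; case: (KP k).
    exists (\bigcap_k K k); split.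
    * by apply: closed_bigI => k _; case: (KP k).
    * by move=> p Kp [k _ Fk]; case: (KP k) => _ /(_ p (Kp k I)).
    have mE k : measurable (f @^-1` (~` F k `\` K k)).
      apply: (@measurableD _ _ (~` (f @^-1` F k)) (f @^-1` K k)) => //.
      by apply: measurableC; case: (mF k).
    apply: (@le_trans _ _ (pr [set x | exists k, (f @^-1` (~` F k `\` K k)) x]));
      last first.
      by apply: pr_countable_le => // [|k]; [exact: ltW|case: (KP k)].
    apply: pr_le; last 1 first.
    * move=> x [nF /existsNP[k /not_implyP[_ nK]]]; exists k; split=> // Fk.
      by apply: nF; exists k.
    * apply: (@measurableD _ _ (~` (f @^-1` \bigcup_k F k)) (f @^-1` \bigcap_k K k)).
        by apply: measurableC; rewrite preimage_bigcup; apply: bigcupT_measurable => k;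
          case: (mF k).
      by rewrite preimage_bigcap; exact: bigcapT_measurable.
    * exact: meas_ex.
- move=> O oO; split; [exact: meas_open | exact: inner_regular_open|].
  move=> e e0; exists (~` O); split=> //; first exact: open_closedC.
  by rewrite setDv preimage_set0 pr_set0 ltW.
Qed.

(** [A'] is cut out by three conditions, each costing [e / 3]: at every scale [m] its image is
    covered by the first [N m] balls, it lies in a closed set [K0] inside the image of [A1], and its
    trace on each basic open set lies in a closed subset [F k] of that set. If codes of points of
    [A'] agree longer and longer, the first condition makes the points Cauchy; completeness gives a
    limit, and the other two make both membership in [A'] and the code pass to the limit. *)
Lemma closed_code_approx A (e : R) : measurable A -> 0 < e ->
  exists A', [/\ measurable A', A' `<=` A, closed_code borel_base A' &
    pr (A `\` A') <= e].
Proof.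
move=> mA e0; have e3 : 0 < e / 3 by lra.
have e3k k : 0 < (e / 3) / (2 ^ k.+1)%:R by rewrite divr_gt0 // ltr0n expn_gt0.
have mb i m : measurable (f @^-1` base_ball i m) by apply/meas_open/open_interior.
pose T m N := [set x | exists i, (i < N)%N /\ (f @^-1` base_ball i m) x].
have mT m N : measurable (T m N).
  by apply: meas_ex => i; apply: meas_and => //; exact: meas_const.
have /choice[N NP] m : exists N, pr (~` T m N) <= (e / 3) / (2 ^ m.+1)%:R.
  have [|N HN] := @pr_inc_approx R d X mu (T m) _ (mT m) _ (e3k m).
    by move=> N x [i [iN ix]]; exists i; split=> //; exact: ltnW.
  exists N; apply: le_trans HN; apply: pr_le.
  - exact: measurableC.
  - by apply: measurableD => //; exact: meas_ex.
  move=> x nx; split=> //.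
  have m0 : 0 < m.+1%:R^-1 / 2 :> R by rewrite divr_gt0.
  have [|i xi] := dnP (open_interior (ball (f x) (m.+1%:R^-1 / 2 : R))).
    by exists (f x); exact: nbhsx_ballx.
  exists i.+1; exists i; split=> //=.
  apply: (@filterS _ _ _ (ball (f x) (m.+1%:R^-1 / 2 : R))) (nbhsx_ballx _ _ m0) => q pq.
  rewrite [X in ball _ X](splitr (m.+1%:R^-1)).
  by apply: (@ball_triangle _ _ (f x)) => //; apply: ball_sym; exact: interior_subset.
pose A1 := [set x | A x /\ forall m, T m (N m) x].
have mA1 : measurable A1 by apply: meas_and => //; exact: meas_all.
have /measP[B1 /regular_borel[_ rB1 _] A1E] := mA1.
have [K0 [cK0 K0B pK0]] := rB1 _ e3.
have /choice[F FP] k : exists K, [/\ closed K,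
  K `<=` base k & pr (f @^-1` (base k `\` K)) <= (e / 3) / (2 ^ k.+1)%:R].
  exact: inner_regular_open.
have mF k : measurable (f @^-1` F k) by apply: meas_closed; case: (FP k).
have mK0 : measurable (f @^-1` K0) by exact: meas_closed.
pose A' := [set x | K0 (f x) /\ forall k, borel_base k x -> F k (f x)].
have mA' : measurable A'.
  apply: meas_and => //; apply: meas_all => k.
  by apply: meas_imp; [exact: measurable_borel_base | exact: mF].
have A'A1 : A' `<=` A1 by move=> x [/K0B]; rewrite A1E.
exists A'; split=> //.
- by move=> x /A'A1[].
- move=> q bq xq.
  have /choice[x xP] k : exists x, A' x /\ code borel_base x k = q k.
    by have [x Ax xk] := xq k; exists x.
  pose b j := head false (q j.+1).
  have pre j k y : (j <= k)%N -> code borel_base y k = q k -> code borel_base y j = q j.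
    elim: k => [|k IH]; first by rewrite leqn0 => /eqP ->.
    rewrite leq_eqVlt => /orP[/eqP -> //|]; rewrite ltnS => jk yk.
    by apply: IH => //; rewrite -bq -yk.
  have xb j k : (j < k)%N -> borel_base j (x k) <-> b j.
    move=> jk; have := pre _ _ _ jk (xP k).2; rewrite /b => <- /=.
    by split=> /asboolP.
  have cx : cauchy ((f \o x) @ \oo).
    apply: cauchy_exP => r r0; have [m mr] := natSinv_lt_ex r0.
    (* A code of length [M] decides membership in all [N m] candidate balls of radius [m.+1%:R^-1],
       so from then on the points stay in the same ball. *)
    pose M := (\max_(i < N m) (pickle (nat_of_ord i, m)).+1)%N.
    have [i [iN ix]] : T m (N m) (x M) by have [/A'A1[_]] := xP M.
    have iM : (pickle (i, m) < M)%N.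
      exact: (@leq_bigmax _ (fun i : 'I_(N m) =>
        (pickle (nat_of_ord i, m)).+1) (Ordinal iN)).
    have bi : b (pickle (i, m)) by apply/(xb _ _ iM); rewrite /borel_base /= baseE.
    exists (dn i); exists M => // k /= Mk; apply: (le_ball (ltW mr)).
    apply: interior_subset; have := (xb _ _ (leq_trans iM Mk)).2 bi.
    by rewrite /borel_base /= baseE.
  have [p xp] : exists p : P, (f \o x) @ \oo --> p.
    by exists (lim ((f \o x) @ \oo)); exact: cauchy_cvg cx.
  have inlim (C : set P) n : closed C -> (forall l, (n <= l)%N -> C (f (x l))) -> C p.
    move=> cC Cx; have W : \forall l \near \oo, C ((f \o x) l) by exists n => // l;
      exact: Cx.
    exact: (@closed_cvg nat P \oo _ (f \o x) C cC W p xp).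
  (* On [A'] a basic set and its complement are both confined to closed sets, so the [k]-th bit
     survives in the limit. *)
  have zA k : (b k /\ F k p) \/ (~ b k /\ ~ base k p).
    have [bk|nbk] := pselect (b k); [left|right]; split=> //.
      apply: (inlim _ k.+1); first by case: (FP k).
      move=> l kl; have [[_ H] _] := xP l; apply: H.
      exact/(xb _ _ kl).
    apply: (inlim (~` base k) k.+1); first exact: open_closedC.
    by move=> l kl /(xb _ _ kl).
  exists (g p).
    split; rewrite ?gK.
      by apply: (inlim _ 0%N) => // l _; have [[]] := xP l.
    move=> k; rewrite /borel_base /= gK; case: (zA k) => -[] //.
  elim=> [|k IH]; first by rewrite -(xP 0%N).2.
  rewrite /= IH -(xP k.+1).2 /= (pre k k.+1 _ _ (xP k.+1).2) //; congr (_ :: _).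
  apply: asbool_equiv_eq; rewrite xb // /borel_base /= gK.
  case: (zA k) => -[bk Fk]; split=> // _.
  by case: (FP k) => _ /(_ _ Fk).
- pose E1 := [set x | exists m, (~` T m (N m)) x].
  pose E2 := A1 `\` f @^-1` K0.
  pose E3 := [set x | exists k, (f @^-1` (base k `\` F k)) x].
  have mE1 : measurable E1 by apply: meas_ex => m; exact: measurableC.
  have mE2 : measurable E2 by exact: measurableD.
  have mbF k : measurable (f @^-1` (base k `\` F k)).
    apply: (@measurableD _ _ (f @^-1` base k) (f @^-1` F k)) => //.
    exact: measurable_borel_base.
  have mE3 : measurable E3 by exact: meas_ex.
  have pE1 : pr E1 <= e / 3.
    by apply: pr_countable_le => // [|m]; [exact: ltW | exact: measurableC].
  have pE2 : pr E2 <= e / 3 by rewrite /E2 A1E.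
  have pE3 : pr E3 <= e / 3.
    by apply: pr_countable_le => // [|k]; [exact: ltW | case: (FP k)].
  apply: (@le_trans _ _ (pr (E1 `|` (E2 `|` E3)))).
    apply: pr_le; [exact: measurableD | by apply: measurableU => //;
      exact: measurableU |].
    move=> x [Ax nA']; have [E1x|nE1] := pselect (E1 x); first by left.
    have A1x : A1 x.
      by split=> // m; apply: contrapT => nT; apply: nE1; exists m.
    have [Kx|nK] := pselect (K0 (f x)); last by right; left.
    right; right; apply: contrapT => nE3; apply: nA'; split=> // k bk.
    by apply: contrapT => nF; apply: nE3; exists k.
  have := prU_le mu mE1 (measurableU _ _ mE2 mE3); have := prU_le mu mE2 mE3.
  by lra.
Qed.

End StandardBorel.

(** Everything that is used below about a standard Borel space. *)
Definition borel_coding (R : realType) d (X : measurableType d)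
    (mu : probability X R) (U : nat -> set X) : Prop :=
  [/\ forall k, measurable (U k),
      forall x y, (forall k, U k x <-> U k y) -> x = y,
      @measurable _ X = <<s range U >> &
      forall A e, measurable A -> 0 < e -> exists A', [/\ measurable A', A' `<=` A,
        closed_code U A' & pr mu (A `\` A') <= e]].

Lemma standard_borel_coding (R : realType) d (X : measurableType d)
    (mu : probability X R) : standard_borel R X -> exists U, borel_coding mu U.
Proof.
move=> [P [f [hausP [D cD dD] [g fK gK] measP]]].
have [x0 _] := probability_inhabited mu.
have /countable_injP[i iD] := cD.
have /choice[dn dnP] k : exists p : P, (exists2 q, D q & i q = k) -> D p /\ i p = k.
  have [[q Dq qk]|nq] := pselect (exists2 q, D q & i q = k); first by exists q.
  by exists (f x0).
have dnO (O : set P) : open O -> O !=set0 -> exists i, O (dn i).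
  move=> oO [p Op]; have [|q [Oq Dq]] := dD O _ oO; first by exists p.
  exists (i q); have [|Dd E] := dnP (i q); first by exists q.
  by rewrite (iD _ _ _ _ E) //; exact/mem_set.
exists (borel_base f dn); split.
- exact: measurable_borel_base measP.
- by apply: (@borel_base_sep _ _ _ _ _ g hausP dn).
- by apply: (@borel_base_gen _ _ _ _ _ dn).
- by move=> A e mA e0; apply: (@closed_code_approx _ _ _ _ _ _ g).
Qed.

Lemma partial_iso_approx (R : realType) d (X : measurableType d)
    (mu : probability X R) U (A B : set X) (e : R) :
  borel_coding mu U -> (forall x : X, mu [set x] = 0%E) ->
  measurable A -> measurable B -> 0 < e ->
  exists A' B' f g, [/\ partial_iso mu A' B' f g, A' `<=` A, B' `<=` B &
    Order.min (pr mu A) (pr mu B) - e <= pr mu A'].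
Proof.
move=> [mU sepU genU appU] at0 mA mB e0.
have [A1 [mA1 A1A cA1 pA1]] := appU _ _ mA e0.
have [B1 [mB1 B1B cB1 pB1]] := appU _ _ mB e0.
have [A' [B' [f [g [iso A'A B'B pA']]]]] :=
  partial_iso_closed_code mU sepU genU at0 mA1 mB1 cA1 cB1.
exists A', B', f, g; split=> //; try by apply: subset_trans; eassumption.
have := prDI mu mA mA1; have := prDI mu mB mB1.
rewrite (setIidr A1A) (setIidr B1B) pA'.
have [] := leP (pr mu A) (pr mu B); have [] := leP (pr mu A1) (pr mu B1); lra.
Qed.

(** * Extension of partial isomorphisms *)

Section PartialIso.
Context (R : realType) d (X : measurableType d) (mu : probability X R).
Local Notation pr := (pr mu).
Local Notation partial_iso := (partial_iso mu).

Lemma partial_iso_sym A B f g : partial_iso A B f g -> partial_iso B A g f.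
Proof.
move=> [[mA mB] [mf mg] fP gP iso]; split=> // S mS.
have mgS : measurable [set y | S (g y)] by exact: meas_preim.
have := iso _ (measurableI _ _ mB mgS); rewrite setIA setIid.
rewrite -[X in _ = pr X]/[set y | B y /\ S (g y)] => <-.
congr (pr _); apply/seteqP; split=> x /=.
  move=> [Ax [Bfx]]; have [_ ->] := fP x Ax; by split.
by move=> [Ax Sx]; have [Bfx ->] := fP x Ax.
Qed.

Lemma partial_iso_comp A B f g C D h k : partial_iso A B f g -> partial_iso C D h k ->
  partial_iso [set x | A x /\ C (f x)] [set y | D y /\ B (k y)] (h \o f) (g \o k).
Proof.
move=> [[mA mB] [mf mg] fP gP isof] [[mC mD] [mh mk] hP kP isoh]; split.
- split; apply: meas_and => //; exact: meas_preim.
- by split; exact: measurableT_comp.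
- move=> x /= [Ax Cfx]; have [Bfx E1] := fP x Ax; have [Dh E2] := hP _ Cfx.
  by rewrite E2.
- move=> y /= [Dy Bky]; have [Agk E1] := gP _ Bky; have [Ck E2] := kP _ Dy.
  by rewrite E1.
- move=> S mS; have mCS : measurable [set y | C y /\ S (h y)].
    by apply: meas_and => //; exact: meas_preim.
  have mDB : measurable [set y | B (k y) /\ S y].
    by apply: meas_and => //; exact: meas_preim.
  transitivity (pr [set x | A x /\ [set y | C y /\ S (h y)] (f x)]).
    congr (pr _); apply/seteqP; split=> x /=; [by case=> -[] | by case=> ? []].
  rewrite isof // -[X in pr X = _]/[set y | B y /\ (C y /\ S (h y))].
  transitivity (pr [set x | C x /\ [set y | B (k y) /\ S y] (h x)]).
    congr (pr _); apply/seteqP; split=> x /=.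
      by move=> [Bx [Cx Sx]]; rewrite (hP _ Cx).2.
    by move=> [Cx]; rewrite (hP _ Cx).2 => -[].
  rewrite isoh //; congr (pr _); apply/seteqP; split=> x /=;
    [by case=> ? [] | by case=> -[]].
Qed.

Lemma partial_iso_id : partial_iso setT setT id id.
Proof. by split=> // S mS; congr (pr _); apply/seteqP; split=> x //= []. Qed.

Definition steps (D : set X) (f : X -> X) (k : nat) : set X :=
  [set x | forall j, (j < k)%N -> D (iter j f x)].

Lemma steps0 D f : steps D f 0 = setT.
Proof. by apply/seteqP; split. Qed.

Lemma stepsS D f k x : steps D f k.+1 x <-> steps D f k x /\ D (iter k f x).
Proof.
split=> [H|[H Hk] j]; first by split=> [j jk|]; apply: H => //; exact: ltnW.
by rewrite ltnS leq_eqVlt => /orP[/eqP ->|] //; exact: H.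
Qed.

Lemma stepsSl D f k x : steps D f k.+1 x <-> D x /\ steps D f k (f x).
Proof.
split=> [H|[Dx H] [|j] //].
  by split=> [|j jk]; [exact: (H 0%N) | rewrite -iterSr; exact: H].
by rewrite ltnS iterSr; exact: H.
Qed.

Lemma partial_iso_iter D E f g k : partial_iso D E f g ->
  partial_iso (steps D f k) (steps E g k) (iter k f) (iter k g).
Proof.
move=> iso; elim: k => [|k IH]; first by rewrite !steps0; exact: partial_iso_id.
have := partial_iso_comp IH iso.
rewrite (_ : [set x | _ /\ D _] = steps D f k.+1); last first.
  by apply/seteqP; split=> x /=; rewrite stepsS.
rewrite (_ : [set x | E x /\ _] = steps E g k.+1); last first.
  by apply/seteqP; split=> x /=; rewrite stepsSl.
by rewrite (_ : iter k g \o g = iter k.+1 g) //; apply/funext => x; rewrite iterSr.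
Qed.

Section Extend.
Variables (D E : set X) (f g : X -> X).
Hypothesis iso : partial_iso D E f g.

Definition forever (D : set X) (f : X -> X) : set X := [set x | forall k, D (iter k f x)].

Lemma foreverP x : forever D f x <-> forall k, steps D f k x.
Proof. by split=> [H k j _|H k]; [exact: H | exact: (H k.+1)]. Qed.

Lemma measurable_iter_part k :
  measurable_fun setT (iter k f) /\ measurable_fun setT (iter k g).
Proof. by have [] := partial_iso_iter k iso. Qed.

Lemma measurable_forever : measurable (forever D f) /\ measurable (forever E g).
Proof.
have [[mD mE] _ _ _ _] := iso.
by split; apply: meas_all => k; apply: meas_preim => //; case: (measurable_iter_part k).
Qed.

Lemma forever_step x : D x -> forever D f (f x) <-> forever D f x.
Proof.
move=> Dx; split=> [H [|k] //|H k]; first by rewrite iterSr; exact: H.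
by rewrite -iterSr; exact: (H k.+1).
Qed.

Lemma forever_unstep x : D x -> forever E g (f x) <-> forever E g x.
Proof.
have [_ _ fP _ _] := iso; move=> Dx; have [Efx gfx] := fP x Dx.
split=> [H k|H [|k] //]; last by rewrite iterSr gfx; exact: H.
by have := H k.+1; rewrite iterSr gfx.
Qed.

(** The failed equivalence says that the chain of the point is infinite in exactly one direction. *)
Definition ray : set X := [set x | ~ (forever D f x <-> forever E g x)].

Lemma measurable_ray : measurable ray.
Proof. by have [? ?] := measurable_forever; apply: meas_not; exact: meas_iff. Qed.

Lemma ray_step x : D x -> ray (f x) <-> ray x.
Proof. by move=> Dx; rewrite /ray /= forever_step // forever_unstep. Qed.

Lemma ray_iter k x : steps D f k x -> ray (iter k f x) <-> ray x.
Proof.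
elim: k x => [|k IH] x //; rewrite stepsS /= => -[H Dk].
by rewrite ray_step // IH.
Qed.

(* The points having exactly [k] predecessors and infinitely many successors
   form sets of the same measure for all [k]; being disjoint, they are null. *)
Lemma pr_forward_ray : pr [set x | forever D f x /\ ~ forever E g x] = 0.
Proof.
have [[mD mE] _ _ _ _] := iso; have [mF mB] := measurable_forever.
pose W k := [set x | forever D f x /\ (steps E g k x /\ ~ E (iter k g x))].
have mW k : measurable (W k).
  have [[_ mS] [_ mg] _ _ _] := partial_iso_iter k iso.
  apply: meas_and => //; apply: meas_and => //.
  by apply: meas_not; exact: meas_preim.
have prW k : pr (W k) = pr (W 0%N).
  have [[mS1 mS2] [mf mg] fP gP isok] := partial_iso_sym (partial_iso_iter k iso).
  have := isok _ (mW 0%N); rewrite (setIidr (_ : W 0%N `<=` steps D f k)).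
    move=> <-; congr (pr _); apply/seteqP; split=> x /=.
      move=> [Fx [Bx nE]]; split=> //; split=> //; have [Dx xE] := fP x Bx.
      move=> j; have [jk|kj] := ltnP j k; first exact: Dx.
      by rewrite -(subnK kj) iterD xE; exact: Fx.
    move=> [Bx [Fx [_ nE]]]; split=> //.
    have [_ <-] := fP x Bx; move=> j; rewrite -iterD; exact: Fx.
  by move=> x [/foreverP].
have tW i j x : W i x -> W j x -> i = j.
  move=> [_ [Bi nEi]] [_ [Bj nEj]]; have [ij|ji|//] := ltngtP i j.
    by case: nEi; exact: Bj.
  by case: nEj; exact: Bi.
have prn n : pr [set x | exists k, (k < n)%N /\ W k x] = n%:R * pr (W 0%N).
  elim: n => [|n IH].
    by rewrite mul0r -[RHS](pr_set0 mu); congr (pr _); apply/seteqP; split=> x //= [k []].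
  rewrite -natr1 mulrDl mul1r -IH -(prW n) -prU //.
  - congr (pr _); apply/seteqP; split=> x /=.
      move=> [k []]; rewrite ltnS leq_eqVlt => /orP[/eqP ->|]; first by right.
      by move=> kn Wk; left; exists k.
    by move=> [[k [kn Wk]]|Wn]; [exists k; split=> //; exact: ltnW | exists n].
  - by apply: meas_ex => k; apply: meas_and => //; exact: meas_const.
  - apply/seteqP; split=> x //= -[[k [kn Wk]] Wn].
    by move: kn; rewrite (tW _ _ _ Wk Wn) ltnn.
have W0 : pr (W 0%N) = 0.
  apply/eqP; rewrite eq_le pr_ge0 andbT leNgt; apply/negP => W0.
  have [n nW] := natSinv_lt_ex W0.
  have mWn : measurable [set x | exists k, (k < n.+1)%N /\ W k x].
    by apply: meas_ex => k; apply: meas_and => //; exact: meas_const.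
  have := pr_le1 mu mWn; rewrite prn leNgt => /negP; apply.
  by rewrite mulrC -ltr_pdivrMr // mul1r.
apply: (@pr_null_sub _ _ _ _ _ [set x | exists k, W k x]).
- by apply: meas_and => //; exact: meas_not.
- exact: meas_ex.
- move=> x [Fx /existsNP nB].
  have ex : exists k, ~~ `[< E (iter k g x) >] by have [k nE] := nB; exists k;
    exact/asboolPn.
  exists (ex_minn ex); case: ex_minnP => k /asboolPn nE kmin; split=> //; split=> // j jk.
  by apply: contrapT => /asboolPn /kmin; rewrite leqNgt jk.
- by apply: pr_null_ex => // k; rewrite prW.
Qed.

End Extend.

Lemma pr_ray D E f g : partial_iso D E f g -> pr (ray D E f g) = 0.
Proof.
move=> iso; have [mF mB] := measurable_forever iso.
have H1 := pr_forward_ray iso; have H2 := pr_forward_ray (partial_iso_sym iso).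
have m1 : measurable [set x | forever D f x /\ ~ forever E g x].
  by apply: meas_and => //; exact: meas_not.
have m2 : measurable [set x | forever E g x /\ ~ forever D f x].
  by apply: meas_and => //; exact: meas_not.
apply: (@pr_null_sub _ _ _ _ _ ([set x | forever D f x /\ ~ forever E g x] `|`
    [set x | forever E g x /\ ~ forever D f x])).
- exact: measurable_ray iso.
- exact: measurableU.
- move=> x nFB; have [Fx|nF] := pselect (forever D f x).
    by left; split=> // Bx; apply: nFB; split.
  by right; split=> //; apply: contrapT => nB; apply: nFB; split.
- apply/eqP; rewrite eq_le pr_ge0 andbT; apply: le_trans (prU_le mu m1 m2) _.
  by rewrite H1 H2 addr0.
Qed.

Lemma raysym D E f g x : ray E D g f x <-> ray D E f g x.
Proof. by split=> H [? ?]; apply: H; split. Qed.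

Definition exit (D : set X) (f : X -> X) (x : X) : nat :=
  if pselect (exists k, ~~ `[< D (iter k f x) >]) is left ex then ex_minn ex else 0%N.

Lemma exitE D f x k : steps D f k x -> ~ D (iter k f x) -> exit D f x = k.
Proof.
move=> Sk nD; rewrite /exit; case: pselect => [ex|[]]; last first.
  by exists k; exact/asboolPn.
case: ex_minnP => j /asboolPn nDj jmin; apply/eqP; rewrite eqn_leq.
rewrite jmin; last exact/asboolPn.
by rewrite leqNgt; apply/negP => /Sk.
Qed.

Lemma exitP D f x : ~ forever D f x ->
  steps D f (exit D f x) x /\ ~ D (iter (exit D f x) f x).
Proof.
move=> /existsNP[k nDk]; rewrite /exit; case: pselect => [ex|[]]; last first.
  by exists k; exact/asboolPn.
case: ex_minnP => j /asboolPn nDj jmin; split=> // i ij.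
by apply: contrapT => /asboolPn /jmin; rewrite leqNgt ij.
Qed.

(* The finite chains [x, f x, ...] leaving [D] are closed up to cycles, and the
   null set of one-sided infinite chains is left pointwise fixed. *)
Definition extension_piece (f g : X -> X) (i : nat) : X -> X :=
  if i is i'.+1 then if i' is k.+1 then iter k g else f else id.

(** Case 0 fixes a ray, case 1 follows [f], and case [k.+2] sends the end of a chain back [k] steps
    to its start; with [k = 0] a point outside [D] and [E] is fixed. *)
Definition extension_case (D E : set X) (f g : X -> X) (x : X) : nat :=
  if `[< ray D E f g x >] then 0%N
  else if `[< D x >] then 1%N else (exit E g x).+2.

Definition extension D E f g x :=
  extension_piece f g (extension_case D E f g x) x.

Lemma extension_case0 D E f g x : extension_case D E f g x = 0%N <-> ray D E f g x.
Proof. by rewrite /extension_case; case: asboolP => // ?; case: asboolP. Qed.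

Lemma extension_case1 D E f g x :
  extension_case D E f g x = 1%N <-> ~ ray D E f g x /\ D x.
Proof. by rewrite /extension_case; case: asboolP => [? | ?];
  [split=> // -[] | case: asboolP => ?; split=> // -[]]. Qed.

Lemma extension_case2 D E f g x k : extension_case D E f g x = k.+2 <->
  [/\ ~ ray D E f g x, ~ D x, steps E g k x & ~ E (iter k g x)].
Proof.
rewrite /extension_case; case: asboolP => [? | nr]; first by split=> // -[].
case: asboolP => [? | nD]; first by split=> // -[].
split=> [[<-]|[_ _ Sk nE]]; last by rewrite (exitE Sk nE).
have nF : ~ forever D f x by move=> /(_ 0%N).
by have [] := @exitP E g x; first by move=> Bx; apply: nr => -[_ /(_ Bx)].
Qed.

(** Exchanging [f] and [g] reverses every chain, so the start and the end of a finite chain trade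
    places and the reversed cycle is the inverse. *)
Lemma extensionK D E f g : partial_iso D E f g ->
  cancel (extension D E f g) (extension E D g f).
Proof.
move=> iso x; have [_ _ fP gP _] := iso; have iso' := partial_iso_sym iso.
rewrite {2}/extension; case c : (extension_case D E f g x) => [|[|k]] /=.
- move/extension_case0/raysym/extension_case0 : c => c.
  by rewrite /extension c.
- move/extension_case1 : c => [nr Dx].
  have /extension_case1 c' : ~ ray E D g f (f x) /\ E (f x).
    by split; [rewrite raysym (ray_step iso) | case: (fP x Dx)].
  by rewrite /extension c' /=; case: (fP x Dx).
- move/extension_case2 : c => [nr nD Sk nE].
  have [_ _ iP _ _] := partial_iso_iter k iso'.
  have [Fk xE] := iP x Sk.
  have /extension_case2 c' : [/\ ~ ray E D g f (iter k g x), ~ E (iter k g x),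
      steps D f k (iter k g x) & ~ D (iter k f (iter k g x))].
    by rewrite xE; split=> //; rewrite (ray_iter iso') // raysym.
  by rewrite /extension c' /= xE.
Qed.

Lemma discr_meas_extension_case D E f g : partial_iso D E f g ->
  discr_meas (extension_case D E f g).
Proof.
move=> iso; have [[mD mE] _ _ _ _] := iso; have mr := measurable_ray iso.
have iso' := partial_iso_sym iso.
move=> [|[|k]].
- rewrite (_ : _ @^-1` _ = ray D E f g) //.
  by apply/seteqP; split=> x; [move/extension_case0 | move=> ?; exact/extension_case0].
- rewrite (_ : _ @^-1` _ = [set x | ~ ray D E f g x /\ D x]).
    by apply: meas_and => //; exact: meas_not.
  by apply/seteqP; split=> x; [move/extension_case1 | move=> ?; exact/extension_case1].
- have [[mS _] [mg _] _ _ _] := partial_iso_iter k iso'.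
  rewrite (_ : _ @^-1` _ = [set x |
      ~ ray D E f g x /\ (~ D x /\ (steps E g k x /\ ~ E (iter k g x)))]).
    apply: meas_and; first exact: meas_not.
    apply: meas_and; first exact: meas_not.
    by apply: meas_and => //; apply: meas_not; exact: meas_preim.
  apply/seteqP; split=> x /=.
    by move/extension_case2 => [].
  by move=> [? [? [? ?]]]; exact/extension_case2.
Qed.

Lemma measurable_extension D E f g : partial_iso D E f g ->
  measurable_fun setT (extension D E f g).
Proof.
move=> iso; apply: (meas_glue (discr_meas_extension_case iso)) => -[|[|k]] /=.
- exact: measurable_id.
- by have [_ []] := iso.
- by have [_ [_]] := partial_iso_iter k iso.
Qed.

(** The map carries its case [i] onto case [i] of its inverse, by the identity, [f] or an iterate of
    [g]; each of these is measure preserving on the piece, and the countably many pieces are added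
    up. *)
Lemma extension_mp D E f g S : partial_iso D E f g -> measurable S ->
  pr (extension D E f g @^-1` S) = pr S.
Proof.
move=> iso mS; have [[mD mE] _ _ _ isoD] := iso; have iso' := partial_iso_sym iso.
have mr := measurable_ray iso.
have mc := discr_meas_extension_case iso; have mc' := discr_meas_extension_case iso'.
pose c := extension_case D E f g; pose c' := extension_case E D g f.
have -> : extension D E f g @^-1` S =
    [set x | exists i, c x = i /\ S (extension_piece f g i x)].
  by apply/seteqP; split=> x /=; [exists (c x) | move=> [i [<-]]].
rewrite [X in _ = pr X](_ : S = [set x | exists i, c' x = i /\ S x]); last first.
  by apply/seteqP; split=> x /=; [exists (c' x) | move=> [i []]].
have mp i : measurable_fun setT (extension_piece f g i).
  case: i => [|[|k]] /=; first exact: measurable_id.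
    by have [_ []] := iso.
  by have [_ [_]] := partial_iso_iter k iso.
apply: pr_eq_ex.
- by move=> i; apply: meas_and; [exact: mc | exact: meas_preim].
- by move=> i; apply: meas_and => //; exact: mc'.
- case=> [|[|k]].
  + congr (pr _); apply/seteqP; split=> x /= [cx Sx]; split=> //.
      by apply/extension_case0/raysym/extension_case0.
    by apply/extension_case0/raysym/extension_case0.
  + have mSr : measurable [set y | S y /\ ~ ray D E f g y].
      by apply: meas_and => //; exact: meas_not.
    transitivity (pr (E `&` [set y | S y /\ ~ ray D E f g y])).
      rewrite -isoD //; congr (pr _); apply/seteqP; split=> x /=.
        by move=> [/extension_case1[nr Dx] Sx]; rewrite (ray_step iso).
      by move=> [Dx [Sx]]; rewrite (ray_step iso) // => nr; split=> //;
        apply/extension_case1.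
    congr (pr _); apply/seteqP; split=> x /=.
      by move=> [Ex [Sx nr]]; split=> //; apply/extension_case1; rewrite raysym.
    by move=> [/extension_case1[]]; rewrite raysym.
  + have [_ [mgk mfk] iP _ isok] := partial_iso_iter k iso'.
    pose S' := [set z | S z /\ (~ ray D E f g z /\ (~ E z /\ ~ D (iter k f z)))].
    have mS' : measurable S'.
      apply: meas_and => //; apply: meas_and; first exact: meas_not.
      apply: meas_and; first exact: meas_not.
      by apply: meas_not; exact: meas_preim.
    transitivity (pr (steps D f k `&` S')).
      rewrite -isok //; congr (pr _); apply/seteqP; split=> x /=.
        move=> [/extension_case2[nr nD Sk nE] Sx]; have [_ xE] := iP x Sk.
        by split=> //; split=> //; rewrite xE -raysym (ray_iter iso') // raysym.
      move=> [Sk [Sx [+ []]]]; have [_ ->] := iP x Sk.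
      rewrite -raysym (ray_iter iso') // raysym => nr nE nD; split=> //.
      exact/extension_case2.
    congr (pr _); apply/seteqP; split=> x /=.
      move=> [Sk [Sx [nr [nE nD]]]]; split=> //; apply/extension_case2; split=> //.
      by rewrite raysym.
    by move=> [/extension_case2[nr nE Sk nD] Sx]; split=> //; split=> //; rewrite -raysym.
- by move=> i j _ _ [x [/= [<- _] [<- _]]].
- by move=> i j _ _ [x [/= [<- _] [<- _]]].
Qed.

Lemma partial_iso_extend D E f g : partial_iso D E f g ->
  exists rho rho', [/\ cancel rho rho', cancel rho' rho,
    measure_preserving mu mu rho, measure_preserving mu mu rho' &
    exists N, [/\ measurable N, pr N = 0 & forall x, D x -> ~ N x -> rho x = f x]].
Proof.
move=> iso; have iso' := partial_iso_sym iso.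
have mp A B h k : partial_iso A B h k -> measure_preserving mu mu (extension A B h k).
  move=> isoh; have mh := measurable_extension isoh; split=> // S mS.
  by rewrite !prE ?extension_mp // -[X in measurable X]setTI; exact: mh.
exists (extension D E f g), (extension E D g f); split.
- exact: extensionK.
- exact: extensionK.
- exact: mp.
- exact: mp.
- exists (ray D E f g); split; [exact: measurable_ray iso | exact: pr_ray|].
  by move=> x Dx nr; rewrite /extension (extension_case1 _ _ _ _ _).2.
Qed.

End PartialIso.

(** * Types and stabilizers *)

Section GroupActions.
Context (n : nat) (T : Type).
Implicit Types (a : gaction n T) (g h : free_group n) (x y : T).

Lemma actK a g x : a (g^-1)%g (a g x) = x.
Proof. by rewrite -actM mulVg act1. Qed.

Lemma actVK a g x : a g (a (g^-1)%g x) = x.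
Proof. by rewrite -actM mulgV act1. Qed.

Lemma act_inj a g x y : a g x = a g y -> x = y.
Proof. by move=> /(congr1 (a (g^-1)%g)); rewrite !actK. Qed.

Lemma act_word a g x : a g x = foldr (fun s => a (gen s)) x (word g).
Proof.
case: g => w rw /=; elim: w rw => [|s w IH] rw /=.
  by rewrite -[RHS](act1 a); congr (a _ x); exact: val_inj.
rewrite -(IH (reduced_behead rw)) -actM; congr (a _ x); apply: val_inj => /=.
by rewrite push_id.
Qed.

End GroupActions.

Definition fg_enum n k : free_group n := odflt (fg_one n) (unpickle k).

Lemma fg_enumK n (g : free_group n) : fg_enum n (pickle g) = g.
Proof. by rewrite /fg_enum pickleK. Qed.

Definition stab_type n T (a : gaction n T) (M : nat) (x : T) : {ffun 'I_M -> bool} :=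
  [ffun k : 'I_M => `[< a (fg_enum n k) x = x >]].

Section Walks.
Context (n : nat).

(** The word is read from its last letter, as in a left action. *)
Fixpoint walk T (G : rgraph n T) (w : seq (letter n)) (y : T) : Prop :=
  if w is s :: w' then exists z, walk G w' z /\ edge G s z y else y = root G.

(** [V i] contains the vertices reached in [i] steps: all vertices for an isomorphism of graphs, the
    balls for an isomorphism of balls, which controls edges only up to step [m]. *)
Lemma walk_transfer T U (G : rgraph n T) (H : rgraph n U) (f : T -> U)
    (V : nat -> set T) (m : nat) :
  f (root G) = root H -> V 0%N (root G) ->
  (forall i s z y, V i z -> edge G s z y -> V i.+1 y) ->
  (forall i s z y, (i < m)%N -> V i z -> V i.+1 y -> edge G s z y ->
    edge H s (f z) (f y)) ->
  forall w y, (size w <= m)%N -> walk G w y -> V (size w) y /\ walk H w (f y).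
Proof.
move=> fr V0 VS fe; elim=> [|s w IH] y /= wm; first by move=> ->.
move=> [z [zw zy]]; have [Vz Hz] := IH z (ltnW wm) zw.
have Vy := VS _ _ _ _ Vz zy; split=> //; exists (f z); split=> //.
exact: (fe (size w)).
Qed.

Lemma walk_schreier T (a : gaction n T) x w y :
  walk (schreier_graph a x) w y <-> y = foldr (fun s => a (gen s)) x w.
Proof.
elim: w y => [|s w IH] y //=; split; first by move=> [z [/IH -> [_ ->]]].
move=> ->; exists (foldr (fun s => a (gen s)) x w); split; first exact/IH.
split=> //; elim: w {IH} => [|t w IH] /=; first by exists 1%g => //; rewrite act1.
exact: gorbit_act.
Qed.

Definition loops T (G : rgraph n T) (w : seq (letter n)) : Prop :=
  walk G w (root G).

Lemma loops_schreier T (a : gaction n T) x (g : free_group n) :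
  loops (schreier_graph a x) (word g) <-> a g x = x.
Proof. by rewrite /loops walk_schreier /= act_word; split=> /esym. Qed.

Lemma loops_iso T U (G : rgraph n T) (H : rgraph n U) w :
  vert G (root G) -> (forall s z y, vert G z -> edge G s z y -> vert G y) ->
  rgraph_iso G H -> loops G w -> loops H w.
Proof.
move=> Gr GS [f [_ fr fe]] Gw; rewrite /loops -fr.
have [] // := @walk_transfer _ _ G H f (fun=> vert G) (size w) fr Gr
  (fun _ => GS) _ w _ (leqnn _) Gw.
by move=> _ s z y _ Vz Vy /fe; apply.
Qed.

Lemma ball_vert_mono T (G : rgraph n T) i j :
  (i <= j)%N -> ball_vert G i `<=` ball_vert G j.
Proof.
move=> ij; rewrite -(subnK ij); elim: (j - i)%N => // k IH x /IH.
by left.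
Qed.

Lemma loops_ball_iso T U (G : rgraph n T) (H : rgraph n U) w r :
  (size w <= r)%N -> rgraph_iso (ball_graph G r) (ball_graph H r) ->
  loops G w -> loops H w.
Proof.
move=> wr [f [_ fr fe]] Gw; rewrite /loops -[root H]/(root (ball_graph H r)) -fr.
have [] // := @walk_transfer _ _ G H f (ball_vert G) r fr _ _ _ w _ wr Gw.
- by move=> i s z y Vz zy; right; exists s, z.
- move=> i s z y ir Vz Vy zy.
  have Bz := ball_vert_mono (ltnW ir) Vz; have By := ball_vert_mono ir Vy.
  by have /fe : edge (ball_graph G r) s z y by []; move=> /(_ Bz By) [].
Qed.

Lemma ball_root T (G : rgraph n T) r : ball_vert G r (root G).
Proof. exact: (@ball_vert_mono _ G 0%N). Qed.

Lemma loops_orbit_type T (a : gaction n T) x (g : free_group n) :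
  loops (val (repr (orbit_type a x))) (word g) <-> a g x = x.
Proof.
have GH : rgraph_iso (val (repr (orbit_type a x))) (schreier_graph a x).
  by apply/orbit_typeP; rewrite reprK.
rewrite -loops_schreier; split.
  apply: loops_iso GH; first exact: schreier_rgraph_root.
  have [c [x0 ->]] := set_mem (valP (repr (orbit_type a x))).
  by move=> s z y /= Vz [_ ->]; exact: gorbit_act.
apply: loops_iso (rgraph_iso_sym _ GH); last exact: schreier_rgraph_root.
  by exists 1%g => //; rewrite act1.
by move=> s z y /= Vz [_ ->]; exact: gorbit_act.
Qed.

Definition loop_cylinder (M : nat) (t : {ffun 'I_M -> bool}) : set (Sigma n) :=
  [set s | forall k : 'I_M, loops (val (repr s)) (word (fg_enum n k)) <-> t k].

Lemma open_loop_cylinder M (t : {ffun 'I_M -> bool}) : open (loop_cylinder t).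
Proof.
(* A walk of length at most [m] stays in the ball of radius [m], so that ball decides which of the
   [M] words are loops, and the set is a union of cylinders of radius [m]. *)
pose m := (\max_(k < M) size (word (fg_enum n k)))%N.
exists [set cylinder (s, m) | s in loop_cylinder t].
  move=> _ [s _ <-]; exists [fset (s, m)]%fset; first by move=> i _; exact: mem_set.
  apply/seteqP; split=> u /=; first by move=> /(_ (s, m)); rewrite /= inE eqxx; apply.
  by move=> su i /=; rewrite inE => /eqP ->.
apply/seteqP; split=> [u [_ [s st <-] su] k|s st]; last first.
  exists (cylinder (s, m)); first by exists s.
  exact: rgraph_iso_refl.
rewrite -st.
have km : (size (word (fg_enum n k)) <= m)%N.
  exact: (@leq_bigmax _ (fun k : 'I_M => size (word (fg_enum n k)))).
split; last exact: loops_ball_iso km su.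
apply: loops_ball_iso km _; apply: rgraph_iso_sym su; exact: ball_root.
Qed.

Lemma loop_cylinder_orbit_type T (a : gaction n T) M (t : {ffun 'I_M -> bool}) x :
  loop_cylinder t (orbit_type a x) <-> stab_type a M x = t.
Proof.
split=> [H|<- k]; last by rewrite loops_orbit_type ffunE asboolE.
apply/ffunP => k; rewrite ffunE; have := H k; rewrite loops_orbit_type => E.
by apply/idP/idP => [/asboolP/E|/E/asboolP].
Qed.

End Walks.

(** Equality of types is used only through this consequence: a finite stabilizer type is an open
    condition on the rooted Schreier graph. *)
Lemma same_type_stab_type (R : realType) n d d' (X : measurableType d)
    (Y : measurableType d') (mu : probability X R) (nu : probability Y R)
    (a : gaction n X) (b : gaction n Y) M (t : {ffun 'I_M -> bool}) :
  same_type mu nu a b ->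
  pr mu [set x | stab_type a M x = t] = pr nu [set x | stab_type b M x = t].
Proof.
move=> ab; have mC : @measurable _ (borel_Sigma n) (@loop_cylinder n M t).
  by apply: sub_sigma_algebra; exact: open_loop_cylinder.
have := ab _ mC.
rewrite /action_type /pushforward /pr => E; congr fine; move: E.
rewrite (_ : _ @^-1` _ = [set x | stab_type a M x = t]); last first.
  by apply/seteqP; split=> x ?; exact/loop_cylinder_orbit_type.
rewrite (_ : _ @^-1` _ = [set x | stab_type b M x = t]) //.
by apply/seteqP; split=> x ?; exact/loop_cylinder_orbit_type.
Qed.

(** * Finite tilings of a hyperfinite action *)

Section LexOrder.
Context (T : Type) (U : nat -> set T).
Hypothesis sepU : forall x y, (forall k, U k x <-> U k y) -> x = y.

(** A linear order given by a countable formula in the [U k], so that taking the least point of a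
    finite component is a measurable choice of root. *)
Definition lexlt (x y : T) : Prop :=
  exists k, (forall j, (j < k)%N -> U j x <-> U j y) /\ (~ U k x /\ U k y).

Lemma lexlt_irr x : ~ lexlt x x.
Proof. by move=> [k [_ []]]. Qed.

Lemma lexlt_trans x y z : lexlt x y -> lexlt y z -> lexlt x z.
Proof.
move=> [k [xy [nx yk]]] [l [yz [ny zl]]]; have [kl|lk|kl] := ltngtP k l.
- exists k; split=> [j jk|]; first by rewrite xy // yz // (ltn_trans jk).
  by split=> //; apply/(yz _ kl).
- exists l; split=> [j jl|]; first by rewrite xy ?yz // (ltn_trans jl).
  by split=> //; rewrite xy.
- by subst l.
Qed.

Lemma lexlt_total x y : x = y \/ (lexlt x y \/ lexlt y x).
Proof.
have [xy|nxy] := pselect (forall k, U k x <-> U k y); first by left; exact: sepU.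
right; have ex : exists k, `[< ~ (U k x <-> U k y) >].
  by have [k nk] := (existsNP _).2 nxy; exists k; exact/asboolP.
case: (ex_minnP ex) => k /asboolP nk kmin.
have eqj j : (j < k)%N -> U j x <-> U j y.
  by move=> jk; apply: contrapT => nj; have := kmin j (asboolT nj); rewrite leqNgt jk.
have [xk|nxk] := pselect (U k x).
  right; exists k; split=> [j /eqj []|]; first by split.
  by split=> // yk; apply: nk; split.
left; exists k; split=> //; split=> //.
by apply: contrapT => nyk; apply: nk; split.
Qed.

Lemma lexlt_min_seq (x : T) (s : seq T) :
  exists m, List.In m (x :: s) /\ forall y, List.In y (x :: s) -> ~ lexlt y m.
Proof.
elim: s x => [|y s IH] x.
  by exists x; split; [left | move=> y [<-|//]; exact: lexlt_irr].
have [m [ms mP]] := IH y; have [xm|nxm] := pselect (lexlt x m).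
  exists x; split; first by left.
  move=> z [<-|zs]; first exact: lexlt_irr.
  by move=> zx; apply: (mP z zs); exact: lexlt_trans xm.
exists m; split; first by right.
by move=> z [<-|zs] //; exact: mP.
Qed.

Lemma lexlt_min (S : set T) : finite_set S -> S !=set0 ->
  exists m, S m /\ forall y, S y -> ~ lexlt y m.
Proof.
move=> [k Sk] [x0 Sx0].
have /card_set_bijP[g [gS ginj gsurj]] := Sk.
have /choice[f fP] i : exists x, (i < k)%N -> S x /\ g x = i.
  have [ik|//] := ltnP i k; last by exists x0.
  by have [x Sx gx] := gsurj i ik; exists x.
have fS i : (i < k)%N -> S (f i) by case/fP.
have fsurj y : S y -> exists2 i, (i < k)%N & f i = y.
  move=> Sy; exists (g y); first exact: gS.
  by have [Sf gf] := fP _ (gS _ Sy); apply: ginj => //; exact/mem_set.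
have [m [ms mP]] := lexlt_min_seq x0 [seq f i | i <- iota 0 k].
have inS y : S y <-> List.In y (x0 :: [seq f i | i <- iota 0 k]).
  split=> [Sy|[<- //|]].
    have [i /= ik <-] := fsurj y Sy; right; apply: List.in_map.
    have : i \in iota 0 k by rewrite mem_iota.
    elim: (iota 0 k) => //= j s IH; rewrite inE => /orP[/eqP ->|/IH]; by [left|right].
  have H j : j \in iota 0 k -> S (f j) by rewrite mem_iota => /= jk; exact: fS.
  elim: (iota 0 k) H => //= j s IH H [<-|]; first by apply: H; rewrite inE eqxx.
  by apply: IH => l ls; apply: H; rewrite inE ls orbT.
by exists m; split=> [|y /inS]; [exact/inS | exact: mP].
Qed.

Lemma lexlt_min_unique (S : set T) m m' : S m -> S m' ->
  (forall y, S y -> ~ lexlt y m) -> (forall y, S y -> ~ lexlt y m') -> m = m'.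
Proof.
move=> Sm Sm' mP mP'.
by case: (lexlt_total m m') => // -[/mP'|/mP]; case.
Qed.

End LexOrder.

(** * Components described by words *)

Section Components.
Context (n : nat) (T : Type) (a : gaction n T) (Z : set T).

Definition act_seq (w : seq (letter n)) (x : T) : T := foldr (fun s => a (gen s)) x w.

(** A letter that fixes the current point is allowed even in [Z], since it is not an edge of the
    graphing. Components become unions over the countably many words. *)
Fixpoint traverse (w : seq (letter n)) (x : T) : Prop :=
  if w is s :: w' then traverse w' x /\
    (act_seq w x = act_seq w' x \/ (~ Z (act_seq w' x) /\ ~ Z (act_seq w x)))
  else True.

Lemma act_seq_ex w : exists g, forall x, act_seq w x = a g x.
Proof.
elim: w => [|s w [g IH]]; first by exists 1%g => x; rewrite act1.
by exists (gen s * g)%g => x; rewrite actM -IH.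
Qed.

Lemma component_refl x : component a Z x x.
Proof. exact: rt_refl. Qed.

Lemma component_trans x y z :
  component a Z x y -> component a Z y z -> component a Z x z.
Proof. exact: rt_trans. Qed.

Lemma component_sym x y : component a Z x y -> component a Z y x.
Proof.
elim=> {x y} [x y [[xy [s ys]] nx ny]|x|x y z _ yx _ zy]; last exact: rt_trans yx.
  apply: rt_step; split=> //; split; first exact: nesym.
  by exists (linv s); rewrite gen_linv ys actK.
exact: rt_refl.
Qed.

Lemma traverse_component w x : traverse w x -> component a Z x (act_seq w x).
Proof.
elim: w => [|s w IH] /=; first by move=> _; exact: rt_refl.
move=> [/IH xw st]; apply: component_trans xw _.
have [->|ne] := pselect (a (gen s) (act_seq w x) = act_seq w x); first exact: rt_refl.
case: st => [//|[nZ nZ']]; apply: rt_step; split=> //.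
by split; [exact: nesym | exists s].
Qed.

Lemma componentP x y : component a Z x y <-> exists w, traverse w x /\ act_seq w x = y.
Proof.
split=> [xy|[w [xw <-]]]; last exact: traverse_component.
elim: xy => {x y} [x y [[xy [s ys]] nx ny]|x|x y z _ [u [xu uy]] _ [w [yw wz]]].
- by exists [:: s]; rewrite /= /act_seq /= -ys; split=> //; split=> //; right.
- by exists [::].
- exists (w ++ u); have E v : act_seq (v ++ u) x = act_seq v y.
    by rewrite /act_seq foldr_cat -uy.
  split; last by rewrite E.
  elim: w yw {wz} => [|s w IH] //= [/IH wu st]; split=> //.
  by rewrite E.
Qed.

Fixpoint hits (w : seq (letter n)) (x : T) : Prop :=
  if w is s :: w' then Z (act_seq w x) \/ hits w' x else Z x.

Lemma hits_traverse w x : ~ hits w x -> ~ Z (act_seq w x) /\ traverse w x.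
Proof.
elim: w => [|s w IH] //= nh; have [|nZ xw] := IH; first by move=> h; apply: nh; right.
have nZs : ~ Z (act_seq (s :: w) x) by move=> h; apply: nh; left.
by split=> //; split=> //; right.
Qed.

End Components.

(** * Measurable tilings with finitely many names *)

Section Castle.
Context (R : realType) (n : nat) d (X : measurableType d) (mu : probability X R).
Variable (U : nat -> set X).
Hypothesis mU : forall k, measurable (U k).
Hypothesis sepU : forall x y, (forall k, U k x <-> U k y) -> x = y.
Variable a : gaction n X.
Hypothesis pa : pmp mu a.
Local Notation pr := (pr mu).

Lemma measurable_act g : measurable_fun setT (a g).
Proof. by case: (pa g). Qed.

Lemma pr_act g S : measurable S -> pr [set x | S (a g x)] = pr S.
Proof. by move=> mS; have [_ /(_ _ mS)] := pa g; rewrite /pr => <-. Qed.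

Lemma measurable_act_seq w : measurable_fun setT (act_seq a w).
Proof.
have [g E] := act_seq_ex a w; rewrite (_ : act_seq a w = a g); last exact/funext.
exact: measurable_act.
Qed.

Lemma pr_hits Z w : measurable Z ->
  measurable [set x | hits a Z w x] /\ pr [set x | hits a Z w x] <= (size w).+1%:R * pr Z.
Proof.
move=> mZ; elim: w => [|s w [IHm IH]] /=; first by rewrite mul1r.
have mZs : measurable [set x | Z (a (gen s) (act_seq a w x))].
  exact: (meas_preim (measurable_act_seq (s :: w)) mZ).
split; first exact: meas_or.
apply: le_trans (prU_le mu mZs IHm) _; rewrite -natr1 mulrDl mul1r addrC lerD //.
have [g E] := act_seq_ex a (s :: w).
rewrite (_ : [set x | _] = [set x | Z (a g x)]) ?pr_act //.
by apply/seteqP; split=> x /=; rewrite -E.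
Qed.

Definition is_root Z (x : X) (k : nat) : Prop :=
  component a Z x (a (fg_enum n k) x) /\
  forall j, component a Z x (a (fg_enum n j) x) ->
    ~ lexlt U (a (fg_enum n j) x) (a (fg_enum n k) x).

Lemma component_orbit Z x y : component a Z x y -> exists k, y = a (fg_enum n k) x.
Proof.
move=> /componentP[w [_ <-]]; have [g E] := act_seq_ex a w.
by exists (pickle g); rewrite fg_enumK.
Qed.

Lemma is_root_ex Z x : finite_set (component a Z x) -> exists k, `[< is_root Z x k >].
Proof.
move=> fC; have [|m [xm mmin]] := lexlt_min U fC; first by exists x;
  exact: component_refl.
have [k E] := component_orbit xm; exists k; apply/asboolP; split; rewrite -?E //.
by move=> j; exact: mmin.
Qed.

Lemma is_root_unique Z x y k l : component a Z x y -> is_root Z x k -> is_root Z y l ->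
  a (fg_enum n k) x = a (fg_enum n l) y.
Proof.
move=> xy [xk kmin] [yl lmin].
apply: (lexlt_min_unique sepU (S := component a Z x)) => //.
- exact: component_trans yl.
- by move=> z xz; have [j E] := component_orbit xz; rewrite E; apply: kmin; rewrite -E.
- move=> z xz; have yz := component_trans (component_sym xy) xz.
  by have [j E] := component_orbit yz; rewrite E; apply: lmin; rewrite -E.
Qed.

Lemma measurable_is_root Z k : measurable Z -> measurable [set x | is_root Z x k].
Proof.
move=> mZ.
have mtr w : measurable [set x | traverse a Z w x].
  elim: w => [|s w IH] /=; first exact: (@meas_const _ _ True).
  have mZw := meas_preim (measurable_act_seq w) mZ.
  have mZsw := meas_preim (measurable_act_seq (s :: w)) mZ.
  apply: meas_and => //; apply: meas_or.
    exact: (measurable_eq mU sepU (measurable_act_seq (s :: w)) (measurable_act_seq w)).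
  by apply: meas_and; exact: meas_not.
have mC j : measurable [set x | component a Z x (a (fg_enum n j) x)].
  rewrite (_ : [set x | _] = [set x | exists w, traverse a Z w x /\
      act_seq a w x = a (fg_enum n j) x]).
    apply: meas_ex => w; apply: meas_and; first exact: mtr.
    exact: (measurable_eq mU sepU (measurable_act_seq w) (measurable_act (fg_enum n j))).
  by apply/seteqP; split=> x /= /componentP.
have mUa j i : measurable [set x | U j (a (fg_enum n i) x)].
  exact: (meas_preim (measurable_act _) (mU j)).
apply: meas_and; first exact: mC.
apply: meas_all => j; apply: meas_imp; [exact: mC | apply: meas_not].
apply: meas_ex => i; apply: meas_and.
  apply: meas_all => l; apply: meas_imp; first exact: meas_const.
  by apply: meas_iff; exact: mUa.
by apply: meas_and; [apply: meas_not; exact: mUa | exact: mUa].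
Qed.

(* A tiling is just a finite-valued [kappa]: the tile of [x] is named by the
   point [g (kappa x) x], which need not belong to it. *)
Definition castle_root N (g : 'I_N -> free_group n) (kappa : X -> 'I_N) (x : X) : X :=
  a (g (kappa x)) x.

Lemma castle_ex m (F : 'I_m -> free_group n) (e : R) : hyperfinite mu a -> 0 < e ->
  exists N (g : 'I_N -> free_group n) (kappa : X -> 'I_N), discr_meas kappa /\
    pr [set x | exists k, castle_root g kappa (a (F k) x) <> castle_root g kappa x] <= e.
Proof.
move=> hyp e0.
pose L := (\max_(k < m) size (word (F k)))%N.
(* For each of the [m] elements the bad set costs at most [L + 3] times [dl]: [L.+1] for the points
   of the path that may hit [Z], and one for each endpoint whose name is truncated. *)
pose c : R := (m.+1 * (L + 3))%:R.
have c0 : 0 < c by rewrite ltr0n muln_gt0 addn_gt0 orbT.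
pose dl := e / c; have dl0 : 0 < dl by rewrite divr_gt0.
have [K [Z [K0 mZ muZ finZ]]] := hyp dl dl0.
have prZ : pr Z <= dl by rewrite -lee_fin -prE // ltW.
have fin x : exists k, `[< is_root Z x k >].
  apply: is_root_ex; apply: (card_le_finite (finZ x)); exact: finite_II.
pose kap x := ex_minn (fin x).
have kapP x : is_root Z x (kap x).
  by rewrite /kap; case: ex_minnP => k /asboolP.
have mkap : discr_meas kap.
  move=> k; rewrite (_ : _ @^-1` _ = [set x | is_root Z x k /\
      forall j, (j < k)%N -> ~ is_root Z x j]).
    apply: meas_and; first exact: measurable_is_root.
    apply: meas_all => j; apply: meas_imp; first exact: meas_const.
    by apply: meas_not; exact: measurable_is_root.
  apply/seteqP; split=> x /=; rewrite /kap.
    case: ex_minnP => j /asboolP rj jmin <-; split=> // i ij /asboolP /jmin.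
    by rewrite leqNgt ij.
  case: ex_minnP => j /asboolP rj jmin [rk kmin]; apply/eqP; rewrite eqn_leq.
  rewrite jmin; last exact/asboolP.
  by rewrite leqNgt; apply/negP => /kmin.
have [||N prN] := @pr_inc_approx R d X mu (fun N => [set x | (kap x <= N)%N]) dl _ _ dl0.
- by move=> N; exact: (@discr_meas_set _ _ _ kap (fun k => (k <= N)%N)).
- by move=> N x /= h; exact: leqW.
have mN : measurable [set x | (N < kap x)%N].
  exact: (@discr_meas_set _ _ _ kap (fun k => (N < k)%N)).
have {}prN : pr [set x | (N < kap x)%N] <= dl.
  apply: le_trans prN; rewrite le_eqVlt; apply/orP; left; apply/eqP; congr (pr _).
  apply/seteqP; split=> x /=; last by rewrite ltnNge => -[_ /negP].
  by rewrite ltnNge => /negP ?; split=> //; exists (kap x).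
(* A point with too large an index gets the arbitrary name 0; such points have measure at most [dl]
   and are counted as bad. *)
pose kappa x : 'I_N.+1 := if (kap x <= N)%N then inord (kap x) else ord0.
exists N.+1, (fun i : 'I_N.+1 => fg_enum n i), kappa; split.
  exact: (@discr_meas_comp _ _ _ _ kap (fun k => if (k <= N)%N then inord k else ord0)).
have rootE x : (kap x <= N)%N ->
    castle_root (fun i : 'I_N.+1 => fg_enum n i) kappa x = a (fg_enum n (kap x)) x.
  by move=> xN; rewrite /castle_root /kappa xN inordK.
set rt := castle_root _ _ in rootE *.
have mka : discr_meas kappa.
  exact: (@discr_meas_comp _ _ _ _ kap (fun k => if (k <= N)%N then inord k else ord0)).
have mrt : measurable_fun setT rt.
  exact: (meas_glue mka (f := fun (i : 'I_N.+1) x => a (fg_enum n i) x) (fun i =>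
    measurable_act _)).
pose bad k := [set x | (N < kap x)%N \/ ((N < kap (a (F k) x))%N \/ hits a Z (word (F
  k)) x)].
have mbad k : measurable (bad k).
  apply: meas_or => //; apply: meas_or; last by have [] := pr_hits (word (F k)) mZ.
  exact: (meas_preim (measurable_act (F k)) mN).
apply: le_trans (_ : pr [set x | exists k, bad k x] <= _).
  apply: pr_le.
  - apply: meas_ex => k; apply: meas_not.
    exact: (measurable_eq mU sepU (measurableT_comp mrt (measurable_act (F k))) mrt).
  - exact: meas_ex.
  move=> x /= [k nk]; exists k; apply: contrapT => nb; apply: nk.
  have xN : (kap x <= N)%N by rewrite leqNgt; apply/negP => h; apply: nb; left.
  have fN : (kap (a (F k) x) <= N)%N.
    by rewrite leqNgt; apply/negP => h; apply: nb; right; left.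
  have [_ tr] : ~ Z (act_seq a (word (F k)) x) /\ traverse a Z (word (F k)) x.
    by apply: hits_traverse => h; apply: nb; right; right.
  rewrite !rootE //; apply: (is_root_unique (Z := Z)) => //.
  by apply: component_sym; rewrite act_word; exact: traverse_component tr.
apply: le_trans (pr_ex_le mu mbad) _.
have bk k : pr (bad k) <= (L + 3)%:R * dl.
  have [mh prh] := pr_hits (word (F k)) mZ.
  have mN' := meas_preim (measurable_act (F k)) mN.
  have p1 := prU_le mu mN (measurableU _ _ mN' mh); have p2 := prU_le mu mN' mh.
  have p3 := pr_act (F k) mN.
  have p4 : (size (word (F k))).+1%:R * pr Z <= L.+1%:R * dl.
    apply: ler_pM => //; first exact: pr_ge0.
    rewrite ler_nat ltnS; exact: (@leq_bigmax _ (fun k : 'I_m => size (word (F k)))).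
  have E : (L + 3)%:R * dl = L.+1%:R * dl + dl + dl.
    by rewrite addn3 -!natr1 !mulrDl !mul1r.
  rewrite E; apply: le_trans p1 _; move: p2 p3; rewrite -/(setU _ _) => p2 p3.
  lra.
apply: le_trans (ler_sum _ (fun k _ => bk k)) _.
rewrite sumr_const card_ord -[leLHS]mulr_natl mulrA -natrM /dl mulrA ler_pdivrMr //.
rewrite mulrC ler_pM2l // ler_nat leq_mul2r leqnSn orbT //.
Qed.

End Castle.

(** * Finite conditional probabilities *)

Lemma bounded_small_increment (R : realType) (v : nat -> R) (B e : R) :
  (forall j, v j <= B) -> 0 <= v 0%N -> 0 < e -> exists j, v j.+1 - v j <= e.
Proof.
move=> vB v0 e0; apply: contrapT => /forallNP H.
have vj j : j%:R * e <= v j.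
  elim: j => [|j IH]; first by rewrite mul0r.
  by have /negP := H j; rewrite -ltNge -natr1 mulrDl mul1r; lra.
have Be : 0 <= B / e by rewrite divr_ge0 ?(ltW e0) // (le_trans v0 (vB 0%N)).
have := archi_boundP Be; set N := Num.bound _; rewrite ltr_pdivrMr //.
by have := vj N; have := vB N; lra.
Qed.

Section ConditionalProbability.
Context (R : realType) d (X : measurableType d) (mu : probability X R).
Local Notation pr := (pr mu).

Lemma pr_fiber (K L : finType) (S : X -> K) (phi : K -> L) (h : L -> R) A :
  discr_meas S -> measurable A ->
  \sum_s h (phi s) * pr [set x | A x /\ S x = s] =
  \sum_t h t * pr [set x | A x /\ phi (S x) = t].
Proof.
move=> mS mA; transitivity (\sum_t \sum_s h t * ((phi s == t)%:R * pr [set x | A x /\ S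
  x = s])).
  rewrite exchange_big; apply: eq_bigr => s _ /=.
  rewrite (bigD1 (phi s)) //= eqxx mul1r big1 ?addr0 // => t /negbTE nt.
  by rewrite eq_sym nt mul0r mulr0.
apply: eq_bigr => t _; rewrite -mulr_sumr; congr (_ * _).
rewrite [RHS](pr_sum mu mS); last first.
  apply: meas_and => //; exact: (@discr_meas_set _ _ _ S (fun s => phi s = t)).
apply: eq_bigr => s _; have [st|nst] := eqVneq (phi s) t.
  rewrite mul1r; congr (pr _); apply/seteqP; split=> x /= [].
    by move=> Ax Sx; rewrite Sx.
  by move=> [Ax _] Sx.
rewrite mul0r -[LHS](pr_set0 mu); congr (pr _); apply/seteqP; split=> x //= [[_ e] Sx].
by rewrite -Sx e eqxx in nst.
Qed.

Lemma pr_fiberT (K L : finType) (S : X -> K) (phi : K -> L) (h : L -> R) :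
  discr_meas S -> \sum_s h (phi s) * pr [set x | S x = s] =
  \sum_t h t * pr [set x | phi (S x) = t].
Proof.
move=> mS; have H := pr_fiber phi h mS (@measurableT _ X).
have E (J : eqType) (f : X ->
  J) j : pr [set x | [set: X] x /\ f x = j] = pr [set x | f x = j].
  by congr (pr _); apply/seteqP; split=> x //= [].
rewrite -[RHS](eq_bigr _ (fun t _ => congr1 ( *%R (h t)) (E _ (phi \o S) t))) -H.
by apply: eq_bigr => s _; rewrite E.
Qed.

Lemma pr_bool_sum (K : finType) (S : X -> K) (p : K -> bool) :
  discr_meas S -> pr [set x | p (S x)] = \sum_s (p s)%:R * pr [set x | S x = s].
Proof.
move=> mS; rewrite (pr_fiberT p (fun b : bool => b%:R)) // big_bool /= mul1r mul0r addr0.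
by congr (pr _); apply/seteqP.
Qed.

Definition cond_pr (K : finType) (A : set X) (S : X -> K) (s : K) : R :=
  pr [set x | A x /\ S x = s] / pr [set x | S x = s].

(** The squared L2 norm of the conditional probability of [A] given [S]; null values of [S]
    contribute 0 by the convention on division. *)
Definition energy (K : finType) (A : set X) (S : X -> K) : R :=
  \sum_s pr [set x | A x /\ S x = s] ^+ 2 / pr [set x | S x = s].

Section OneMap.
Variables (K : finType) (S : X -> K) (A : set X).
Hypotheses (mS : discr_meas S) (mA : measurable A).

Lemma pr_and_le s : pr [set x | A x /\ S x = s] <= pr [set x | S x = s].
Proof. by apply: pr_le => [||x []//]; [apply: meas_and => //; exact: mS | exact: mS]. Qed.

Lemma pr_and0 s : pr [set x | S x = s] = 0 -> pr [set x | A x /\ S x = s] = 0.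
Proof. by move=> s0; apply/eqP; rewrite eq_le pr_ge0 -s0 pr_and_le. Qed.

Lemma energy_ge0 : 0 <= energy A S.
Proof. by apply: sumr_ge0 => s _; rewrite divr_ge0 ?pr_ge0 // exprn_ge0 ?pr_ge0. Qed.

Lemma energy_le1 : energy A S <= 1.
Proof.
apply: (@le_trans _ _ (pr A)); last exact: pr_le1.
rewrite (pr_sum mu mS mA); apply: ler_sum => s _.
have [s0|s0] := eqVneq (pr [set x | S x = s]) 0.
  by rewrite (pr_and0 s0) s0 expr0n mul0r.
rewrite ler_pdivrMr ?lt_def ?s0 ?pr_ge0 // expr2 ler_wpM2l ?pr_ge0 //.
exact: pr_and_le.
Qed.

End OneMap.

(** Pythagoras: conditioning on [phi \o S] is an orthogonal projection of conditioning on [S]. *)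
Lemma energy_increment (K L : finType) (S : X -> K) (phi : K -> L) A :
  discr_meas S -> measurable A ->
  \sum_s pr [set x | S x = s] *
    (cond_pr A S s - cond_pr A (phi \o S) (phi s)) ^+ 2 =
  energy A S - energy A (phi \o S).
Proof.
move=> mS mA; have mphi : discr_meas (phi \o S) by exact: discr_meas_comp.
set q := cond_pr A (phi \o S).
transitivity (\sum_s (pr [set x | A x /\ S x = s] ^+ 2 / pr [set x | S x = s]
    - 2 * (q (phi s) * pr [set x | A x /\ S x = s]) + q (phi s) ^+ 2 * pr [set x | S x
        = s])).
  apply: eq_bigr => s _; rewrite {1}/cond_pr.
  have [s0|s0] := eqVneq (pr [set x | S x = s]) 0.
    by rewrite (pr_and0 mS mA s0) s0; ring.
  by field.
rewrite big_split /= sumrB -mulr_sumr (pr_fiber phi q mS mA).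
rewrite (pr_fiberT phi (fun t => q t ^+ 2) mS) /energy -addrA; congr (_ + _).
rewrite mulr_sumr -sumrN -big_split -sumrN /=; apply: eq_bigr => t _.
rewrite /q /cond_pr /=; have [t0|t0] := eqVneq (pr [set x | phi (S x) = t]) 0.
  by rewrite (pr_and0 mphi mA t0) t0; ring.
by field.
Qed.

Lemma energy_comp_le (K L : finType) (S : X -> K) (phi : K -> L) A :
  discr_meas S -> measurable A -> energy A (phi \o S) <= energy A S.
Proof.
move=> mS mA; rewrite -subr_ge0 -energy_increment //; apply: sumr_ge0 => s _.
by rewrite mulr_ge0 ?pr_ge0 // sqr_ge0.
Qed.

Lemma pr_partition (K : finType) (S : X -> K) : discr_meas S ->
  \sum_s pr [set x | S x = s] = 1.
Proof.
move=> mS; rewrite -(pr_setT mu) (pr_sum mu mS) //; apply: eq_bigr => s _.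
by congr (pr _); apply/seteqP; split=> x //= [].
Qed.

(* [|u| <= eta + u^2 / eta] replaces the Cauchy-Schwarz inequality. *)
Lemma cond_pr_close (K L J : finType) (S : X -> K) (phi : K -> L) (psi : L ->
  J) A (eta : R) :
  discr_meas S -> measurable A -> 0 < eta ->
  \sum_s pr [set x | S x = s] *
    `|cond_pr A (phi \o S) (phi s) - cond_pr A (psi \o phi \o S) (psi (phi s))| <=
  eta + (energy A S - energy A (psi \o phi \o S)) / eta.
Proof.
move=> mS mA eta0; have mphi : discr_meas (phi \o S) by exact: discr_meas_comp.
pose u t := cond_pr A (phi \o S) t - cond_pr A (psi \o phi \o S) (psi t).
apply: (@le_trans _ _ (\sum_s pr [set x | S x = s] * (eta + u (phi s) ^+ 2 / eta))).
  apply: ler_sum => s _; rewrite ler_wpM2l ?pr_ge0 // -/(u _).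
  have : 0 <= (`|u (phi s)| - eta) ^+ 2 + `|u (phi s)| * eta.
    by rewrite addr_ge0 ?sqr_ge0 // mulr_ge0 // ltW.
  rewrite sqrrB real_normK ?num_real // => H.
  rewrite -(ler_pM2r eta0) mulrDl divfK ?gt_eqF //.
  by rewrite -expr2; lra.
under eq_bigr do rewrite mulrDr mulrA.
rewrite big_split /= -!mulr_suml pr_partition // mul1r lerD2l ler_pM2r ?invr_gt0 //.
under eq_bigr do rewrite mulrC.
rewrite (pr_fiberT phi (fun t => u t ^+ 2) mS).
under eq_bigr do rewrite mulrC.
(* This is the increment between the two coarser maps; replacing [phi \o S] by [S] only raises the
   energy. *)
have := energy_increment psi mphi mA; rewrite /= => ->.
by rewrite lerD2r energy_comp_le.
Qed.

End ConditionalProbability.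

(** * Transfer of colorings between actions of the same type *)

Section StabTypes.
Context (n : nat).

Definition at_index M (s : {ffun 'I_M -> bool}) (k : nat) : bool :=
  if insub k is Some o then s o else false.

Lemma at_index_stab_type T (c : gaction n T) M x (g : free_group n) :
  (pickle g < M)%N -> at_index (stab_type c M x) (pickle g) = `[< c g x = x >].
Proof. by move=> gM; rewrite /at_index insubT ffunE /= fg_enumK. Qed.

(** An element [h] fixes [g x] exactly when its conjugate by the inverse of [g] fixes [x]. The value
    false for indices beyond [M'] is never met under [conj_bound]. *)
Definition conj_type (g : free_group n) M M' (s : {ffun 'I_M' -> bool}) : {ffun 'I_M ->
  bool} :=
  [ffun k : 'I_M => at_index s (pickle (g^-1 * (fg_enum n k * g))%g)].

Definition conj_bound (g : free_group n) M M' : Prop :=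
  forall k, (k < M)%N -> (pickle (g^-1 * (fg_enum n k * g))%g < M')%N.

Lemma stab_type_conj T (c : gaction n T) g M M' x : conj_bound g M M' ->
  stab_type c M (c g x) = conj_type g M (stab_type c M' x).
Proof.
move=> gM; apply/ffunP => k; rewrite !ffunE at_index_stab_type; last exact: gM.
by apply: asbool_equiv_eq; rewrite !actM; split=> [->|E];
  [rewrite actK | apply: (@act_inj _ _ c (g^-1)%g); rewrite E actK].
Qed.

Lemma conj_bound_ex (s : seq (free_group n)) M :
  exists M', (M <= M')%N /\ forall g, g \in s -> conj_bound g M M'.
Proof.
elim: s => [|g s [M' [MM' IH]]]; first by exists M.
pose M1 := (\max_(k < M) (pickle (g^-1 * (fg_enum n k * g))%g).+1)%N.
exists (M' + M1)%N; split=> [|h]; first exact: leq_trans (leq_addr _ _).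
rewrite inE => /orP[/eqP ->|/IH hM] k kM; last exact: leq_trans (hM k kM) (leq_addr _ _).
apply: leq_trans (leq_addl _ _).
exact: (@leq_bigmax _ (fun k : 'I_M =>
  (pickle (g^-1 * (fg_enum n k * g))%g).+1) (Ordinal kM)).
Qed.

End StabTypes.

Lemma pickle_bound (T : countType) (s : seq T) : exists M, forall x, x \in s ->
  (pickle x < M)%N.
Proof.
elim: s => [|x s [M IH]]; first by exists 0%N.
exists (M + (pickle x).+1)%N => y; rewrite inE => /orP[/eqP ->|/IH yM].
  exact: leq_addl.
exact: leq_trans yM (leq_addr _ _).
Qed.

Section Pattern.
Context (n : nat) (T : Type) (I : finType) (m : nat) (F : 'I_m -> free_group n).

(** The second component records which of the translates of [x] coincide, which for a non-free
    action the colors do not tell. *)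
Definition pattern (c : gaction n T) (f : T -> I) (x : T) :
    {ffun 'I_m -> I} * {ffun 'I_m * 'I_m -> bool} :=
  ([ffun k => f (c (F k) x)],
   [ffun kl : 'I_m * 'I_m => `[< c (F kl.1) x = c (F kl.2) x >]]).

Lemma pattern_color c f c' f' x y : pattern c f x = pattern c' f' y ->
  forall k, f (c (F k) x) = f' (c' (F k) y).
Proof. by move=> [/ffunP E _] k; have := E k; rewrite !ffunE. Qed.

Lemma pattern_edge c f c' f' x y : pattern c f x = pattern c' f' y ->
  forall k l, c (F k) x = c (F l) x <-> c' (F k) y = c' (F l) y.
Proof.
move=> [_ /ffunP E] k l; have := E (k, l); rewrite !ffunE /= => klE.
by split=> h; apply/asboolP; [rewrite -klE | rewrite klE]; exact/asboolP.
Qed.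

Lemma patternP (c c' : gaction n T) (f f' : T ->
  I) x y : (forall k, f (c (F k) x) = f' (c' (F k) y)) ->
  (forall k l, c (F k) x = c (F l) x <-> c' (F k) y = c' (F l) y) ->
  pattern c f x = pattern c' f' y.
Proof.
move=> fE cE; congr (_, _); apply/ffunP => k; rewrite !ffunE //.
exact: asbool_equiv_eq.
Qed.

End Pattern.

Section Transfer.
Context (R : realType) (n : nat) d (X : measurableType d) (mu : probability X R).
Variable (U : nat -> set X).
Hypothesis mU : forall k, measurable (U k).
Hypothesis sepU : forall x y, (forall k, U k x <-> U k y) -> x = y.
Hypothesis mu_atomless : forall x : X, mu [set x] = 0%E.
Variables a b : gaction n X.
Hypotheses (pa : pmp mu a) (pb : pmp mu b).
Hypothesis ab : same_type mu mu a b.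
Local Notation pr := (pr mu).

Lemma discr_meas_stab_type (c : gaction n X) M : pmp mu c -> discr_meas (stab_type c M).
Proof.
move=> pc; apply: discr_meas_ffun => k; apply: discr_meas_bool.
exact: (measurable_eq mU sepU (measurable_act pc _) (@measurable_id _ _ _)).
Qed.

Lemma discr_meas_pattern (I : finType) m (F : 'I_m -> free_group n)
    (c : gaction n X) (f : X -> I) :
  pmp mu c -> discr_meas f -> discr_meas (pattern F c f).
Proof.
move=> pc mf; apply: discr_meas_pair.
  by apply: discr_meas_ffun => k; apply: (discr_meas_preim (measurable_act pc _)).
apply: discr_meas_ffun => kl; apply: discr_meas_bool.
exact: (measurable_eq mU sepU (measurable_act pc _) (measurable_act pc _)).
Qed.

(** * Sampling patterns of [a] on the tiles of [b] *)

Section Sampling.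
Variables (N : nat) (g : 'I_N -> free_group n) (kappa : X -> 'I_N).
Hypothesis mkappa : discr_meas kappa.
Let root := castle_root b g kappa.

(** The energies summed over the [N] indices are bounded by [N], so along a sequence of scales some
    increment is at most [theta]. *)
Lemma radius_ex M0 (theta : R) : 0 < theta -> exists M1 M M2, [/\ (M0 <= M)%N,
  forall i, conj_bound (g i) M M2, forall i, conj_bound (g i)^-1%g M1 M &
  \sum_i (energy mu (kappa @^-1` [set i]) (stab_type b M2) -
    energy mu (kappa @^-1` [set i]) (stab_type b M1)) <= theta].
Proof.
move=> th0; pose s := [seq g i | i <- enum 'I_N] ++ [seq (g i)^-1%g | i <- enum 'I_N].
have gs i : g i \in s by rewrite mem_cat map_f // mem_enum.
have Vs i : (g i)^-1%g \in s.
  by rewrite mem_cat; apply/orP; right; apply: map_f; rewrite mem_enum.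
have /choice[next nextP] M := conj_bound_ex s M.
pose rad k := iter k next M0.
have M0r k : (M0 <= rad k)%N.
  by elim: k => //= k IH; apply: leq_trans IH _; case: (nextP (rad k)).
pose en i M := energy mu (kappa @^-1` [set i]) (stab_type b M).
(* Only even scales are compared; the odd scale between two of them serves as [M]. *)
pose v j := \sum_i en i (rad j.*2).
have [j||j Hj] := @bounded_small_increment _ v N%:R theta _ _ th0.
- apply: (@le_trans _ _ (\sum_(i < N) 1)); last by rewrite sumr_const card_ord.
  by apply: ler_sum => i _; apply: energy_le1;
    [exact: discr_meas_stab_type | exact: mkappa].
- by apply: sumr_ge0 => i _; exact: energy_ge0.
exists (rad j.*2), (rad j.*2.+1), (rad j.*2.+2); split=> //.
- by move=> i; case: (nextP (rad j.*2.+1)) => _; apply; exact: gs.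
- by move=> i; case: (nextP (rad j.*2)) => _; apply; exact: Vs.
- by rewrite sumrB.
Qed.

Variables (I : finType) (m : nat) (F : 'I_m -> free_group n) (c : X -> I).
Hypothesis mc : discr_meas c.
Variables (M1 M M2 : nat).
Hypothesis Mg : forall i, conj_bound (g i) M M2.
Hypothesis MV : forall i, conj_bound (g i)^-1%g M1 M.
(** These elements fix the root [z] when [F k] moves the point named [i] to the point named [j] of
    the same tile; those of [Medge] fix [z] when [F k] and [F l] agree at the point named [i]. So
    the [M]-type of the root decides both. *)
Hypothesis Mroot : forall i j k, (pickle (g j * (F k * (g i)^-1))%g < M)%N.
Hypothesis Medge : forall i k l, (pickle (g i * ((F l)^-1 * (F k * (g i)^-1)))%g < M)%N.

Let PT := ({ffun 'I_m -> I} * {ffun 'I_m * 'I_m -> bool})%type.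
Let V := ({ffun 'I_M -> bool} * {ffun 'I_N -> PT})%type.

(** A sample at a root carries the patterns at all its possible tile points, so that one draw serves
    the whole tile. *)
Definition sample (x : X) : V :=
  (stab_type a M x, [ffun i => pattern F a c (a (g i)^-1%g x)]).

Lemma discr_meas_sample : discr_meas sample.
Proof.
apply: discr_meas_pair; first exact: discr_meas_stab_type.
apply: discr_meas_ffun => i; apply: (discr_meas_preim (measurable_act pa _)).
exact: discr_meas_pattern.
Qed.

(** Here [z] is viewed as a root: the second component marks the [i] for which the translate of [z]
    by the inverse of [g i] names [z] by [i]. *)
Definition tile (z : X) : {ffun 'I_M -> bool} * {ffun 'I_N -> bool} :=
  (stab_type b M z, [ffun i => kappa (b (g i)^-1%g z) == i]).

Lemma discr_meas_tile : discr_meas tile.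
Proof.
apply: discr_meas_pair; first exact: discr_meas_stab_type.
apply: discr_meas_ffun => i.
apply: (@discr_meas_comp _ _ _ _ (fun z => kappa (b (g i)^-1%g z)) (fun j => j == i)).
exact: (discr_meas_preim (measurable_act pb _)).
Qed.

Lemma stab_type_pr t : pr [set x | stab_type a M x = t] = pr [set x | stab_type b M x =
  t].
Proof. exact: same_type_stab_type. Qed.

(* Given the stabilizer type, the sampled value is independent of the tile. *)
Definition weight (j : {ffun 'I_M -> bool} * {ffun 'I_N -> bool}) (v : V) : R :=
  \sum_t (j.1 == t)%:R * (v.1 == t)%:R * (pr [set z | tile z = j] *
    (pr [set x | sample x = v] / pr [set x | stab_type a M x = t])).

Lemma weight_ge0 j v : 0 <= weight j v.
Proof. by apply: sumr_ge0 => t _; rewrite !mulr_ge0 ?invr_ge0 ?pr_ge0. Qed.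

Lemma weight_ne0 j v : weight j v != 0 ->
  v.1 = j.1 /\ exists x, sample x = v.
Proof.
move=> w0; have [t] : exists t, (j.1 == t)%:R * (v.1 == t)%:R * (pr [set z | tile z = j] *
    (pr [set x | sample x = v] / pr [set x | stab_type a M x = t])) != 0 :> R.
  apply: contrapT => /forallNP H; move/eqP: w0; apply; apply: big1 => t _.
  by apply/eqP; apply: contrapT => /negP; exact: H.
have [->|] := eqVneq j.1 t; last by rewrite !mul0r eqxx.
have [->|] := eqVneq v.1 t; last by rewrite mulr0 mul0r eqxx.
rewrite !mul1r => ne; split=> //; apply: contrapT => nx; move/eqP: ne; apply.
rewrite [X in pr X / _](_ : _ = set0) ?pr_set0 ?mul0r ?mulr0 //.
by apply/seteqP; split=> x //= E; apply: nx; exists x.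
Qed.

Lemma sum_weight j : \sum_v weight j v = pr [set z | tile z = j].
Proof.
rewrite exchange_big /= (bigD1 j.1) //= [X in _ + X]big1 ?addr0; last first.
  by move=> t /negbTE nt; apply: big1 => v _; rewrite eq_sym nt !mul0r.
rewrite (eq_bigr (fun v : V =>
  (pr [set z | tile z = j] / pr [set x | stab_type a M x = j.1]) *
   ((v.1 == j.1)%:R * pr [set x | sample x = v]))); last first.
  by move=> v _; rewrite eqxx mul1r; ring.
rewrite -mulr_sumr -(pr_bool_sum mu (fun v : V => v.1 == j.1) discr_meas_sample).
rewrite [X in _ * pr X](_ : _ = [set x | stab_type a M x = j.1]); last first.
  by apply/seteqP; split=> x /= /eqP.
(* A stabilizer type that is null for [a] is null for [b] by equality of types, so no mass of tiles
   is lost in the division by 0. *)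
have [t0|t0] := eqVneq (pr [set x | stab_type a M x = j.1]) 0; last by rewrite divfK.
rewrite t0 mulr0; apply/esym/(@pr_null_sub _ _ _ _ _ [set z | stab_type b M z = j.1]).
- exact: discr_meas_tile.
- exact: discr_meas_stab_type.
- by move=> z /= <-.
- by rewrite -stab_type_pr.
Qed.

Lemma weight_split (p : {ffun 'I_M -> bool} * {ffun 'I_N -> bool} -> bool) (q : V ->
  bool) :
  \sum_j \sum_v (p j)%:R * (q v)%:R * weight j v =
  \sum_t pr [set z | p (tile z) && (stab_type b M z == t)] *
    (pr [set x | q (sample x) && (stab_type a M x == t)] / pr [set x | stab_type a M x
      = t]).
Proof.
transitivity (\sum_t \sum_j \sum_v (p j && (j.1 == t))%:R * pr [set z | tile z = j] *
    ((q v && (v.1 == t))%:R * pr [set x | sample x = v] / pr [set x | stab_type a M x =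
      t])).
  rewrite [RHS]exchange_big; apply: eq_bigr => j _; rewrite [RHS]exchange_big /=.
  apply: eq_bigr => v _; rewrite mulr_sumr; apply: eq_bigr => t _.
  by rewrite -!mulnb !natrM; ring.
apply: eq_bigr => t _.
rewrite (pr_bool_sum mu (fun j => p j && (j.1 == t)) discr_meas_tile).
rewrite (pr_bool_sum mu (fun v : V => q v && (v.1 == t)) discr_meas_sample).
rewrite [RHS]mulr_suml; apply: eq_bigr => j _.
by rewrite [X in _ = _ * X]mulr_suml [RHS]mulr_sumr; apply: eq_bigr.
Qed.

Let K i := kappa @^-1` [set i].
Let phi i := @conj_type n (g i) M M2.
Let psi i := @conj_type n (g i)^-1%g M1 M.
Let dens i := cond_pr mu (K i) (phi i \o stab_type b M2).

Lemma phiE (e : gaction n X) i x : phi i (stab_type e M2 x) = stab_type e M (e (g i) x).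
Proof. by rewrite /phi -stab_type_conj. Qed.

Lemma psiE i x : psi i (phi i (stab_type b M2 x)) = stab_type b M1 x.
Proof. by rewrite phiE /psi -stab_type_conj // actK. Qed.

Section Sampled.
Variable xi : X -> V.
Hypotheses (mxi : discr_meas xi)
  (xiP : forall j v, pr [set z | tile z = j /\ xi z = v] = weight j v).

(** Substitute [g i] applied to [x] for [z]. Invariance under [b] turns the tile factor into the
    probability of name [i] together with type [t] at the translate; invariance under [a] turns the
    sample factor into that of pattern [q] together with type [t]. The denominators agree by
    equality of types, which leaves the density [dens i t]. *)
Lemma pr_sampled i q :
  pr [set z | (kappa (b (g i)^-1%g z) == i) && ((xi z).2 i == q)] =
  \sum_t dens i t * pr [set x | pattern F a c x = q /\ phi i (stab_type a M2 x) = t].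
Proof.
pose p (j : {ffun 'I_M -> bool} * {ffun 'I_N -> bool}) := j.2 i.
pose q' (v : V) := v.2 i == q.
have -> : [set z | (kappa (b (g i)^-1%g z) == i) && ((xi z).2 i == q)] =
    [set z | (fun jv => p jv.1 && q' jv.2) (tile z, xi z)].
  by apply/seteqP; split=> z; rewrite /p /= ffunE.
rewrite (pr_bool_sum mu (fun jv =>
  p jv.1 && q' jv.2) (discr_meas_pair discr_meas_tile mxi)).
transitivity (\sum_j \sum_v (p j)%:R * (q' v)%:R * weight j v).
  rewrite pair_bigA; apply: eq_bigr => -[j v] _ /=; rewrite -xiP -mulnb natrM;
    congr (_ * _).
  by congr (pr _); apply/seteqP; split=> z /= [-> ->].
rewrite weight_split; apply: eq_bigr => t _; rewrite /dens /cond_pr.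
have mTa := discr_meas_stab_type (M := M) pa;
  have mTb := discr_meas_stab_type (M := M) pb.
have mS := discr_meas_stab_type (M := M2) pb.
have Eb : pr [set x | (phi i \o stab_type b M2) x = t] = pr [set x | stab_type a M x = t].
  rewrite stab_type_pr -(pr_act pb (g i) (mTb t)); congr (pr _).
  by apply/seteqP; split=> x; rewrite /= phiE.
have EK : pr [set z | p (tile z) && (stab_type b M z == t)] =
    pr [set x | K i x /\ (phi i \o stab_type b M2) x = t].
  have mE : measurable [set z | p (tile z) && (stab_type b M z == t)].
    exact: (@discr_meas_set _ _ _ tile (fun j => p j && (j.1 == t)) discr_meas_tile).
  rewrite -(pr_act pb (g i) mE); congr (pr _); apply/seteqP; split=> x /=.
    rewrite /p /= ffunE actK => /andP[/eqP kx /eqP tx]; split=> //.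
    by rewrite phiE.
  by rewrite /p /= ffunE actK phiE => -[-> ->]; rewrite !eqxx.
have EQ : pr [set x | q' (sample x) && (stab_type a M x == t)] =
    pr [set x | pattern F a c x = q /\ phi i (stab_type a M2 x) = t].
  have mE : measurable [set x | q' (sample x) && (stab_type a M x == t)].
    exact: (@discr_meas_set _ _ _ sample (fun v => q' v && (v.1 == t)) discr_meas_sample).
  rewrite -(pr_act pa (g i) mE); congr (pr _); apply/seteqP; split=> x /=.
    by rewrite /q' /= ffunE actK phiE => /andP[/eqP -> /eqP ->].
  by rewrite /q' /= ffunE actK phiE => -[-> ->]; rewrite !eqxx.
by rewrite Eb EK EQ; ring.
Qed.

(** For every [i] the twice conjugated type is just the [M1]-type of the point itself, so these are
    the probabilities of the names given one and the same event. *)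
Lemma sum_cond_pr s : pr [set x | stab_type b M2 x = s] != 0 ->
  \sum_i cond_pr mu (K i) (psi i \o phi i \o stab_type b M2) (psi i (phi i s)) = 1.
Proof.
move=> s0; have [y ys] : exists y, stab_type b M2 y = s.
  apply: contrapT => ny; move/eqP: s0; apply.
  rewrite (_ : [set _ | _] = set0) ?pr_set0 //.
  by apply/seteqP; split=> x //= xs; apply: ny; exists x.
have mT := discr_meas_stab_type (M := M1) pb.
pose t0 := stab_type b M1 y.
have t0n : pr [set x | stab_type b M1 x = t0] != 0.
  apply: contra_neq s0 => t00; apply: (@pr_null_sub _ _ _ _ _ _ _ _ _ t00).
  - exact: (discr_meas_stab_type (M := M2) pb).
  - exact: mT.
  - case: (@pselect (exists i : 'I_N, True)) => [[i _]|nN] x /= xs.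
      by rewrite /t0 -(psiE i) -(psiE i y) xs ys.
    by case: nN; exists (kappa x).
rewrite (eq_bigr (fun i => pr [set x | stab_type b M1 x = t0 /\ kappa x = i] /
    pr [set x | stab_type b M1 x = t0])); last first.
  move=> i _; rewrite /cond_pr -ys psiE; congr (_ / _).
    by congr (pr _); apply/seteqP; split=> x /=; rewrite psiE => -[].
  by congr (pr _); apply/seteqP; split=> x /=; rewrite psiE.
by rewrite -mulr_suml -(pr_sum mu mkappa (mT t0)) divff.
Qed.

(** The densities are replaced by conditional probabilities given the [M1]-type, which add up to 1;
    [cond_pr_close] bounds the cost [w i] for each [i]. *)
Lemma sum_pr_sampled q (eta : R) : 0 < eta ->
  pr [set x | pattern F a c x = q] - (N%:R * eta +
    (\sum_i (energy mu (K i) (stab_type b M2) - energy mu (K i) (stab_type b M1))) /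
      eta) <=
  \sum_i pr [set z | (kappa (b (g i)^-1%g z) == i) && ((xi z).2 i == q)].
Proof.
move=> eta0; have mSa := discr_meas_stab_type (M := M2) pa;
  have mSb := discr_meas_stab_type (M := M2) pb.
have mQ : measurable [set x | pattern F a c x = q] by exact: (discr_meas_pattern F pa mc).
pose Q := [set x | pattern F a c x = q].
pose w i s := `|dens i (phi i s) -
   cond_pr mu (K i) (psi i \o phi i \o stab_type b M2) (psi i (phi i s))|.
have wle i : \sum_s pr [set x | stab_type b M2 x = s] * w i s <=
    eta + (energy mu (K i) (stab_type b M2) - energy mu (K i) (stab_type b M1)) / eta.
  have E : psi i \o phi i \o stab_type b M2 = stab_type b M1.
    by apply/funext => x; rewrite /= psiE.
  rewrite -[in X in _ <= X]E.
  exact: (@cond_pr_close R d X mu _ _ _ _ (phi i) (psi i) (K i) eta mSb (mkappa i) eta0).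
have wsum : \sum_i \sum_s pr [set x | stab_type b M2 x = s] * w i s <= N%:R * eta +
    (\sum_i (energy mu (K i) (stab_type b M2) - energy mu (K i) (stab_type b M1))) / eta.
  apply: le_trans (ler_sum _ (fun i _ => wle i)) _.
  by rewrite big_split /= sumr_const card_ord -[eta *+ N]mulr_natl mulr_suml.
apply: (@le_trans _ _ (pr Q - \sum_i \sum_s pr [set x | stab_type b M2 x = s] * w i s)).
  by rewrite lerD2l lerN2.
rewrite [leRHS](eq_bigr (fun i => \sum_s dens i (phi i s) *
    pr [set x | Q x /\ stab_type a M2 x = s])); last first.
  by move=> i _; rewrite pr_sampled -(pr_fiber mu (phi i) (dens i) mSa mQ).
rewrite lerBlDr (pr_sum mu mSa mQ) exchange_big [X in _ + X]exchange_big -big_split /=.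
apply: ler_sum => s _; rewrite -mulr_suml -mulr_sumr.
(* The error is averaged over types of [b], whereas the pattern is averaged over types of [a]. *)
have sab : pr [set x | stab_type a M2 x = s] = pr [set x | stab_type b M2 x = s].
  exact: same_type_stab_type.
have Qle := pr_and_le mu mSa mQ s; rewrite sab in Qle.
have Q0 := pr_ge0 mu [set x | Q x /\ stab_type a M2 x = s].
set z := pr [set x | stab_type b M2 x = s] in Qle *.
set r := pr [set x | Q x /\ _] in Qle Q0 *.
have [z0|z0] := eqVneq z 0.
  have -> : r = 0 by apply/eqP; rewrite eq_le Q0 -z0 Qle.
  by rewrite z0 mulr0 mul0r addr0.
have := sum_cond_pr z0; set one := \sum_i _ => oneE.
have W0 : 0 <= \sum_i w i s by apply: sumr_ge0 => i _; exact: normr_ge0.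
have H : 1 <= \sum_i dens i (phi i s) + \sum_i w i s.
  rewrite -oneE -big_split /=; apply: ler_sum => i _.
  by rewrite /w addrC -lerBlDr distrC; exact: ler_norm.
apply: (@le_trans _ _ ((\sum_i dens i (phi i s) + \sum_i w i s) * r)).
  by rewrite -[leLHS]mul1r ler_wpM2r.
by rewrite mulrDl lerD2l [leRHS]mulrC ler_wpM2l.
Qed.

(** There are finitely many sampled values, so an arbitrary choice of a point for each raises no
    question of measurability. *)
Definition representative (v : V) (x0 : X) : X :=
  if pselect (exists x, sample x = v) is left ex then sval (cid ex) else x0.

Lemma representativeP v x0 : (exists x, sample x = v) -> sample (representative v x0) = v.
Proof. by move=> ex; rewrite /representative; case: pselect => // ex'; case: cid. Qed.

Variable x0 : X.

(* [y] copies the color that [a] gives to the corresponding point of the orbit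
   of the representative sampled at the root of the tile of [y]. *)
Definition transferred_color (y : X) : I :=
  c (a (g (kappa y))^-1%g (representative (xi (root y)) x0)).

Lemma discr_meas_xi_root : discr_meas (fun y => xi (root y)).
Proof.
move=> v; rewrite (_ : _ @^-1` _ = [set y | exists i, kappa y = i /\ xi (b (g i) y) = v]).
  apply: meas_ex => i; apply: meas_and; first exact: mkappa.
  exact: (discr_meas_preim (measurable_act pb _) mxi).
by apply/seteqP; split=> y /=; [exists (kappa y) | move=> [i [<-]]].
Qed.

Lemma discr_meas_transferred_color : discr_meas transferred_color.
Proof.
exact: (@discr_meas_comp _ _ _ _ (fun y => (kappa y, xi (root y)))
  (fun iv => c (a (g iv.1)^-1%g (representative iv.2 x0)))
  (discr_meas_pair mkappa discr_meas_xi_root)).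
Qed.

Definition good_sample (z : X) : Prop :=
  (xi z).1 = stab_type b M z /\ exists x, sample x = xi z.

(** All the translates of [y] have the same root [z], so they copy from the same representative
    [x']. As [x'] and [z] have the same [M]-type, every relation between positions in the tile holds
    at [x'] if and only if it holds at [z]. *)
Lemma pattern_transferred y : good_sample (root y) ->
  (forall k, root (b (F k) y) = root y) ->
  pattern F b transferred_color y = (xi (root y)).2 (kappa y).
Proof.
move=> [xi1 ex] inner; set z := root y in xi1 ex inner *.
pose x' := representative (xi z) x0.
have sx' : sample x' = xi z by exact: representativeP.
have stabE h : (pickle h < M)%N -> a h x' = x' <-> b h z = z.
  move=> hM; have := at_index_stab_type a x' hM;
    rewrite -[stab_type a M x']/((sample x').1).
  rewrite sx' xi1 (at_index_stab_type b z hM) => E.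
  by split=> h1; apply/asboolP; [rewrite E | rewrite -E]; exact/asboolP.
rewrite -sx' /sample /= ffunE.
have yE : y = b (g (kappa y))^-1%g z by rewrite /z /root /castle_root actK.
apply: patternP => [k|k l].
- rewrite /transferred_color inner -/x'; congr (c _).
  set j := kappa (b (F k) y).
  (* Common root: the [k]-th translate of [y], taken back by its own name [j], is again [z]. At [x']
     this says that the color it copies sits at the [k]-th translate of the point copied by [y]. *)
  have : b (g j * (F k * (g (kappa y))^-1))%g z = z.
    by rewrite !actM -yE; exact: inner.
  move/(stabE _ (Mroot _ _ _)); rewrite !actM => E.
  by apply: (@act_inj _ _ a (g j)); rewrite actVK E.
- rewrite {1 2}yE.
  have := stabE _ (Medge (kappa y) k l); rewrite !actM => E.
  split=> H.
    have /E : b (g (kappa y)) (b (F l)^-1%g (b (F k) (b (g (kappa y))^-1%g z))) = z.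
      by rewrite H actK actVK.
    move=> Ea; apply: (@act_inj _ _ a (F l)^-1%g); rewrite actK.
    by apply: (@act_inj _ _ a (g (kappa y))); rewrite Ea actVK.
  have /E : a (g (kappa y)) (a (F l)^-1%g (a (F k) (a (g (kappa y))^-1%g x'))) = x'.
    by rewrite H actK actVK.
  move=> Eb; apply: (@act_inj _ _ b (F l)^-1%g); rewrite actK.
  by apply: (@act_inj _ _ b (g (kappa y))); rewrite Eb actVK.
Qed.

(** Pairs of weight 0 are almost never drawn, and the root of [y] is one of finitely many translates
    of [y]. *)
Lemma good_sample_pr : measurable [set y | ~ good_sample (root y)] /\
  pr [set y | ~ good_sample (root y)] = 0.
Proof.
pose bad (jv : ({ffun 'I_M -> bool} * {ffun 'I_N -> bool}) * V) :=
  ~ (jv.2.1 = jv.1.1 /\ exists x, sample x = jv.2).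
have mB : measurable [set z | bad (tile z, xi z)].
  exact: (@discr_meas_set _ _ _ _ bad (discr_meas_pair discr_meas_tile mxi)).
have B0 : pr [set z | bad (tile z, xi z)] = 0.
  rewrite (_ : [set z | _] = [set z | (fun jv => `[< bad jv >]) (tile z, xi z)]).
    rewrite (pr_bool_sum mu (fun jv =>
      `[< bad jv >]) (discr_meas_pair discr_meas_tile mxi)).
    apply: big1 => -[j v] _; case: asboolP => [nb|]; last by rewrite mul0r.
    rewrite mul1r (_ : [set _ | _] = [set z | tile z = j /\ xi z = v]).
      by rewrite xiP; apply/eqP; apply: contraT => /weight_ne0.
    by apply/seteqP; split=> z /= [-> ->].
  by apply/seteqP; split=> z /asboolP.
have mBi i : measurable [set y | bad (tile (b (g i) y), xi (b (g i) y))].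
  exact: (meas_preim (measurable_act pb (g i)) mB).
have E : [set y | ~ good_sample (root y)] =
    [set y | exists i, kappa y = i /\ bad (tile (b (g i) y), xi (b (g i) y))].
  apply/seteqP; split=> y /=; first by move=> nb; exists (kappa y).
  by move=> [i [<-]].
have mE : measurable [set y | ~ good_sample (root y)].
  by rewrite E; apply: meas_ex => i; apply: meas_and; [exact: mkappa | exact: mBi].
split=> //; apply: (@pr_null_sub _ _ _ _ _
  [set y | exists i, bad (tile (b (g i) y), xi (b (g i) y))]) => //.
- exact: meas_ex.
- by rewrite E => y [i [_ ?]]; exists i.
- apply/eqP; rewrite eq_le pr_ge0 andbT; apply: le_trans (pr_ex_le mu mBi) _.
  by rewrite big1 // => i _; rewrite (pr_act pb (g i) mB) B0.
Qed.

Lemma transferred_color_pr q (eta e : R) : 0 < eta ->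
  pr [set y | exists k, root (b (F k) y) <> root y] <= e ->
  pr [set x | pattern F a c x = q] - (N%:R * eta +
    (\sum_i (energy mu (K i) (stab_type b M2) - energy mu (K i) (stab_type b M1))) /
      eta) - e <=
  pr [set y | pattern F b transferred_color y = q].
Proof.
move=> eta0 pe; have mroot : measurable_fun setT root.
  exact: (meas_glue mkappa (f := fun i y => b (g i) y) (fun i => measurable_act pb _)).
have mN : measurable [set y | exists k, root (b (F k) y) <> root y].
  apply: meas_ex => k; apply: meas_not.
  exact: (measurable_eq mU sepU (measurableT_comp mroot (measurable_act pb (F k))) mroot).
have [mG pG] := good_sample_pr.
have mP : measurable [set y | pattern F b transferred_color y = q].
  exact: (discr_meas_pattern F pb discr_meas_transferred_color).
rewrite lerBlDr; apply: le_trans (sum_pr_sampled q eta0) _.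
have mS i : measurable [set z | (kappa (b (g i)^-1%g z) == i) && ((xi z).2 i == q)].
  apply: (@discr_meas_set _ _ _ (fun z => (kappa (b (g i)^-1%g z), xi z))
    (fun jv => (jv.1 == i) && (jv.2.2 i == q))).
  by apply: discr_meas_pair => //; exact: (discr_meas_preim (measurable_act pb _)).
pose W := [set y | (xi (root y)).2 (kappa y) = q].
have mW : measurable W.
  exact: (@discr_meas_set _ _ ('I_N * V)%type (fun y => (kappa y, xi (root y)))
    (fun iv => iv.2.2 iv.1 = q) (discr_meas_pair mkappa discr_meas_xi_root)).
(* Mass transport: the points named [i] are counted at their roots, by invariance under [g i]. *)
have -> : \sum_i pr [set z | (kappa (b (g i)^-1%g z) == i) && ((xi z).2 i == q)] = pr W.
  rewrite (pr_sum mu mkappa mW); apply: eq_bigr => i _.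
  rewrite -(pr_act pb (g i) (mS i)); congr (pr _); apply/seteqP; split=> y /=.
    by rewrite actK /W /= => /andP[/eqP ky /eqP <-]; rewrite /root /castle_root ky.
  by rewrite actK /W /= => -[<- ky]; rewrite ky /root /castle_root ky !eqxx.
have sub : W `<=` [set y | pattern F b transferred_color y = q] `|`
    ([set y | exists k, root (b (F k) y) <> root y] `|` [set y | ~ good_sample (root y)]).
  move=> y Wy; have [gy|ngy] := pselect (good_sample (root y)); last by right; right.
  have [inner|ninner] := pselect (forall k, root (b (F k) y) = root y).
    by left; rewrite /= pattern_transferred.
  by right; left; apply/existsNP.
have mNG := measurableU _ _ mN mG.
apply: le_trans (pr_le mu mW (measurableU _ _ mP mNG) sub) _.
have := prU_le mu mP mNG; have := prU_le mu mN mG; rewrite pG.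
by move: pe; rewrite -/root; lra.
Qed.

End Sampled.

End Sampling.

Lemma transfer_ex (I : finType) m (F : 'I_m -> free_group n) (c : X -> I) (e : R) :
  hyperfinite mu b -> discr_meas c -> 0 < e ->
  exists c' : X -> I, discr_meas c' /\ forall q,
    pr [set x | pattern F a c x = q] - e <= pr [set y | pattern F b c' y = q].
Proof.
move=> hyp mc e0; have e3 : 0 < e / 3 by lra.
have [N [g [kappa [mkappa pk]]]] := castle_ex mU sepU pb F hyp e3.
(* The order of choices matters: the tiling fixes [N], then [eta] makes [N%:R * eta] small, and only
   then are the scales chosen with an energy gap of at most [(e / 3) * eta]. The remaining third is
   the boundary of the tiles. *)
pose eta : R := (e / 3) / N.+1%:R.
have eta0 : 0 < eta by rewrite divr_gt0.
have Neta : N%:R * eta <= e / 3.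
  by rewrite /eta mulrA ler_pdivrMr // mulrC ler_pM2l // ler_nat.
have th0 : 0 < (e / 3) * eta by rewrite mulr_gt0.
pose roots := [seq (g ijk.1.2 * (F ijk.2 * (g ijk.1.1)^-1))%g | ijk <- enum {: 'I_N *
  'I_N * 'I_m}].
pose edges := [seq (g ikl.1.1 * ((F ikl.2)^-1 * (F ikl.1.2 * (g ikl.1.1)^-1)))%g | ikl
  <- enum {: 'I_N * 'I_m * 'I_m}].
have [M0 M0P] := pickle_bound (roots ++ edges).
have [M1 [M [M2 [M0M Mg MV Men]]]] := radius_ex g mkappa M0 th0.
have Mroot i j k : (pickle (g j * (F k * (g i)^-1))%g < M)%N.
  apply: leq_trans M0M; apply: M0P; rewrite mem_cat; apply/orP; left.
  by apply/mapP; exists (i, j, k); rewrite ?mem_enum.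
have Medge i k l : (pickle (g i * ((F l)^-1 * (F k * (g i)^-1)))%g < M)%N.
  apply: leq_trans M0M; apply: M0P; rewrite mem_cat; apply/orP; right.
  by apply/mapP; exists (i, k, l); rewrite ?mem_enum.
have [x0 _] := probability_inhabited mu.
have [xi [mxi xiP]] := atomless_partition mU sepU mu_atomless
  (sample g F c M x0) (discr_meas_tile g mkappa (M := M))
  (weight_ge0 g kappa F c (M := M)) (fun j => sum_weight g mkappa F mc j).
exists (transferred_color g kappa F c xi x0); split.
  exact: discr_meas_transferred_color.
move=> q; have H := transferred_color_pr mkappa mc Mg MV Mroot Medge mxi xiP x0 q eta0 pk.
apply: le_trans H; rewrite -addrA -opprD lerD2l lerN2.
have : (\sum_i (energy mu (kappa @^-1` [set i]) (stab_type b M2) -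
   energy mu (kappa @^-1` [set i]) (stab_type b M1))) / eta <= e / 3.
  by rewrite ler_pdivrMr.
by lra.
Qed.

End Transfer.

(** * Assembling the conjugacy *)

Lemma partial_iso_glue (R : realType) d (X : measurableType d) (mu : probability X R)
    (J : finType) (P P' : X -> J) (A B : J -> set X) (f h : J -> X -> X) :
  discr_meas P -> discr_meas P' ->
  (forall q, partial_iso mu (A q) (B q) (f q) (h q)) ->
  (forall q x, A q x -> P x = q) -> (forall q y, B q y -> P' y = q) ->
  partial_iso mu [set x | A (P x) x] [set y | B (P' y) y]
    (fun x => f (P x) x) (fun y => h (P' y) y).
Proof.
move=> mP mP' iso AP BP.
have mA q : measurable (A q) by case: (iso q) => [[]].
have mB q : measurable (B q) by case: (iso q) => [[]].
have glue (Q : X -> J) C : discr_meas Q -> (forall q, measurable (C q)) ->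
    measurable [set x : X | C (Q x) x].
  move=> mQ mC; rewrite (_ : [set x | _] = [set x | exists q : J, Q x = q /\ C q x]).
    by apply: meas_ex => q; apply: meas_and; [exact: mQ | exact: mC].
  by apply/seteqP; split=> x /=; [exists (Q x) | move=> [q [->]]].
have mf q : measurable_fun setT (f q) by case: (iso q) => _ [].
have mh q : measurable_fun setT (h q) by case: (iso q) => _ [].
have mF := meas_glue mP mf.
split.
- by split; exact: glue.
- by split; exact: meas_glue.
- move=> x /= Ax; have [_ _ fP _ _] := iso (P x); have [Bf hf] := fP x Ax.
  by rewrite (BP _ _ Bf).
- move=> y /= By; have [_ _ _ hP _] := iso (P' y); have [Ah fh] := hP y By.
  by rewrite (AP _ _ Ah).
- move=> S mS; rewrite (pr_sum mu mP); last first.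
    by apply: meas_and; [exact: glue | exact: (meas_preim mF)].
  rewrite (pr_sum mu mP'); last by apply: measurableI => //; exact: glue.
  apply: eq_bigr => q _; have [_ _ fP _ mp] := iso q.
  transitivity (pr mu [set x | A q x /\ S (f q x)]).
    congr (pr _ _); apply/seteqP; split=> x /=; first by move=> [[Ax Sx] xq]; rewrite -xq.
    by move=> [Ax Sx]; have xq := AP _ _ Ax; rewrite xq.
  rewrite mp //; congr (pr _ _); apply/seteqP; split=> y /=.
    by move=> [By Sy]; have yq := BP _ _ By; rewrite yq.
  by move=> [[By Sy] yq]; rewrite -yq.
Qed.

(** * From a matching of roots to a matching of tiles *)

Section Spread.
Context (R : realType) (n : nat) d (X : measurableType d) (mu : probability X R).
Variables a b : gaction n X.
Hypotheses (pa : pmp mu a) (pb : pmp mu b).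
Variables (N : nat) (g : 'I_N -> free_group n) (kappa kappa' : X -> 'I_N).
Hypotheses (mk : discr_meas kappa) (mk' : discr_meas kappa').
Variables (A B : set X) (f h : X -> X).
Hypothesis iso : partial_iso mu A B f h.
Hypothesis kf : forall z, A z ->
  forall i, kappa (a (g i)^-1%g z) = kappa' (b (g i)^-1%g (f z)).

(** By [kf], a matched pair of roots is named by the same indices [i], so the points named [i] can
    be paired. Measure is preserved name by name, after moving the points to their roots by
    invariance. *)
Lemma partial_iso_spread :
  partial_iso mu [set x | A (castle_root a g kappa x)] [set y | B (castle_root b g
    kappa' y)]
    (fun x => b (g (kappa x))^-1%g (f (castle_root a g kappa x)))
    (fun y => a (g (kappa' y))^-1%g (h (castle_root b g kappa' y))).
Proof.
have [[mA mB] [mf mh] fP hP mp] := iso.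
have mrt (e : gaction n X) k : pmp mu e -> discr_meas k ->
  measurable_fun setT (castle_root e g k).
  by move=> pe mk0; exact: (meas_glue mk0 (f := fun i y => e (g i) y) (fun i =>
    measurable_act pe _)).
have mra := mrt a kappa pa mk; have mrb := mrt b kappa' pb mk'.
have mF : measurable_fun setT (fun x =>
  b (g (kappa x))^-1%g (f (castle_root a g kappa x))).
  apply: (meas_glue mk (f := fun i x => b (g i)^-1%g (f (castle_root a g kappa x)))) => i.
  by apply: (measurableT_comp (measurable_act pb _)); exact: measurableT_comp.
have mH : measurable_fun setT (fun y =>
  a (g (kappa' y))^-1%g (h (castle_root b g kappa' y))).
  apply: (meas_glue mk' (f := fun i y =>
    a (g i)^-1%g (h (castle_root b g kappa' y)))) => i.
  by apply: (measurableT_comp (measurable_act pa _)); exact: measurableT_comp.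
have mD : measurable [set x | A (castle_root a g kappa x)] by exact: meas_preim.
have mE : measurable [set y | B (castle_root b g kappa' y)] by exact: meas_preim.
split=> //.
- move=> x /= Az; have [Bw hw] := fP _ Az; have E := kf Az (kappa x).
  have yE : kappa' (b (g (kappa x))^-1%g (f (castle_root a g kappa x))) = kappa x.
    by rewrite -E /castle_root actK.
  by rewrite /castle_root yE actVK; split=> //; rewrite hw /castle_root actK.
- move=> y /= Bw; have [Az fz] := hP _ Bw; have E := kf Az (kappa' y).
  have xE : kappa (a (g (kappa' y))^-1%g (h (castle_root b g kappa' y))) = kappa' y.
    by rewrite E fz /castle_root actK.
  by rewrite /castle_root xE actVK; split=> //; rewrite fz /castle_root actK.
- move=> S mS; rewrite (pr_sum mu mk); last first.
    by apply: meas_and => //; exact: (meas_preim mF).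
  rewrite (pr_sum mu mk'); last exact: measurableI.
  apply: eq_bigr => i _.
  have mSi : measurable [set w | S (b (g i)^-1%g w)] by exact: (meas_preim
    (measurable_act pb _)).
  pose T := [set w | kappa' (b (g i)^-1%g w) = i /\ S (b (g i)^-1%g w)].
  have mT : measurable T.
    by apply: meas_and => //; exact: (discr_meas_preim (measurable_act pb _) mk').
  transitivity (pr mu [set z | A z /\ T (f z)]).
    have mAT : measurable [set z | A z /\ T (f z)] by apply: meas_and => //;
      exact: meas_preim.
    rewrite -(pr_act pa (g i) mAT); congr (pr _ _); apply/seteqP; split=> x /=.
      move=> [[Az Sx] xi]; rewrite /castle_root xi in Az Sx; split=> //.
      by split; rewrite // -kf // actK.
    move=> [Az [+ Sx]]; rewrite -kf // actK => xi.
    by rewrite /castle_root xi.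
  rewrite mp // -(pr_act pb (g i) (measurableI _ _ mB mT)); congr (pr _ _).
  apply/seteqP; split=> y /=.
    by move=> [By]; rewrite /T /= actK => -[yi Sy]; rewrite /castle_root yi.
  by move=> [[By Sy] yi]; rewrite /castle_root yi in By; rewrite /T /= actK.
Qed.

End Spread.

Lemma pr_setC_root_le (R : realType) (n : nat) d (X : measurableType d)
    (mu : probability X R) (a : gaction n X) N (g : 'I_N -> free_group n) (kappa : X ->
      'I_N)
    (A : set X) : pmp mu a -> discr_meas kappa -> measurable A ->
  measurable [set x | ~ A (castle_root a g kappa x)] /\
  pr mu [set x | ~ A (castle_root a g kappa x)] <= N%:R * pr mu (~` A).
Proof.
move=> pa mk mA; have mC : measurable (~` A) by exact: measurableC.
have mAi i : measurable [set x | (~` A) (a (g i) x)] by exact: (meas_preim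
  (measurable_act pa _)).
have mr : measurable_fun setT (castle_root a g kappa).
  exact: (meas_glue mk (f := fun i y => a (g i) y) (fun i => measurable_act pa _)).
have mD : measurable [set x | ~ A (castle_root a g kappa x)] by exact: (meas_preim mr mC).
split=> //; apply: (@le_trans _ _ (pr mu [set x | exists i, (~` A) (a (g i) x)])).
  by apply: pr_le => //; [exact: meas_ex | move=> x nA; exists (kappa x)].
apply: le_trans (pr_ex_le mu mAi) _.
rewrite (eq_bigr (fun=> pr mu (~` A))); last by move=> i _; rewrite pr_act.
by rewrite sumr_const card_ord -[leLHS]mulr_natl.
Qed.

Theorem theorem9 (R : realType) (n : nat) (d : measure_display)
    (X : measurableType d) (mu : probability X R) (a b : gaction n X) :
  standard_borel R X -> atomless mu ->
  pmp mu a -> pmp mu b ->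
  hyperfinite mu a -> hyperfinite mu b ->
  same_type mu mu a b ->
  strongly_equivalent mu mu a b.
Proof.
move=> sX mu0 pa pb ha hb ab e e0.
have [U bc] := standard_borel_coding mu sX; have [mU sepU _ _] := bc.
have e3 : 0 < e / 3 by lra.
pose ls := enum {: letter n}.
pose F0 (k : 'I_(size ls)) := gen (tnth (in_tuple ls) k).
have [N [g [kappa [mk pk]]]] := castle_ex mU sepU pa F0 ha e3.
pose rt := castle_root a g kappa.
(* Seen from a root, the first elements reach the possible tile points, whose colors tell which are
   in the tile; comparing them with the second ones tells how each generator acts inside the
   tile. *)
pose fl := [seq (g i)^-1%g | i <- enum 'I_N] ++
  [seq (gen si.1 * (g si.2)^-1)%g | si <- enum {: letter n * 'I_N}].
pose F (k : 'I_(size fl)) := tnth (in_tuple fl) k.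
have FP h : h \in fl -> exists k, F k = h by move=> /(tnthP (in_tuple fl)) [k ->];
  exists k.
have FV i : exists k, F k = (g i)^-1%g.
  by apply: FP; rewrite mem_cat; apply/orP; left; apply: map_f; rewrite mem_enum.
have FS s i : exists k, F k = (gen s * (g i)^-1)%g.
  apply: FP; rewrite mem_cat; apply/orP; right; apply/mapP.
  by exists (s, i); rewrite ?mem_enum.
pose J : finType := ({ffun 'I_(size fl) -> 'I_N} * {ffun 'I_(size fl) * 'I_(size fl) ->
  bool})%type.
(* Each of the [#|J|] patterns loses at most [dl] in the transfer of frequencies and [dl] in the
   matching, and an unmatched root spoils at most [N] translates. *)
pose dl := (e / 3) / (N * (#|J| * 2)).+1%:R.
have dl0 : 0 < dl by rewrite divr_gt0.
have [c' [mc' prc']] := transfer_ex mU sepU mu0 pa pb ab F hb mk dl0.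
pose P := pattern F a kappa; pose P' := pattern F b c'.
have mP : discr_meas P by exact: (discr_meas_pattern mU sepU F pa mk).
have mP' : discr_meas P' by exact: (discr_meas_pattern mU sepU F pb mc').
have /choice[ABfh isoq] (q : J) : exists ABfh : (set X * set X) * ((X -> X) * (X -> X)),
    [/\ partial_iso mu ABfh.1.1 ABfh.1.2 ABfh.2.1 ABfh.2.2,
        ABfh.1.1 `<=` [set x | P x = q], ABfh.1.2 `<=` [set x | P' x = q] &
        pr mu ([set x | P x = q] `\` ABfh.1.1) <= dl + dl].
  have [A [B [f [h [iso AP BP prA]]]]] := partial_iso_approx bc mu0 (mP q) (mP' q) dl0.
  exists (A, B, (f, h)); split=> //=.
  have mA : measurable A by case: iso => [[]].
  have := prDI mu (mP q) mA; rewrite (setIidr AP).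
  have := prc' q; rewrite -/P -/P'.
  move: prA; have [_|_] := leP (pr mu [set x | P x = q]) (pr mu [set x | P' x = q]).
    by move: (pr mu [set x | P x = q]) (pr mu [set x | P' x = q]) (pr mu A) dl0 => *; lra.
  by move: (pr mu [set x | P x = q]) (pr mu [set x | P' x = q]) (pr mu A) dl0 => *; lra.
pose A q := (ABfh q).1.1; pose B q := (ABfh q).1.2.
pose f q := (ABfh q).2.1; pose h q := (ABfh q).2.2.
have AP q x : A q x -> P x = q by case: (isoq q) => _ H _ _ /H.
have BP q x : B q x -> P' x = q by case: (isoq q) => _ _ H _ /H.
have iso0 : partial_iso mu [set x | A (P x) x] [set y | B (P' y) y]
    (fun x => f (P x) x) (fun y => h (P' y) y).
  by apply: partial_iso_glue => // q; case: (isoq q).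
set A0 := [set x | A (P x) x] in iso0; set B0 := [set y | B (P' y) y] in iso0.
set f0 := fun x => f (P x) x in iso0; set h0 := fun y => h (P' y) y in iso0.
have patE z : A0 z -> P z = P' (f0 z).
  move=> Az; have [_ _ fP _ _] := iso0; have [/BP H _] := fP z Az.
  have [[_ _ fqP _ _] _ _ _] := isoq (P z).
  by have [/BP -> _] := fqP z Az.
have kf z : A0 z -> forall i, kappa (a (g i)^-1%g z) = c' (b (g i)^-1%g (f0 z)).
  move=> Az i; have [k <-] := FV i; exact: (pattern_color (patE z Az)).
have isoD := partial_iso_spread pa pb mk mc' iso0 kf.
set D := [set x | A0 _] in isoD; set f1 := (fun x => b _ _) in isoD.
have [rho [rho' [K1 K2 mp1 mp2 [Nl [mNl prN rhoE]]]]] := partial_iso_extend isoD.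
exists rho, rho'; split=> //.
have [mA0 _] : measurable A0 /\ measurable B0 by case: iso0.
have prA0 : pr mu (~` A0) <= #|J|%:R * (dl + dl).
  have mAq q : measurable (A q) by case: (isoq q) => [[[]]].
  have mDq q : measurable ([set x | P x = q] `\` A q) by apply: measurableD => //;
    exact: mP.
  apply: (@le_trans _ _ (pr mu [set x | exists q, ([set x | P x = q] `\` A q) x])).
    apply: pr_le; [exact: measurableC | exact: meas_ex |].
    by move=> x nA; exists (P x).
  apply: le_trans (pr_ex_le mu mDq) _.
  apply: (@le_trans _ _ (\sum_(q : J) (dl + dl))).
    by apply: ler_sum => q _; case: (isoq q).
  by rewrite sumr_const -[leLHS]mulr_natl.
have [mND prND] := pr_setC_root_le g pa mk mA0.
have prND3 : pr mu [set x | ~ A0 (castle_root a g kappa x)] <= e / 3.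
  apply: le_trans prND _; apply: (@le_trans _ _ (N%:R * (#|J|%:R * (dl + dl)))).
    by rewrite ler_wpM2l.
  rewrite (_ : N%:R * (#|J|%:R * (dl + dl)) = (N * (#|J| * 2))%:R * dl); last first.
    by rewrite !natrM; ring.
  rewrite /dl mulrA ler_pdivrMr // mulrC ler_pM2l // ler_nat //.
have mrho : measurable_fun setT rho by case: mp1.
have mrt : measurable_fun setT rt.
  exact: (meas_glue mk (f := fun i y => a (g i) y) (fun i => measurable_act pa _)).
pose bd := [set x | exists k, rt (a (F0 k) x) <> rt x].
have mbd : measurable bd.
  apply: meas_ex => k; apply: meas_not.
  exact: (measurable_eq mU sepU (measurableT_comp mrt (measurable_act pa (F0 k))) mrt).
have mNs s : measurable [set x | Nl (a (gen s) x)] by exact: (meas_preim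
  (measurable_act pa _)).
pose Ns := [set x | exists s : letter n, Nl (a (gen s) x)].
have mNs' : measurable Ns by exact: meas_ex.
have prNs : pr mu Ns = 0.
  apply/eqP; rewrite eq_le pr_ge0 andbT; apply: le_trans (pr_ex_le mu mNs) _.
  by rewrite big1 // => s _; rewrite (pr_act pa (gen s) mNl).
pose G := [set x | forall s, rho (a (gen s) x) = b (gen s) (rho x)].
have mG : measurable G.
  apply: meas_all => s.
  exact: (measurable_eq mU sepU (measurableT_comp mrho (measurable_act pa (gen s)))
    (measurableT_comp (measurable_act pb (gen s)) mrho)).
pose ND := [set x | ~ A0 (castle_root a g kappa x)].
have sub : ~` G `<=` (ND `|` bd) `|` (Nl `|` Ns).
  move=> x nG; apply: contrapT => good; apply: nG => s.
  have Dx : D x by apply: contrapT => nD; apply: good; left; left.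
  have inner t : rt (a (gen t) x) = rt x.
    apply: contrapT => nt; apply: good; left; right.
    have [k tk] : exists k, tnth (in_tuple ls) k = t.
      have : t \in ls by rewrite mem_enum.
      by move=> /(tnthP (in_tuple ls))[k ->]; exists k.
    by exists k; rewrite /F0 tk.
  have nN : ~ Nl x by move=> Nx; apply: good; right; left.
  have nNs : ~ Nl (a (gen s) x) by move=> Nx; apply: good; right; right; exists s.
  have Dsx : D (a (gen s) x) by rewrite /D /= -/rt inner.
  rewrite !rhoE // /f1 /= -/rt inner.
  have [k kE] := FS s (kappa x); have [l lE] := FV (kappa (a (gen s) x)).
  (* As [x] and its image under [s] have the same root, equivariance at [x] is a coincidence of two
     translates of this root; matched roots have the same pattern, so the coincidence also holds for
     [b]. *)
  have := pattern_edge (patE _ Dx) k l; rewrite kE lE !actM => -[H _].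
  symmetry; apply: H; rewrite -/rt.
  have -> : a (g (kappa x))^-1%g (rt x) = x by rewrite /rt /castle_root actK.
  by rewrite -(inner s) /rt /castle_root actK.
have mND' : measurable (ND `|` bd) by exact: measurableU.
have mNN : measurable (Nl `|` Ns) by exact: measurableU.
have H1 := pr_le mu (measurableC mG) (measurableU _ _ mND' mNN) sub.
have H2 := prU_le mu mND' mNN; have H3 := prU_le mu mND mbd;
  have H4 := prU_le mu mNl mNs'.
have H5 := prC mu mG; rewrite prN prNs in H4.
have pk' : pr mu bd <= e / 3 by exact: pk.
rewrite prE // lte_fin -/G.
by move: H1 H2 H3 H4 H5 pk' prND3; rewrite -/ND; lra.
Qed.
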